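(* Let $1\le l<k\le n$, let $w=w_0\cdot t_{l,k}\in S_n$ and let $v<w$. Denote by $(a_1,b_1)=(n-k+2,l)$ and $(a_2,b_2)=(n-l+1,k-1)$ the two elements of $\mathrm{Ess}(w)$ (or the unique element, since these coincide when $t_{l,k}$ is a simple reflection), and by $p$ the complexity of $\mathcal N_{v,w}$. \begin{enumerate} \item If $r_v(a_1,b_1)<l-1$ and $r_v(a_2,b_2)<l-1$, then $p=\nu(G_{v,w})-|D^\circ(w)|=|P_v|-2(k-l)+1$. \item If $r_v(a_1,b_1)=l-1$ and $r_v(a_2,b_2)<l-1$, or $r_v(a_1,b_1)<l-1$ and $r_v(a_2,b_2)=l-1$, then $p=\nu(G_{v,w})-|D^\circ(w)|+(k-l)=\nu(G_{v,w})+l-k+1$. \item If $r_v(a_1,b_1)=r_v(a_2,b_2)=l-1$, then $p=\nu(G_{v,w})$, and $\mathcal N_{v,w}$ is toric if and only if $G_{v,w}$ is a forest. \end{enumerate}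
   Context: $w_0$ is the longest permutation, $w_0(i)=n+1-i$; $t_{a,b}$ is the transposition of $a$ and $b$ (right multiplication swaps positions). A permutation $v\in S_n$ is identified with the permutation matrix having $1$s at $(v(j),j)$; $r_v(a,b)$ is the rank of its submatrix with rows $a,\dots,n$ and columns $1,\dots,b$. $D^\circ(v)=\{(i,j): v(j)<i,\ v^{-1}(i)>j\}$ is the opposite Rothe diagram, and $\mathrm{Ess}(v)$ is the set of north-east corners of its connected components. $\le$ is the Bruhat order, $\ell$ the Coxeter length. Let $B$ (resp. $B_-$) be the upper (resp. lower) triangular Borel subgroup of $G=GL_n(\mathbb C)$ and $T$ the diagonal torus. For $v\le w$ the Kazhdan-Lusztig variety is $\mathcal N_{v,w}=\overline{BwB/B}\cap B_-vB/B\subset G/B$, of dimension $\ell(w)-\ell(v)=|D^\circ(v)|-|D^\circ(w)|$. The usual torus action is that of $T$ by left multiplication; its weight cone is $\sigma_{v,w}=\mathrm{Cone}(e_{v(j)}-e_i : (i,j)\in D^\circ(v),\ t_{v(j),i}\,v\le w)\subset\mathbb R^n$. The complexity is $\dim\mathcal N_{v,w}-\dim\sigma_{v,w}$; toric means complexity $0$. $G_{v,w}$ is the directed graph with vertex set $[n]$ and edges $v(j)\to i$ for $(i,j)\in D^\circ(v)$ with $t_{v(j),i}\,v\le w$; being a forest refers to the underlying undirected graph. The cyclomatic number of a graph is $\nu(G)=|E(G)|-|V(G)|+\#(\text{connected components of }G)$. For $(i,j),(i',j')\in D^\circ(v)$ with $i<i'$ and $j<j'$ put $d((i,j),(i',j'))=(i'-i)+(j'-j)$.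 The set $P_v\subseteq D^\circ(v)\times D^\circ(v)$ is defined recursively by increasing distance $d$: (i) $((i,j),(i+1,j+1))\in P_v$ whenever both cells are in $D^\circ(v)$; (ii) a pair $(x,y)$ of cells $x=(i,j)$, $y=(i',j')$ of $D^\circ(v)$ with $i<i'$, $j<j'$ and $d(x,y)=d$ is in $P_v$ if there is not already some $(x,y')\in P_v$ with $d(x,y')<d$ or some $(x',y)\in P_v$ with $d(x',y)<d$. *)

(* Defs.v *)
From HB Require Import structures.
From mathcomp Require Import all_boot all_order all_algebra all_fingroup.
From mathcomp Require Import boolp classical_sets reals.
From mathcomp Require Import complex mpoly.

Set Implicit Arguments.
Unset Strict Implicit.
Unset Printing Implicit Defensive.

Import Order.TTheory GRing.Theory Num.Theory.

(* All positions, values, rows and columns are 0-based: 'I_n stands for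
   {1, ..., n} via i |-> i + 1. *)

Section Permutations.
Context {n : nat}.
Implicit Types u v w : 'S_n.

Definition cell : finType := ('I_n * 'I_n)%type.

(* The product of the symmetric group acting on the left, (u v)(j) = u (v j);
   the product of fingroup composes in the other order. *)
Definition perm_comp u v : 'S_n := (v * u)%g.

Definition w0 : 'S_n := perm (@rev_ord_inj n).

Definition coxeter_length v : nat :=
  #|[set c : cell | (c.1 < c.2) && (v c.2 < v c.1)]|.

Definition bruhat_step : rel 'S_n := fun u v =>
  [exists a : 'I_n, exists b : 'I_n,
     (v == perm_comp u (tperm a b)) && (coxeter_length u < coxeter_length v)].

Definition bruhat_le : rel 'S_n := connect bruhat_step.

Definition bruhat_lt : rel 'S_n := fun u v => (u != v) && bruhat_le u v.

Definition perm_matrix (F : nzRingType) v : 'M[F]_n :=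
  \matrix_(i, j) (v j == i)%:R%R.

(* Rank of the submatrix of rows a, a + 1, ... and columns 0, ..., b. *)
Definition sw_rank v (a b : nat) : nat :=
  let rows := [set i : 'I_n | a <= i] in
  let cols := [set j : 'I_n | j <= b] in
  \rank (mxsub (fun i : 'I_#|rows| => enum_val i)
               (fun j : 'I_#|cols| => enum_val j) (perm_matrix rat v)).

Definition opp_rothe v : {set cell} :=
  [set c : cell | (v c.2 < c.1) && (c.2 < (v^-1)%g c.1)].

(* A cell is a north-east corner of its connected component when neither the
   cell above it nor the cell to its right is in the diagram: adjacent cells of
   the diagram are in the same component. *)
Definition ess v : {set cell} :=
  [set c in opp_rothe v |
    ~~ [exists c' in opp_rothe v,
         ((c'.1.+1 == c.1 :> nat) && (c'.2 == c.2)) ||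
         ((c'.1 == c.1) && (c'.2 == c.2.+1 :> nat))]].

(* The cells (i, j) of the diagram of v with t_{v(j), i} v <= w. *)
Definition weight_cells v w : {set cell} :=
  [set c in opp_rothe v | bruhat_le (perm_comp (tperm (v c.2) c.1) v) w].

Definition graph_edges v w : {set 'I_n * 'I_n} :=
  [set (v c.2, c.1) | c in weight_cells v w].

Definition strictly_se (x y : cell) : bool := (x.1 < y.1) && (x.2 < y.2).

Definition cell_dist (x y : cell) : nat := (y.1 - x.1) + (y.2 - x.2).

(* The pairs of P_v at distance at most d. *)
Fixpoint P_upto v (d : nat) : {set cell * cell} :=
  if d is d'.+1 then
    P_upto v d' :|:
    [set q : cell * cell |
      [&& q.1 \in opp_rothe v, q.2 \in opp_rothe v, strictly_se q.1 q.2,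
          cell_dist q.1 q.2 == d &
          ((q.2.1 == q.1.1.+1 :> nat) && (q.2.2 == q.1.2.+1 :> nat)) ||
          ~~ ([exists y', (q.1, y') \in P_upto v d'] ||
              [exists x', (x', q.2) \in P_upto v d'])]]
  else finset.set0.

(* Distances between cells are less than 2 n. *)
Definition P_set v : {set cell * cell} := P_upto v (n + n).

End Permutations.

Section Graphs.
Variables (V : finType) (E : {set V * V}).

Definition undirected : rel V := fun a b => ((a, b) \in E) || ((b, a) \in E).

(* Meaningful when E has no loops and no antiparallel edges, as is the case for
   graph_edges v w, all of whose edges (a, b) satisfy a < b. *)
Definition is_forest : Prop :=
  ~ exists c : seq V, ucycle undirected c /\ 2 < size c.

Definition cyclomatic : int :=
  (#|E|%:Z - #|V|%:Z + (n_comp undirected predT)%:Z)%R.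

End Graphs.

Local Open Scope classical_set_scope.
Local Open Scope ring_scope.

(* Krull dimension of a subspace S of the topological space X whose closed sets
   are given by cl. The value for an empty or infinite-dimensional S is
   unspecified. *)
Section KrullDimension.
Variables (X : Type) (cl : set (set X)).

Definition relatively_closed (S Z : set X) : Prop :=
  exists2 F, cl F & Z = S `&` F.

Definition irreducible_set (Z : set X) : Prop :=
  Z !=set0 /\
  forall F1 F2, cl F1 -> cl F2 -> Z `<=` F1 `|` F2 -> Z `<=` F1 \/ Z `<=` F2.

Definition irreducible_chain (S : set X) (m : nat) : Prop :=
  exists Z : nat -> set X,
    (forall i, (i <= m)%N -> relatively_closed S (Z i) /\ irreducible_set (Z i))
    /\ (forall i, (i < m)%N -> Z i `<` Z i.+1).

Definition krull_dim (S : set X) : nat :=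
  get [set d | irreducible_chain S d /\
               forall m, irreducible_chain S m -> (m <= d)%N].

End KrullDimension.

(* R[i] is the field of complex numbers. *)
Section FlagVariety.
Context {R : realType} {n : nat}.
Local Notation C := (R[i]).
Implicit Types v w : 'S_n.

Definition GL : set 'M[C]_n := [set g | g \in unitmx].

Definition borel : set 'M[C]_n := [set b | b \in unitmx /\ is_trig_mx b^T].

Definition borel_opp : set 'M[C]_n := [set b | b \in unitmx /\ is_trig_mx b].

Definition zariski_closed_GL (A : set 'M[C]_n) : Prop :=
  exists I : set {mpoly C[n * n]},
    A = [set g | GL g /\ forall p, I p -> p.@[fun k => mxvec g 0 k] = 0].

(* The coset g B, as a set of matrices. *)
Definition coset_borel (g : 'M[C]_n) : set 'M[C]_n :=
  [set g *m b | b in borel].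

Definition flag_variety : set (set 'M[C]_n) := [set coset_borel g | g in GL].

(* The Zariski topology of G/B is the quotient topology. *)
Definition zariski_closed_flag (Y : set (set 'M[C]_n)) : Prop :=
  Y `<=` flag_variety /\ zariski_closed_GL [set g | GL g /\ Y (coset_borel g)].

Definition zariski_closure_flag (Y : set (set 'M[C]_n)) : set (set 'M[C]_n) :=
  \bigcap_(F in [set F | zariski_closed_flag F /\ Y `<=` F]) F.

Definition schubert_cell w : set (set 'M[C]_n) :=
  [set coset_borel (b *m perm_matrix C w) | b in borel].

Definition opp_schubert_cell v : set (set 'M[C]_n) :=
  [set coset_borel (b *m perm_matrix C v) | b in borel_opp].

Definition kl_variety v w : set (set 'M[C]_n) :=
  zariski_closure_flag (schubert_cell w) `&` opp_schubert_cell v.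

End FlagVariety.

Section Complexity.
Variables (R : realType) (n : nat).
Implicit Types v w : 'S_n.

Definition weight_cone v w : set 'rV[R]_n :=
  [set x | exists a : cell -> R, (forall c, 0 <= a c) /\
     x = \sum_(c in weight_cells v w)
            a c *: (delta_mx 0 (v c.2) - delta_mx 0 c.1)].

(* The dimension of a cone is the dimension of its linear span. *)
Definition cone_dim (K : set 'rV[R]_n) : nat :=
  get [set d | exists U : {vspace 'rV[R]_n},
    [/\ forall x, K x -> x \in U,
        forall U' : {vspace 'rV[R]_n},
          (forall x, K x -> x \in U') -> (U <= U')%VS
      & \dim U = d]].

Definition complexity v w : int :=
  (krull_dim (@zariski_closed_flag R n) (kl_variety v w))%:Z
  - (cone_dim (weight_cone v w))%:Z.

Definition is_toric v w : Prop := complexity v w = 0.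

End Complexity.

(* Main.v *)
Require Import Defs.
From mathcomp Require Import all_boot all_order all_algebra all_fingroup.
From mathcomp Require Import reals.
From mathcomp Require Import zify ring.

(* The permutations below [w] are those satisfying the rank bounds at the two
   essential cells of [w], so the cells of [D(v)] missing from the graph are those
   whose swap breaks a tight bound; counting them compares [|E(G)|] with [|D(v)|].
   The weight cone spans the space generated by the edge vectors, of dimension
   [n] minus the number of components. The set [P_v] is a partial matching of the
   cells of [D(v)], and a cell [(i, j)] has no partner to its south-east exactly
   when [i] is the largest value of its component in the noninversion graph on the
   positions beyond [j]; adding positions from right to left, such cells account for
   the merging of components, whence [|P_v| = |D(v)| - n + c].

   For the dimension of the Kazhdan-Lusztig variety, the Bruhat decomposition
   identifies it with the matrices of the slice [vU_- /\ U_-v] having a relation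
   among the columns of one south-west block and a relation among the rows of the
   other. Normalizing one coefficient in each relation covers these matrices by
   finitely many polynomial images of affine spaces, all of dimension
   [|D(v)| - 2(k - l) + 1]. A chain of irreducible closed sets of length [m] yields
   [m] algebraically independent functions, which bounds its length by this number
   of parameters, and a flag of coordinate subspaces in one chart attains it. *)

Set Implicit Arguments.
Unset Strict Implicit.
Unset Printing Implicit Defensive.

Import Order.TTheory GRing.Theory Num.Theory.

(** * Permutations below [w] *)

(** All three cases are instances of [p = nu - |D(w)| + m], where [m] is the number of cells of
    [D(v)] missing from the graph: [0], [k - l] or [2(k - l) - 1], according to how many of the two
    rank bounds are tight. Two obstacles shape the rest. [P_v] comes from a recursion on distance,
    which resists counting; it is replaced by a local condition on pairs of cells, and the resulting
    matching is stable for the preference for closer cells, so that greedy selection must return it.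
    The Krull dimension concerns chains of closed sets of cosets, not of matrices; functions on the
    slice are therefore extended to relative invariants of the Borel subgroup built from minors, and
    closed sets are compared through the polynomials vanishing on them. Several charts are needed
    because a relation is determined only up to a scalar and in general none of its coefficients is
    sure to be nonzero. Their images need not be open: an irreducible set covered by finitely many
    images lies in the closure of one of them. *)

Lemma perm_comp_tpermE n (u : 'S_n) a b p :
  perm_comp u (tperm a b) p = u (tperm a b p).
Proof. by rewrite /perm_comp permM. Qed.

Lemma perm_comp_tpermK n (u : 'S_n) a b :
  perm_comp (perm_comp u (tperm a b)) (tperm a b) = u.
Proof. by apply/permP => p; rewrite !perm_comp_tpermE tpermK. Qed.

(** Inversions of [u] inject into those of the swap: relabel both positions by [t] if that keeps
    them in order, otherwise keep the pair. The inversion [(a, b)] of the swap is missed. *)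
Lemma coxeter_length_tperm n (u : 'S_n) (a b : 'I_n) : a < b -> u a < u b ->
  coxeter_length u < coxeter_length (perm_comp u (tperm a b)).
Proof.
move=> ab uab; rewrite /coxeter_length; set t := tperm a b.
set A := [set _ | _]; set B := [set _ | _].
pose f (c : 'I_n * 'I_n) := if t c.1 < t c.2 then (t c.1, t c.2) else c.
have f_inj : {in A &, injective f}.
  move=> [p q] [p' q']; rewrite !inE /f /= => /andP [pq _] /andP [pq' _].
  case: ifP => h; case: ifP => h' [] e1 e2.
  - by rewrite (perm_inj e1) (perm_inj e2).
  - by move: h'; rewrite -e1 -e2 !tpermK pq.
  - by move: h; rewrite e1 e2 !tpermK pq'.
  - by rewrite e1 e2.
rewrite -(card_in_imset f_inj); apply/proper_card/properP; split.
  apply/subsetP => _ /imsetP[[p q] pqA ->]; move: pqA; rewrite inE /= => /andP[pq upq].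
  rewrite /f /=; case: ifP => h /=; rewrite !inE /= !perm_comp_tpermE -/t.
    by rewrite h /= !tpermK.
  rewrite pq /=; move: h upq pq; rewrite /t.
  by case: tpermP => [->|->|_ _]; case: tpermP => [->|->|_ _] //; lia.
exists (a, b); first by rewrite !inE /= !perm_comp_tpermE -/t /t tpermL tpermR ab.
apply/imsetP => -[[p q]]; rewrite !inE /f /= => /andP[pq upq].
case: ifP => h [] e1 e2.
  by move: pq; rewrite -[p](tpermK a b) -[q](tpermK a b) -/t -e1 -e2 /t tpermL tpermR; lia.
by move: upq; rewrite -e1 -e2; lia.
Qed.

(** A swap with [u b < u a] shortens, by the previous lemma applied to the swapped permutation; so a
    step always moves the larger value to the left. *)
Lemma bruhat_stepP n (u v : 'S_n) :
  reflect (exists a b : 'I_n, [/\ a < b, u a < u b & v = perm_comp u (tperm a b)])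
          (bruhat_step u v).
Proof.
apply: (iffP existsP) => [[a /existsP[b /andP[/eqP-> lt_uv]]]|[a [b [ab uab ->]]]];
  last first.
  by exists a; apply/existsP; exists b; rewrite eqxx coxeter_length_tperm.
wlog ab : a b lt_uv / a < b => [H|].
  have [ab|ba|/ord_inj eab] := ltngtP a b; first exact: H.
    by rewrite tpermC; apply: H => //; rewrite tpermC.
  by move: lt_uv; rewrite eab tperm1 /perm_comp mul1g ltnn.
exists a, b; split=> //; rewrite ltnNge leq_eqVlt negb_or; apply/andP; split.
  by apply/eqP=> /ord_inj/perm_inj eba; move: ab; rewrite eba ltnn.
apply/negP => uba; have := @coxeter_length_tperm n (perm_comp u (tperm a b)) a b ab.
rewrite perm_comp_tpermK !perm_comp_tpermE tpermL tpermR => /(_ uba).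
by rewrite ltnNge (ltnW lt_uv).
Qed.

Lemma coxeter_length_le n (u : 'S_n) : coxeter_length u <= n * n.
Proof.
by apply: leq_trans (max_card _) _; rewrite card_prod card_ord.
Qed.

(** Agreeing off [A], the two permutations take the same set of values on [A], and a set can be
    listed in decreasing order in one way only. *)
Lemma perm_eq_decreasing_in n (u w : 'S_n) (A : {set 'I_n}) :
    (forall p q : 'I_n, p \in A -> q \in A -> p < q -> u q < u p) ->
    (forall p q : 'I_n, p \in A -> q \in A -> p < q -> w q < w p) ->
    (forall p, p \notin A -> u p = w p) -> u = w.
Proof.
move=> uA wA uwA.
suff le (u' w' : 'S_n) : (forall p q : 'I_n, p \in A -> q \in A -> p < q -> u' q < u' p) ->
    (forall p q : 'I_n, p \in A -> q \in A -> p < q -> w' q < w' p) ->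
    (forall p, p \notin A -> u' p = w' p) ->
    forall p : 'I_n, (forall q : 'I_n, q < p -> u' q = w' q) -> w' p <= u' p.
  apply/permP => p; elim/(@ltn_ind): {p}(p : nat) {-2}p (erefl (p : nat)) => m IH p pm.
  have IHp (q : 'I_n) : q < p -> u q = w q by rewrite pm => qm; exact: (IH q).
  apply/ord_inj/anti_leq; rewrite (le u w uA wA uwA p IHp) andbT.
  by apply: (le w u wA uA _ p) => [q /uwA|q /IHp].
move=> {}uA {}wA {}uwA p Hp; have [pA|/uwA->//] := boolP (p \in A).
rewrite leqNgt; apply/negP => lt_uw.
pose q := (u'^-1)%g (w' p); have uq : u' q = w' p by rewrite permKV.
have qA : q \in A.
  apply/negPn/negP => qA; move: uq; rewrite uwA // => /perm_inj eqp.
  by rewrite eqp pA in qA.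
have [qp|pq|/ord_inj eqp] := ltngtP q p.
- move: uq; rewrite (Hp _ qp) => /perm_inj eqp.
  by rewrite eqp ltnn in qp.
- by have := uA _ _ pA qA pq; rewrite uq; lia.
- by move: lt_uw; rewrite -uq eqp ltnn.
Qed.

Lemma card_ord_ltn n m : m <= n -> #|[set p : 'I_n | p < m]| = m.
Proof.
move=> mn; rewrite -[RHS]card_ord -(card_imset _ (_ : injective (widen_ord mn))).
  2: by move=> p q /(congr1 val) e; apply: ord_inj.
apply: eq_card => p; rewrite inE; apply/idP/imsetP => [pm|[q _ ->]]; last exact: (ltn_ord q).
by exists (Ordinal pm) => //; apply: ord_inj.
Qed.

Lemma card_ord_geq n m : m <= n -> #|[set p : 'I_n | m <= p]| = n - m.
Proof.
move=> mn; have := cardsC [set p : 'I_n | p < m].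
rewrite card_ord_ltn // card_ord => mC.
have -> : [set p : 'I_n | m <= p] = ~: [set p : 'I_n | p < m].
  by apply/setP => p; rewrite !inE -leqNgt.
by lia.
Qed.

Lemma card_perm_geq n (u : 'S_n) m : m <= n -> #|[set p : 'I_n | m <= u p]| = n - m.
Proof.
move=> mn; rewrite -(card_ord_geq mn) -(card_imset _ (@perm_inj _ u)).
apply: eq_card => p; rewrite inE; apply/imsetP/idP => [[q /[!inE] ? ->] //|mp].
by exists ((u^-1)%g p); rewrite ?inE permKV.
Qed.

Section TranspositionOfLongest.
Variables (n : nat) (l k : 'I_n) (w : 'S_n).
Hypotheses (lk : l < k) (wE : w = perm_comp w0 (tperm l k)).
Implicit Types u v : 'S_n.

(* The bounds imposed by [w] on the ranks at the two essential cells; they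
   characterize the permutations below [w], see [bruhat_le_below]. *)
Definition below u :=
  [exists j : 'I_n, (j <= l) && (u j < n - k)] &&
  [exists j : 'I_n, (k <= j) && (n - l.+1 <= u j)].

Lemma belowP u :
  reflect (exists j0 j1 : 'I_n, [/\ j0 <= l, u j0 < n - k, k <= j1 & n - l.+1 <= u j1])
          (below u).
Proof.
apply: (iffP andP) => [[/existsP[j0 /andP[? ?]] /existsP[j1 /andP[? ?]]]|].
  by exists j0, j1.
by move=> [j0 [j1 [? ? ? ?]]]; split; apply/existsP; [exists j0|exists j1]; apply/andP.
Qed.

Lemma wE_nat (p : 'I_n) : w p = (if p == l then n - k.+1 else
   if p == k then n - l.+1 else n - p.+1) :> nat.
Proof.
rewrite wE perm_comp_tpermE /w0 permE /=.
case: tpermP => [->|->|/eqP/negPf-> /eqP/negPf->] //; first by rewrite eqxx.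
by rewrite eqxx ifN //; apply/eqP => ekl; move: lk; rewrite ekl ltnn.
Qed.

Lemma below_w : below w.
Proof.
apply/belowP; exists l, k; rewrite !wE_nat !eqxx.
have -> : (k == l) = false by apply/eqP => e; move: lk; rewrite e ltnn.
by have := ltn_ord k; split; lia.
Qed.

(** Going down a step puts the smaller value at the smaller position. A witness of [v] at [a] or [b]
    is thus replaced by [a] for the first bound and by [b] for the second. *)
Lemma below_step u v : bruhat_step u v -> below v -> below u.
Proof.
move=> /bruhat_stepP[a [b [ab uab ->]]] /belowP[j0 [j1 [h0 h1 h2 h3]]].
move: h1 h3; rewrite !perm_comp_tpermE; set t := tperm a b => h1 h3.
have [i0 [hi0 hi1]] : exists i : 'I_n, i <= l /\ u i < n - k.
  move: h1; rewrite /t; case: tpermP => [e|e|_ _] h1; last by exists j0.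
    by exists a; rewrite -e; split => //; rewrite e; lia.
  by exists a; split => //; move: h0; rewrite e; lia.
have [i1 [hi2 hi3]] : exists i : 'I_n, k <= i /\ n - l.+1 <= u i.
  move: h3; rewrite /t; case: tpermP => [e|e|_ _] h3; last by exists j1.
    by exists b; split => //; move: h2; rewrite e; lia.
  by exists b; rewrite -e; split => //; rewrite e; lia.
by apply/belowP; exists i0, i1.
Qed.

(* Away from the witnesses [j0], [j1] of [below u] the permutation [u] decreases;
   counting large values then forces [j0 = l], [j1 = k] and the values there. *)
Lemma below_maximal u : below u ->
  (forall a b : 'I_n, a < b -> below (perm_comp u (tperm a b)) -> u b < u a) -> u = w.
Proof.
move=> /belowP[j0 [j1 [h0 h1 h2 h3]]] umax.
have ln := ltn_ord l; have kn := ltn_ord k.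
have j01 : j0 != j1 by apply/eqP => e; move: h2; rewrite -e; lia.
have dec (a b : 'I_n) : a < b -> a != j0 -> a != j1 -> b != j0 -> b != j1 -> u b < u a.
  move=> ab a0 a1 b0 b1; apply: umax => //; apply/belowP; exists j0, j1.
  by rewrite !perm_comp_tpermE !tpermD //; split.
have swap_j0 (q : 'I_n) : j0 < q -> q != j1 -> (q <= l) || (u q < n - k) -> u q < u j0.
  move=> jq q1 /orP hq; apply: umax => //; apply/belowP.
  case: hq => hq; [exists q, j1|exists j0, j1];
    by rewrite !perm_comp_tpermE ?tpermR ?tpermL tpermD //; split.
have swap_j1 (p : 'I_n) : p < j1 -> p != j0 -> (k <= p) || (n - l.+1 <= u p) -> u j1 < u p.
  move=> pj p0 /orP hp; apply: umax => //; apply/belowP.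
  case: hp => hp; [exists j0, p|exists j0, j1];
    by rewrite !perm_comp_tpermE ?tpermR ?tpermL tpermD // 1?eq_sym //; split.
(* If [j0 < l], the [k] positions with value at least [n - k] lie among [j1] and the positions left
   of [j0], which are at most [j0 + 1 < k] in number. *)
have e0 : j0 = l.
  apply/ord_inj/eqP; rewrite eqn_leq h0 leqNgt; apply/negP => j0l.
  have qn : j0.+1 < n by lia.
  pose q := Ordinal qn.
  have q1 : q != j1 by apply/eqP => /(congr1 (@nat_of_ord n)) /=; lia.
  have q0 : q != j0 by apply/eqP => /(congr1 (@nat_of_ord n)) /=; lia.
  have uq := swap_j0 q (ltnSn _) q1; rewrite j0l /= in uq.
  have : k <= #|[set p : 'I_n | p < j0] :|: [set j1]|.
    rewrite -[X in X <= _](subKn (ltnW kn)) -(@card_perm_geq _ u _ (leq_subr k n)).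
    apply/subset_leq_card/subsetP => p; rewrite !inE => hp.
    have [//|p1] := eqVneq p j1; first by rewrite orbT.
    rewrite orbF ltnNge leq_eqVlt negb_or; apply/andP; split.
      by apply/negP => /eqP/ord_inj e; move: hp; rewrite -e; lia.
    apply/negP => jp; have [e|pq] := eqVneq p q; first by move: hp; rewrite e; lia.
    have : u p < u q.
      apply: dec => //; last by apply/eqP => e; move: jp; rewrite e ltnn.
      by rewrite ltn_neqAle [q <= p]jp andbT eq_sym.
    by move: (uq isT); lia.
  have := (leq_card_setU [set p : 'I_n | p < j0] [set j1]).1.
  by rewrite card_ord_ltn ?cards1 //; lia.
rewrite {j0}e0 in h0 h1 j01 dec swap_j0 swap_j1 *.
have e1 : j1 = k.
  apply/ord_inj/eqP; rewrite eqn_leq h2 andbT leqNgt; apply/negP => kj1.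
  have pn : j1.-1 < n by have := ltn_ord j1; lia.
  pose p := Ordinal pn.
  have p0 : p != l by apply/eqP => /(congr1 (@nat_of_ord n)) /=; lia.
  have up : u j1 < u p by apply: swap_j1 => //=; lia.
  have : #|[set q : 'I_n | q < j1.+1] :\ l| <= #|[set q : 'I_n | n - l.+1 <= u q]|.
    apply/subset_leq_card/subsetP => q; rewrite !inE => /andP[ql qj].
    have [->//|q1] := eqVneq q j1.
    have {q1}qj : q < j1 by rewrite ltn_neqAle q1 -ltnS.
    have [->|qp] := eqVneq q p; first by lia.
    suff : u p < u q by lia.
    apply: dec => //; rewrite ?ltn_neqAle ?qp /=; try lia.
      by apply/eqP => e; move: qj; rewrite e ltnn.
    by apply/eqP => /(congr1 (@nat_of_ord n)) /=; lia.
  have := cardsD1 l [set q : 'I_n | q < j1.+1].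
  rewrite card_ord_ltn ?inE ?card_perm_geq; [|lia|exact: ltn_ord].
  have -> : l < j1.+1 by lia.
  by rewrite add1n -ltnS => -[<-]; lia.
rewrite {j1}e1 in h2 h3 j01 dec swap_j0 swap_j1 *.
have kl : k != l by rewrite eq_sym.
have ul : u l = n - k.+1 :> nat.
  apply/eqP/negPn/negP => ul.
  have vn : n - k.+1 < n by lia.
  pose p := (u^-1)%g (Ordinal vn).
  have up : u p = n - k.+1 :> nat by rewrite permKV.
  have pl : p != l by apply/eqP => e; move: ul; rewrite -e up eqxx.
  have pk : p != k by apply/eqP => e; move: h3; rewrite -e up; lia.
  have pltl : p < l.
    have [//|lp|/ord_inj e] := ltngtP p l; last by rewrite e eqxx in pl.
    by have := swap_j0 p lp pk; rewrite up; lia.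
  have : k <= #|[set q : 'I_n | q < p] :|: [set k]|.
    rewrite -[X in X <= _](subKn (ltnW kn)) -(@card_perm_geq _ u _ (leq_subr k n)).
    apply/subset_leq_card/subsetP => q; rewrite !inE => hq.
    have [//|qk] := eqVneq q k; first by rewrite orbT.
    have ql : q != l by apply/eqP => e; move: hq; rewrite e; lia.
    rewrite orbF ltnNge leq_eqVlt negb_or; apply/andP; split.
      by apply/negP => /eqP/ord_inj e; move: hq; rewrite -e up; lia.
    by apply/negP => pq; have := dec p q pq pl pk ql qk; rewrite up; lia.
  have := (leq_card_setU [set q : 'I_n | q < p] [set k]).1.
  by rewrite card_ord_ltn ?cards1 //; lia.
have uk : u k = n - l.+1 :> nat.
  apply/eqP/negPn/negP => uk.
  have vn : n - l.+1 < n by lia.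
  pose p := (u^-1)%g (Ordinal vn).
  have up : u p = n - l.+1 :> nat by rewrite permKV.
  have pk : p != k by apply/eqP => e; move: uk; rewrite -e up eqxx.
  have pl : p != l by apply/eqP => e; move: ul; rewrite -e up; lia.
  have kp : k < p.
    have [pk'|//|/ord_inj e] := ltngtP p k; last by rewrite e eqxx in pk.
    by have := swap_j1 p pk' pl; rewrite up; lia.
  have : #|[set q : 'I_n | q < p] :\ l| <= #|[set q : 'I_n | n - l <= u q]|.
    apply/subset_leq_card/subsetP => q; rewrite !inE => /andP[ql qp].
    have [->|qk] := eqVneq q k; first by lia.
    have := dec q p qp ql qk pl pk; rewrite up; lia.
  have := cardsD1 l [set q : 'I_n | q < p].
  rewrite card_ord_ltn ?inE ?card_perm_geq; [|lia|exact: ltnW].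
  have -> : l < p by lia.
  by rewrite add1n -ltnS => e; rewrite -e; lia.
apply: (@perm_eq_decreasing_in _ _ _ (~: [set l; k])) => p.
- by move=> q; rewrite !inE !negb_or => /andP[? ?] /andP[? ?] pq; apply: dec.
- move=> q; rewrite !inE !negb_or => /andP[/negPf pl /negPf pk] /andP[/negPf ql /negPf qk] pq.
  by rewrite !wE_nat pl pk ql qk; have := ltn_ord q; lia.
rewrite !inE negbK => /orP[]/eqP->; apply: ord_inj => /=; rewrite wE_nat ?eqxx //.
by rewrite (negPf kl).
Qed.

(** One direction is closure of [below] under steps down. For the other, an element of [below] other
    than [w] has a step up inside [below], and lengths are bounded, so the climb ends at [w]. *)
Lemma bruhat_le_below u : bruhat_le u w = below u.
Proof.
apply/idP/idP => [/connectP[s]|].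
  elim: s u => [|u' s IH] u /=; first by move=> _ <-; exact: below_w.
  by move=> /andP[uu' s_path] ws; apply: below_step uu' _; apply: IH.
have [m] := ubnP (n * n - coxeter_length u); elim: m u => // m IH u um bu.
have [->|uw] := eqVneq u w; first exact: connect0.
have [/forallP H|] := boolP [forall a : 'I_n, forall b : 'I_n,
    (a < b) && below (perm_comp u (tperm a b)) ==> (u b < u a)].
  case/eqP: uw; apply: below_maximal => // a b ab buab.
  by have /forallP/(_ b) := H a; rewrite ab buab.
rewrite negb_forall => /existsP[a]; rewrite negb_forall => /existsP[b].
rewrite negb_imply -leqNgt [u a <= _]leq_eqVlt => /andP[/andP[ab buab] /orP[/eqP/ord_inj/perm_inj e|uab]].
  by move: ab; rewrite e ltnn.
apply: connect_trans (connect1 _) (IH _ _ buab).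
  by apply/bruhat_stepP; exists a, b.
have := coxeter_length_tperm ab uab.
have := coxeter_length_le (perm_comp u (tperm a b)).
by lia.
Qed.

End TranspositionOfLongest.

(** * Ranks at the essential cells and the cells missing from the graph *)

Lemma sum_enum_val_delta (T : finType) (A : {set T}) (x y : T) : x \in A ->
  (\sum_(t < #|A|) (x == enum_val t)%:R * (y == enum_val t)%:R = (x == y)%:R :> rat)%R.
Proof.
move=> xA.
rewrite -(big_enum_val (fun t => (x == t)%:R * (y == t)%:R)%R) (bigD1 x) //= eqxx mul1r.
by rewrite big1 ?addr0 1?eq_sym // => t /andP[_ /negPf]; rewrite eq_sym => ->; rewrite mul0r.
Qed.

(** The block factors as [P *m Q] through the set [S] of its ones; [P^T] is a left inverse of [P]
    and [Q^T] a right inverse of [Q], so the rank is [#|S|]. *)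
Lemma sw_rankE n (v : 'S_n) a b :
  sw_rank v a b = #|[set j : 'I_n | (j <= b) && (a <= v j)]|.
Proof.
rewrite /sw_rank; set A := mxsub _ _ _; set S := [set j : 'I_n | (j <= b) && (a <= v j)].
pose P := (\matrix_(i < _, t < #|S|) (v (enum_val t) == enum_val i)%:R)%R
  : 'M[rat]_(#|[set i : 'I_n | a <= i]|, #|S|).
pose Q := (\matrix_(t < #|S|, j < _) (enum_val j == enum_val t)%:R)%R
  : 'M[rat]_(#|S|, #|[set i : 'I_n | i <= b]|).
have APQ : A = (P *m Q)%R.
  apply/matrixP => i j; rewrite !mxE.
  have := enum_valP i; have := enum_valP j; rewrite !inE => jb ai.
  transitivity (\sum_(t < #|S|) ((v^-1)%g (enum_val i) == enum_val t)%:R *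
                  (enum_val j == enum_val t)%:R : rat)%R; last first.
    apply: eq_bigr => t _; rewrite !mxE; congr (_ %:R * _)%R.
    by rewrite -(inj_eq (@perm_inj _ v)) permKV eq_sym.
  have [e|ne] := eqVneq (v (enum_val j)) (enum_val i).
    by rewrite -[in RHS]e permK sum_enum_val_delta ?eqxx // inE jb e ai.
  rewrite big1 // => t _; case: eqP => [e1|]; last by rewrite mul0r.
  case: eqP => [e2|]; last by rewrite mulr0.
  by move: ne; rewrite e2 -e1 permKV eqxx.
have PP : (P^T *m P = 1%:M)%R.
  apply/matrixP => t t'; rewrite !mxE -(inj_eq enum_val_inj) -(inj_eq (@perm_inj _ v)).
  rewrite -(sum_enum_val_delta (A := [set i : 'I_n | a <= i])).
    by apply: eq_bigr => i _; rewrite !mxE.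
  by have := enum_valP t; rewrite !inE => /andP[].
have QQ : (Q *m Q^T = 1%:M)%R.
  apply/matrixP => t t'; rewrite !mxE -(inj_eq enum_val_inj).
  rewrite -(sum_enum_val_delta (A := [set i : 'I_n | i <= b])).
    by apply: eq_bigr => i _; rewrite !mxE ![enum_val i == _]eq_sym.
  by have := enum_valP t; rewrite !inE => /andP[].
rewrite APQ mxrankMfree; last by apply/row_freeP; exists (Q^T)%R.
rewrite -mxrank_tr; apply/eqP; change (row_free (P^T)%R).
by apply/row_freeP; exists P.
Qed.

Lemma card_ord_itv n a b : a <= b -> b <= n -> #|[set i : 'I_n | a <= i < b]| = b - a.
Proof.
move=> ab bn.
have := cardsID [set i : 'I_n | i < a] [set i : 'I_n | i < b].
have -> : [set i : 'I_n | i < b] :&: [set i : 'I_n | i < a] = [set i : 'I_n | i < a].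
  by apply/setP => i; rewrite !inE; lia.
have -> : [set i : 'I_n | i < b] :\: [set i : 'I_n | i < a] = [set i : 'I_n | a <= i < b].
  by apply/setP => i; rewrite !inE; lia.
by rewrite !card_ord_ltn //; lia.
Qed.

Section TranspositionOfLongest.
Variables (n : nat) (l k : 'I_n) (w : 'S_n).
Hypotheses (lk : l < k) (wE : w = perm_comp w0 (tperm l k)).
Implicit Types u v : 'S_n.

Lemma mem_opp_rothe_w (i j : 'I_n) : ((i, j) \in opp_rothe w) =
  ((j == l) && (n - k <= i < n - l)) || ((i == n - l.+1 :> nat) && (l <= j < k)).
Proof.
rewrite inE /=; pose j' := (w^-1)%g i.
have -> : i = w j' by rewrite permKV.
rewrite permK !(wE_nat lk wE) -!(inj_eq (@ord_inj n)).
have := ltn_ord j; have := ltn_ord j'; have := ltn_ord k.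
by repeat case: ifP => [/eqP ?|/eqP ?]; lia.
Qed.

(** The diagram of [w] is a hook: a column and a row of [k - l] cells each, sharing the corner
    [(n - l - 1, l)]. Its two free ends are the essential cells. *)
Lemma card_opp_rothe_w : #|opp_rothe w| = (2 * (k - l)).-1.
Proof.
have kn := ltn_ord k; have ln := ltn_ord l.
have i0n : n - l.+1 < n by lia.
pose i0 := Ordinal i0n.
pose A := [set i : 'I_n | n - k <= i < n - l]; pose B := [set j : 'I_n | l <= j < k].
have -> : opp_rothe w = setX A [set l] :|: setX [set i0] B.
  by apply/setP => -[i j]; rewrite mem_opp_rothe_w !inE /= andbC -(inj_eq (@ord_inj n) i).
have := cardsUI (setX A [set l]) (setX [set i0] B).
have -> : setX A [set l] :&: setX [set i0] B = [set (i0, l)].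
  apply/setP => -[i j]; rewrite !inE /= xpair_eqE -!(inj_eq (@ord_inj n)) /=.
  by lia.
rewrite !cardsX !cards1 !card_ord_itv; try lia.
by move: #|_ :|: _| => m; lia.
Qed.

Lemma mem_ess_w (i j : 'I_n) : ((i, j) \in ess w) =
  ((i : nat, j : nat) \in [:: (n - k, l : nat); (n - l.+1, k.-1)]).
Proof.
have kn := ltn_ord k; have ln := ltn_ord l; have jn := ltn_ord j; have i_n := ltn_ord i.
rewrite inE !in_cons in_nil orbF !xpair_eqE mem_opp_rothe_w.
apply/andP/idP => [[ijD /existsPn H]|].
  move: ijD => /orP[/andP[/eqP jl hi]|/andP[/eqP hi hj]].
    apply/orP; left; rewrite jl eqxx andbT; apply/negPn/negP => ni.
    have pn : i.-1 < n by lia.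
    have /negP := H (Ordinal pn, j); apply; rewrite mem_opp_rothe_w /=.
    by apply/andP; split; [apply/orP; left|]; rewrite ?jl eqxx //; lia.
  apply/orP; right; rewrite hi eqxx /=; apply/negPn/negP => nj.
  have pn : j.+1 < n by lia.
  have /negP := H (i, Ordinal pn); apply; rewrite mem_opp_rothe_w /=.
  by apply/andP; split; [apply/orP; right|]; rewrite ?hi ?eqxx ?orbT //; lia.
move=> hij; split; first by rewrite -(inj_eq (@ord_inj n)); lia.
apply/existsPn => -[i' j']; rewrite mem_opp_rothe_w /= -!(inj_eq (@ord_inj n)).
by lia.
Qed.

(** [low_cols] and [high_rows] collect the possible witnesses of the two conditions in [below]; a
    condition is tight when its set is a singleton. [free_rows] (resp. [free_cols]) are the rows
    (resp. columns) whose swap with the only witness destroys it. *)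
Definition low_cols v := [set j : 'I_n | (j <= l) && (v j < n - k)].
Definition free_rows v := [set i : 'I_n | (n - k <= i) && (l < (v^-1)%g i)].
Definition high_rows v := [set i : 'I_n | (n - l.+1 <= i) && (k <= (v^-1)%g i)].
Definition free_cols v := [set j : 'I_n | (j < k) && (v j < n - l.+1)].

Lemma card_low_cols v : sw_rank v (n - k) l + #|low_cols v| = l.+1.
Proof.
rewrite sw_rankE -[RHS](card_ord_ltn (ltn_ord l)) -[RHS](cardsID [set j | v j < n - k]) addnC.
congr (_ + _); apply: eq_card => j; rewrite !inE ltnS //.
by rewrite -leqNgt andbC.
Qed.

Lemma card_high_rows v : sw_rank v (n - l.+1) k.-1 + #|high_rows v| = l.+1.
Proof.
have k0 : k.-1.+1 = k by lia.
have ln := ltn_ord l.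
rewrite sw_rankE -[RHS](subKn ln) -(card_perm_geq v (leq_subr l.+1 n)).
rewrite -[RHS](cardsID [set j : 'I_n | j < k]); congr (_ + _).
  by apply: eq_card => j; rewrite !inE -ltnS k0 andbC.
rewrite -(card_imset _ (@perm_inj _ v^-1%g)); apply: eq_card => j.
rewrite !inE -leqNgt; apply/imsetP/idP => [[i /[!inE] /andP[? ?] ->]|/andP[? ?]].
  by rewrite permKV; apply/andP.
by exists (v j); rewrite ?inE permK //; apply/andP.
Qed.

(** Of the [k] rows from [n - k] on, all but [sw_rank v (n - k) l] are free, and this rank is
    [l + 1 - #|low_cols v|]. *)
Lemma card_free_rows v : #|free_rows v| = #|low_cols v| + (k - l.+1).
Proof.
have kn := ltn_ord k.
suff : #|free_rows v| + sw_rank v (n - k) l = k by have := card_low_cols v; lia.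
rewrite sw_rankE -[RHS](subKn (ltnW kn)) -(card_perm_geq v (leq_subr k n)).
rewrite -[RHS](cardsID [set j : 'I_n | j <= l]) addnC; congr (_ + _).
  by apply: eq_card => j; rewrite !inE andbC.
rewrite -(card_imset _ (@perm_inj _ v^-1%g)); apply: eq_card => j.
rewrite !inE -ltnNge; apply/imsetP/idP => [[i /[!inE] /andP[? ?] ->]|/andP[? ?]].
  by rewrite permKV; apply/andP.
by exists (v j); rewrite ?inE permK //; apply/andP.
Qed.

Lemma card_free_cols v : #|free_cols v| = #|high_rows v| + (k - l.+1).
Proof.
have k0 : k.-1.+1 = k by lia.
suff : #|free_cols v| + sw_rank v (n - l.+1) k.-1 = k.
  by have := card_high_rows v; lia.
rewrite sw_rankE -[RHS](card_ord_ltn (ltnW (ltn_ord k))).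
rewrite -[RHS](cardsID [set j : 'I_n | v j < n - l.+1]); congr (_ + _).
  by apply: eq_card => j; rewrite !inE.
by apply: eq_card => j; rewrite !inE; lia.
Qed.

Definition violating v : {set cell} :=
  [set c in opp_rothe v | (low_cols v == [set c.2]) && (c.1 \in free_rows v)
                       || (high_rows v == [set c.1]) && (c.2 \in free_cols v)].

Lemma perm_comp_tpermL v (j i : 'I_n) :
  perm_comp (tperm (v j) i) v = perm_comp v (tperm j ((v^-1)%g i)).
Proof.
apply/permP => p; rewrite perm_comp_tpermE /perm_comp permM.
have -> : i = v ((v^-1)%g i) by rewrite permKV.
by rewrite permK; case: (tpermP j) => [->|->|/eqP pj /eqP pi];
  rewrite ?tpermL ?tpermR // tpermD // inj_eq 1?eq_sym //; apply: perm_inj.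
Qed.

(** The swap puts the larger value [i] at [j] and moves [v j] right to [j']. The first bound is lost
    only when [j] was its sole witness, [i] is too large to be one, and [j'] lies beyond [l]; the
    second bound is symmetric. *)
Lemma below_swap v (i j : 'I_n) : below l k v -> (i, j) \in opp_rothe v ->
  below l k (perm_comp (tperm (v j) i) v) =
  ~~ ((low_cols v == [set j]) && (i \in free_rows v)
      || (high_rows v == [set i]) && (j \in free_cols v)).
Proof.
move=> /belowP[j0 [j1 [h0 h1 h2 h3]]]; rewrite inE /= perm_comp_tpermL.
set j' := (v^-1)%g i => /andP[vji jj'].
have vj' : v j' = i by rewrite permKV.
have vk (p : 'I_n) : p != j -> p != j' -> perm_comp v (tperm j j') p = v p.
  by move=> pj pj'; rewrite perm_comp_tpermE tpermD // eq_sym.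
have vL : perm_comp v (tperm j j') j = i by rewrite perm_comp_tpermE tpermL.
have vR : perm_comp v (tperm j j') j' = v j by rewrite perm_comp_tpermE tpermR.
rewrite negb_or /below; congr (_ && _).
  apply/existsP/idP => [[p /andP[pl vp]]|].
    apply/negP => /andP[/eqP low]; rewrite inE -/j' => /andP[ni lj'].
    move: vp; have [->|pj] := eqVneq p j; first by rewrite vL; lia.
    have [e|pj'] := eqVneq p j'; first by move: pl; rewrite e; lia.
    rewrite vk // => vp; have : p \in low_cols v by rewrite inE pl.
    by rewrite low inE (negPf pj).
  rewrite negb_and => /orP[ne|].
    have [low0|] := set_0Vmem (low_cols v :\ j).
      case/eqP: ne; apply/eqP; rewrite eqEsubset -setD_eq0 low0 eqxx sub1set.
      have : j0 \in low_cols v by rewrite inE h0.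
      by have [->//|j0j] := eqVneq j0 j; move/setP/(_ j0): low0; rewrite !inE j0j h0 h1.
    move=> [p]; rewrite !inE => /and3P[pj pl vp].
    have [e|pj'] := eqVneq p j'; last by exists p; rewrite vk // pl.
    by exists j; rewrite vL -vj' -e vp andbT; move: jj' pl; rewrite e; lia.
  rewrite inE -/j' negb_and -ltnNge -leqNgt => /orP[ni|lj'].
    have [jl|lj] := leqP j l; first by exists j; rewrite jl vL.
    exists j0; rewrite h0 vk //; apply/eqP => e; move: h0; rewrite e; lia.
  have [ni|ni] := ltnP i (n - k); first by exists j; rewrite vL ni andbT; lia.
  have [vjn|nvj] := ltnP (v j) (n - k); first by exists j'; rewrite vR vjn lj'.
  exists j0; rewrite h0 vk //; apply/eqP => e; move: h1; rewrite e ?vj'; lia.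
have kn := ltn_ord k.
apply/existsP/idP => [[p /andP[kp vp]]|].
  apply/negP => /andP[/eqP high]; rewrite inE => /andP[jk vjn].
  move: vp; have [e|pj] := eqVneq p j; first by move: kp; rewrite e; lia.
  have [->|pj'] := eqVneq p j'; first by rewrite vR; lia.
  rewrite vk // => vp; have : v p \in high_rows v by rewrite inE permK kp vp.
  by rewrite high inE -vj' (inj_eq perm_inj) (negPf pj').
rewrite negb_and => /orP[ne|].
  have [high0|] := set_0Vmem (high_rows v :\ i).
    case/eqP: ne; apply/eqP; rewrite eqEsubset -setD_eq0 high0 eqxx sub1set.
    have : v j1 \in high_rows v by rewrite inE permK h2 h3.
    have [->//|j1i] := eqVneq (v j1) i.
    by move/setP/(_ (v j1)): high0; rewrite !inE permK j1i h2 h3.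
  move=> [r]; rewrite !inE; set p := (v^-1)%g r; have -> : r = v p by rewrite permKV.
  rewrite -vj' (inj_eq perm_inj) => /and3P[pj' vp kp].
  have [e|pj] := eqVneq p j; last by exists p; rewrite vk // kp.
  by exists j'; rewrite vR -e vp andbT; move: jj' kp; rewrite e; lia.
rewrite inE negb_and -!leqNgt => /orP[kj|vjn].
  have [nvj|vjn] := leqP (n - l.+1) (v j); first by exists j'; rewrite vR nvj andbT; lia.
  have [ni|ni] := leqP (n - l.+1) i; first by exists j; rewrite vL kj ni.
  exists j1; rewrite h2 vk //; apply/eqP => e; move: h3; rewrite e ?vj'; lia.
have [kj'|j'k] := leqP k j'; first by exists j'; rewrite vR kj'.
exists j1; rewrite h2 vk //; apply/eqP => e; move: h2; rewrite e; lia.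
Qed.

Lemma weight_cellsE v : below l k v -> weight_cells v w = opp_rothe v :\: violating v.
Proof.
move=> bv; apply/setP => -[i j]; rewrite in_setD andbC [LHS]inE.
have [ijD|//] := boolP ((i, j) \in opp_rothe v).
rewrite (bruhat_le_below lk wE) below_swap // !andTb.
by rewrite [in RHS]inE ijD.
Qed.

Lemma low_cols_gt0 v : below l k v -> 0 < #|low_cols v|.
Proof.
by move=> /belowP[j0 [_ [? ? _ _]]]; apply/card_gt0P; exists j0; rewrite inE; apply/andP.
Qed.

Lemma high_rows_gt0 v : below l k v -> 0 < #|high_rows v|.
Proof.
move=> /belowP[_ [j1 [_ _ ? ?]]]; apply/card_gt0P; exists (v j1).
by rewrite inE permK; apply/andP.
Qed.

Lemma low_cell v (i j : 'I_n) : j \in low_cols v -> i \in free_rows v ->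
  (i, j) \in opp_rothe v.
Proof. by rewrite !inE /=; lia. Qed.

Lemma high_cell v (i j : 'I_n) : i \in high_rows v -> j \in free_cols v ->
  (i, j) \in opp_rothe v.
Proof. by rewrite !inE /=; lia. Qed.

Lemma low_cols_free v : low_cols v \subset free_cols v.
Proof. by apply/subsetP => j; rewrite !inE; have := ltn_ord k; lia. Qed.

Lemma high_rows_free v : high_rows v \subset free_rows v.
Proof. by apply/subsetP => i; rewrite !inE; have := ltn_ord k; lia. Qed.

(** A singleton [low_cols] contributes a column of [k - l] cells, a singleton [high_rows] a row of
    [k - l] cells. When both occur they meet in one cell, since a low column is free and a high row
    is free. *)
Lemma card_violating v : below l k v -> #|violating v| =
  if #|low_cols v| == 1 then
    if #|high_rows v| == 1 then (2 * (k - l)).-1 else k - l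
  else if #|high_rows v| == 1 then k - l else 0.
Proof.
move=> bv.
pose V1 := if #|low_cols v| == 1 then setX (free_rows v) (low_cols v) else set0.
pose V2 := if #|high_rows v| == 1 then setX (high_rows v) (free_cols v) else set0.
have eqV : violating v = V1 :|: V2.
  apply/setP => -[i j]; rewrite in_setU [LHS]inE andb_orr; congr (_ || _).
    rewrite /V1; case: cards1P => [[j0 e]|ne].
      rewrite in_setX e in_set1 (inj_eq set1_inj) eq_sym.
      have [->|] := eqVneq j j0; last by rewrite !andbF.
      by rewrite andbT; case: (boolP (i \in _)) => [?|]; rewrite ?andbF // low_cell // e set11.
    rewrite in_set0; case: eqP => [e|]; last by rewrite andbF.
    by case: ne; exists j.
  rewrite /V2; case: cards1P => [[i0 e]|ne].
    rewrite in_setX e in_set1 (inj_eq set1_inj) eq_sym.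
    have [->|] := eqVneq i i0; last by rewrite !andbF.
    by case: (boolP (j \in _)) => [?|]; rewrite ?andbF // high_cell // e set11.
  rewrite in_set0; case: eqP => [e|]; last by rewrite andbF.
  by case: ne; exists i.
have UI := cardsUI V1 V2.
have c1 : #|V1| = if #|low_cols v| == 1 then k - l else 0.
  by rewrite /V1; case: eqP => [e|_]; rewrite ?cards0 // cardsX e muln1 card_free_rows e; lia.
have c2 : #|V2| = if #|high_rows v| == 1 then k - l else 0.
  by rewrite /V2; case: eqP => [e|_]; rewrite ?cards0 // cardsX e mul1n card_free_cols e; lia.
have c12 : #|V1 :&: V2| = (#|low_cols v| == 1) && (#|high_rows v| == 1).
  rewrite /V1 /V2; case: cards1P => [[j0 e]|_]; last by rewrite set0I cards0.
  case: cards1P => [[i0 e']|_]; last by rewrite setI0 cards0.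
  transitivity #|[set (i0, j0)]|; last by rewrite cards1.
  rewrite e e'; apply: eq_card => -[i j].
  have := low_cols_free v; have := high_rows_free v; rewrite e e' !sub1set => h1 h2.
  rewrite in_setI !in_setX !in_set1 xpair_eqE.
  by have [->|] := eqVneq i i0; have [->|] := eqVneq j j0; rewrite ?andbF // h1 h2.
rewrite eqV; move: UI; rewrite c1 c2 c12.
by case: (_ == 1); case: (_ == 1) => /=; move: #|V1 :|: V2| => m; lia.
Qed.
End TranspositionOfLongest.

(** * The matching [P_set] and the non-inversion graph *)

Section GreedyMatching.
Variables (n : nat) (v : 'S_n).
Implicit Types (i j p q r : 'I_n) (x y : @cell n).

(* With [x = (i, j)] and [y = (i', j')], in the noninversion graph on the dots at
   positions beyond [j] with values less than [i'], some component has largest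
   value [i] and first position [j']. *)
Definition cut x y :=
  [forall p : 'I_n, (x.2 < p) && (v p < y.1) ==> ((p < y.2) == (x.1 < v p))].

Definition matching : {set cell * cell} :=
  [set c : cell * cell | [&& c.1 \in opp_rothe v, c.2 \in opp_rothe v,
                             strictly_se c.1 c.2 & cut c.1 c.2]].

Lemma matchingP i j i' j' : reflect
  [/\ v j < i, j < (v^-1)%g i, v j' < i', j' < (v^-1)%g i' &
      [/\ i < i', j < j' & forall p, j < p -> v p < i' -> (p < j') = (i < v p)]]
  (((i, j), (i', j')) \in matching).
Proof.
rewrite inE /= !inE /strictly_se /=.
apply: (iffP and4P) => [[/andP[? ?] /andP[? ?] /andP[? ?] /forallP h]|].
  by do 2!split=> //; move=> p jp vp; have := h p; rewrite jp vp => /eqP.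
move=> [-> -> -> -> [-> -> h]]; split=> //; apply/forallP => p /=.
by apply/implyP => /andP[jp vp]; rewrite h.
Qed.

Lemma matching_fst_inj x y y1 : (x, y) \in matching -> (x, y1) \in matching -> y = y1.
Proof.
wlog le_yy : y y1 / y.1 <= y1.1 => [H h1 h2|].
  by case: (leqP y.1 y1.1) => le; [apply: H|apply/esym/H => //; exact: ltnW].
case: x y y1 le_yy => [i j] [i1 j1] [i' j'] /= le_ii.
move=> /matchingP[h1 h2 h3 h4 [h5 h6 h7]] /matchingP[_ _ g3 g4 [g5 g6 g7]].
have vj : v j1 <= i by have := h7 j1 h6 h3; rewrite ltnn => e; rewrite leqNgt -e.
have vj' : v j' <= i by have := g7 j' g6 g3; rewrite ltnn => e; rewrite leqNgt -e.
have [lt_ii|e] : i1 < i' \/ i1 = i' by move: le_ii; rewrite leq_eqVlt => /orP[/eqP/ord_inj|];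
  tauto.
  have := g7 ((v^-1)%g i1); rewrite permKV lt_ii h5 => /(_ _ isT) e.
  by have := g7 j1 h6; have := e; lia.
move: e h3 h7 => -> h3 h7; congr (_, _); apply/ord_inj.
by have := g7 j1 h6 h3; have := h7 j' g6; have := h3; lia.
Qed.

Lemma matching_snd_inj x x1 y : (x, y) \in matching -> (x1, y) \in matching -> x = x1.
Proof.
wlog le_xx : x x1 / x.2 <= x1.2 => [H h1 h2|].
  by case: (leqP x.2 x1.2) => le; [apply: H|apply/esym/H => //; exact: ltnW].
case: x x1 y le_xx => [i j] [i1 j1] [i' j'] /= le_jj.
move=> /matchingP[h1 h2 h3 h4 [h5 h6 h7]] /matchingP[g1 g2 g3 g4 [g5 g6 g7]].
have hp : (v^-1)%g i1 >= j'.
  by have := g7 ((v^-1)%g i1) g2; rewrite permKV g5 ltnn => /(_ isT); lia.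
have hp' : (v^-1)%g i >= j'.
  by have := h7 ((v^-1)%g i) h2; rewrite permKV h5 ltnn => /(_ isT); lia.
have i1i : i1 <= i.
  by have := h7 ((v^-1)%g i1); rewrite permKV g5; lia.
have [lt_jj|e] : j < j1 \/ j = j1 by move: le_jj; rewrite leq_eqVlt => /orP[/eqP/ord_inj|];
  tauto.
  by have := h7 j1 lt_jj; lia.
move: e h1 h2 h6 h7 => -> h1 h2 h6 h7; congr (_, _); apply/ord_inj.
by have := g7 ((v^-1)%g i) h2; rewrite permKV h5 => /(_ isT); lia.
Qed.

(** The partner of [(i, j)] made explicit: its column is the first later position with value at most
    [i], its row the least value above [i] beyond that position. [matching_prev] is the mirror
    image. *)
Lemma matching_next i j j1 r : (i, j) \in opp_rothe v ->
    j < j1 -> v j1 <= i -> (forall p, j < p -> p < j1 -> i < v p) ->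
    j1 < r -> i < v r -> (forall p, j1 < p -> i < v p -> v r <= v p) ->
  ((i, j), (v r, j1)) \in matching.
Proof.
rewrite inE /= => /andP[vji jvi] jj1 vj1 j1min j1r ivr rmin.
apply/matchingP; rewrite permK; split=> //; first by lia.
split=> // p jp vpr.
have [e|ne] := eqVneq p j1; first by rewrite e ltnn ltnNge vj1.
have {}ne : p <> j1 :> nat by move=> /ord_inj e; rewrite e eqxx in ne.
apply/idP/idP => [pj1|ivp]; first exact: j1min.
by rewrite ltnNge; apply/negP => j1p; have := rmin p; lia.
Qed.

Lemma matching_prev i' j' r q : (i', j') \in opp_rothe v ->
    j' <= r -> v r < i' -> (forall p, j' <= p -> v p < i' -> v p <= v r) ->
    q < j' -> v q < v r -> (forall p, p < j' -> v p < v r -> p <= q) ->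
  ((v r, q), (i', j')) \in matching.
Proof.
rewrite inE /= => /andP[vji jvi] jr vri rmax qj vqr qmax.
apply/matchingP; rewrite permK; split=> //; first by lia.
split=> // p qp vpi.
have [pj|jp] := ltnP p j'.
  apply/esym; rewrite ltnNge leq_eqVlt negb_or; apply/andP; split.
    by apply/negP => /eqP/ord_inj/perm_inj e; move: pj; rewrite e; lia.
  by apply/negP => vpr; have := qmax p pj vpr; lia.
by apply/esym/negbTE; rewrite -leqNgt; apply: rmax.
Qed.

(** A pair [q], [r] refuting the condition is an edge from a value up to [i] to a larger one. Taking
    the leftmost [j1] and then the least value turns it into the partner of [(i, j)]. *)
Lemma unmatchedP i j : (i, j) \in opp_rothe v ->
  reflect (exists y, ((i, j), y) \in matching)
    (~~ [forall q : 'I_n, forall r : 'I_n,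
        [&& j < q, j < r, v q <= i & i < v r] ==> (r < q)]).
Proof.
move=> ijD; apply: (iffP idP) => [|[[i' j'] /matchingP[h1 h2 h3 h4 [h5 h6 h7]]]].
  rewrite negb_forall => /existsP[q]; rewrite negb_forall => /existsP[r].
  rewrite negb_imply -leqNgt => /andP[/and4P[jq jr vq vr] qr].
  pose P1 p := (j < p) && (v p <= i).
  have P1q : P1 q by apply/andP.
  case: (arg_minnP (fun p => val p) P1q) => j1 /andP[jj1 vj1] j1min.
  have j1r : j1 < r.
    rewrite ltn_neqAle; apply/andP; split.
      by apply/negP => /eqP/ord_inj e; move: vr; rewrite -e; lia.
    by have := j1min q P1q => /=; lia.
  pose P2 p := (j1 < p) && (i < v p).
  have P2r : P2 r by apply/andP.
  case: (arg_minnP (fun p => val (v p)) P2r) => r1 /andP[jr1 vr1] r1min.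
  exists (v r1, j1); apply: matching_next => //.
    move=> p jp pj1; rewrite ltnNge; apply/negP => vpi.
    by have := j1min p; rewrite /P1 jp vpi => /(_ isT) /=; lia.
  by move=> p j1p vp; apply: r1min; rewrite /P2 j1p vp.
apply/negP => /forallP/(_ j')/forallP/(_ ((v^-1)%g i')); rewrite permKV h5 h6.
have := h7 j' h6 h3; rewrite ltnn => e.
by rewrite [v j' <= i]leqNgt -e (ltn_trans h6 h4) /=; lia.
Qed.

(** Stability, with closer partners preferred: this is why the recursion of [P_upto] selects exactly
    [matching]. If the first position beyond [j] with value at most [i] is at most [j'], the partner
    of [x] is no farther than [y]; otherwise [y] has a partner closer than [x]. *)
Lemma matching_stable x y :
    x \in opp_rothe v -> y \in opp_rothe v -> strictly_se x y ->
  [\/ (x, y) \in matching,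
      exists2 y1, (x, y1) \in matching & cell_dist x y1 < cell_dist x y |
      exists2 x1, (x1, y) \in matching & cell_dist x1 y < cell_dist x y].
Proof.
case: x y => [i j] [i' j'] xD yD /andP[/= ii jj].
have [vji jvi] : v j < i /\ j < (v^-1)%g i by move: xD; rewrite inE => /andP.
have [vji' jvi'] : v j' < i' /\ j' < (v^-1)%g i' by move: yD; rewrite inE => /andP.
pose P1 p := (j < p) && (v p <= i).
have P1i : P1 ((v^-1)%g i) by rewrite /P1 permKV jvi leqnn.
case: (arg_minnP (fun p => val p) P1i) => j1 /andP[jj1 vj1] j1min.
have [j1j'|j'j1] := leqP j1 j'.
  pose P2 p := (j1 < p) && (i < v p).
  have P2i : P2 ((v^-1)%g i') by rewrite /P2 permKV ii; lia.
  case: (arg_minnP (fun p => val (v p)) P2i) => r /andP[j1r vr] rmin.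
  have xy1 : ((i, j), (v r, j1)) \in matching.
    apply: matching_next => //.
      move=> p jp pj1; rewrite ltnNge; apply/negP => vpi.
      by have := j1min p; rewrite /P1 jp vpi => /(_ isT) /=; lia.
    by move=> p j1p vp; apply: rmin; rewrite /P2 j1p vp.
  have := rmin _ P2i; rewrite permKV /= => le_vr.
  have [/eqP[e1 e2]|ne] := boolP ((v r, j1) == (i', j')).
    by constructor 1; rewrite -e1 -e2.
  constructor 2; exists (v r, j1) => //; rewrite /cell_dist /=.
  by move: ne; rewrite xpair_eqE -!(inj_eq (@ord_inj n)); lia.
constructor 3.
have ivj' : i < v j'.
  by rewrite ltnNge; apply/negP => h; have := j1min j'; rewrite /P1 jj h => /(_ isT) /=; lia.
pose P2 p := (j' <= p) && (v p < i').
have P2j : P2 j' by rewrite /P2 leqnn.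
case: (arg_maxnP (fun p => val (v p)) P2j) => r /andP[j'r vr] rmax.
have vj'r : v j' <= v r by apply: rmax.
pose P1' p := (p < j') && (v p < v r).
have P1j : P1' j by rewrite /P1' jj /=; lia.
case: (arg_maxnP (fun p => val p) P1j) => q /andP[qj' vq] qmax.
exists (v r, q).
  apply: matching_prev => //.
    by move=> p j'p vp; apply: rmax; rewrite /P2 j'p vp.
  by move=> p pj' vp; apply: qmax; rewrite /P1' pj' vp.
by have := qmax j P1j; rewrite /cell_dist /=; lia.
Qed.

Lemma P_uptoE d : P_upto v d = [set c in matching | cell_dist c.1 c.2 <= d].
Proof.
have se_dist x y : strictly_se x y -> 1 < cell_dist x y.
  by rewrite /strictly_se /cell_dist; lia.
elim: d => [|d IH].
  apply/setP => -[x y]; rewrite !inE /= leqn0; apply/esym/negbTE/negP.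
  by move=> /andP[/and4P[_ _ /se_dist h _] /eqP e]; rewrite e in h.
apply/setP => -[x y]; rewrite /= in_setU IH; apply/idP/idP.
  move=> /orP[|]; first by rewrite !inE => /andP[-> /= h]; apply: leqW.
  rewrite inE /= => /and5P[xD yD xy /eqP xyd H].
  rewrite inE xyd leqnn andbT.
  have [//|[y1 xy1 lt1]|[x1 xy1 lt1]] := matching_stable xD yD xy.
    (* A diagonally adjacent pair is at distance 2, the least possible, so no closer pair can block
       it. *)
    move: H => /orP[/andP[/eqP e1 /eqP e2]|].
      have : 1 < cell_dist x y1 by apply: se_dist; move: xy1; rewrite inE => /and4P[].
      by move: lt1; rewrite /cell_dist e1 e2 !subSnn => lt1; rewrite ltnNge -ltnS lt1.
    rewrite negb_or => /andP[/existsPn/(_ y1)]; rewrite inE xy1 /=.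
    by move: lt1; rewrite xyd ltnS => ->.
  move: H => /orP[/andP[/eqP e1 /eqP e2]|].
    have : 1 < cell_dist x1 y by apply: se_dist; move: xy1; rewrite inE => /and4P[].
    by move: lt1; rewrite /cell_dist e1 e2 !subSnn => lt1; rewrite ltnNge -ltnS lt1.
  rewrite negb_or => /andP[_ /existsPn/(_ x1)]; rewrite inE xy1 /=.
  by move: lt1; rewrite xyd ltnS => ->.
rewrite inE => /andP[xyM /=]; rewrite leq_eqVlt => /orP[/eqP xyd|]; last first.
  by rewrite ltnS => le; apply/orP; left; rewrite inE xyM.
apply/orP; right; rewrite inE /= xyd eqxx.
have := xyM; rewrite inE => /and4P[-> -> -> _] /=.
apply/orP; right; rewrite negb_or; apply/andP; split; apply/existsPn => z.
  rewrite inE; apply/negP => /andP[/= xz le]; move: le.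
  by rewrite -(matching_fst_inj xyM xz) xyd ltnn.
rewrite inE; apply/negP => /andP[/= xz le]; move: le.
by rewrite -(matching_snd_inj xyM xz) xyd ltnn.
Qed.

Lemma P_setE : P_set v = matching.
Proof.
rewrite /P_set P_uptoE; apply/setP => -[x y]; rewrite inE; apply: andb_idr => _.
by apply: leq_add; apply: leq_trans (leq_subr _ _) (ltnW (ltn_ord _)).
Qed.

(* The largest values of the components of the noninversion graph on the positions
   at least [m]. *)
Definition suffix_max (m : nat) : {set 'I_n} :=
  [set i : 'I_n | (m <= (v^-1)%g i) && [forall q : 'I_n, forall r : 'I_n,
     [&& m <= q, m <= r, v q <= i & i < v r] ==> (r < q)]].

Definition unmatched : {set cell} :=
  [set x in opp_rothe v | [forall q : 'I_n, forall r : 'I_n,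
        [&& x.2 < q, x.2 < r, v q <= x.1 & x.1 < v r] ==> (r < q)]].

Lemma card_matching : #|matching| + #|unmatched| = #|opp_rothe v|.
Proof.
have <- : #|[set c.1 | c in matching]| = #|matching|.
  apply: card_in_imset => -[x y] [x1 y1] /= h h1 e; rewrite e in h *.
  by rewrite (matching_fst_inj h h1).
rewrite addnC -[RHS](cardsID [set x : cell | [forall q : 'I_n, forall r : 'I_n,
        [&& x.2 < q, x.2 < r, v q <= x.1 & x.1 < v r] ==> (r < q)]]).
congr (_ + _); first by apply: eq_card => x; rewrite !inE.
apply: eq_card => -[i j]; rewrite in_setD inE /=; apply/imsetP/andP.
  move=> [[x y] xyM /= xE]; rewrite -xE in xyM.
  have xD : (i, j) \in opp_rothe v by move: xyM; rewrite inE => /and4P[].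
  by split=> //; apply/unmatchedP => //; exists y.
by move=> [h xD]; have /unmatchedP-/(_ xD)[y xyM] := h; exists ((i, j), y).
Qed.

(** Position [j] is joined to every later position with a larger value. The components whose largest
    value exceeds [v j], which are the unmatched cells of column [j], therefore merge with [j] into
    one; the others are untouched. *)
Lemma card_suffix_max_step (j : 'I_n) :
  #|suffix_max j| + #|[set i | (i, j) \in unmatched]| = #|suffix_max j.+1|.+1.
Proof.
pose P p := j <= p; have jPj : P j by exact: leqnn.
case: (arg_maxnP (fun p => val (v p)) jPj) => m; rewrite /P => jm mmax.
have vm p : j <= p -> v p <= v m by exact: mmax.
have eS : suffix_max j = v m |: [set i in suffix_max j.+1 | i < v j].
  apply/setP => i; rewrite in_setU1 !inE; have [->|im] /= := eqVneq i (v m).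
    rewrite permK jm; apply/forallP => q; apply/forallP => r; apply/implyP.
    by move=> /and4P[jq jr _]; rewrite ltnNge vm.
  have {}im : i <> v m :> nat by move=> /ord_inj e; rewrite e eqxx in im.
  apply/andP/andP => [[ji /forallP h]|[/andP[ji /forallP h] iv]].
    have ivj : i < v j.
      rewrite ltnNge; apply/negP => vji.
      have := vm _ ji; rewrite permKV => lim.
      by have /forallP/(_ m) := h j; rewrite leqnn jm vji; lia.
    split=> //; apply/andP; split.
      rewrite ltn_neqAle ji andbT; apply/negP => /eqP/ord_inj e.
      by move: ivj; rewrite e permKV ltnn.
    apply/forallP => q; apply/forallP => r; apply/implyP => /and4P[jq jr vq vr].
    by have /forallP/(_ r)/implyP := h q; apply; rewrite vq vr (ltnW jq) (ltnW jr).
  split; first exact: ltnW.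
  apply/forallP => q; apply/forallP => r; apply/implyP => /and4P[jq jr vq vr].
  have jq' : j < q.
    rewrite ltn_neqAle jq andbT; apply/negP => /eqP/ord_inj e; move: iv; rewrite e; lia.
  have [jr'|rj] := ltnP j r; last by lia.
  by have /forallP/(_ r)/implyP := h q; apply; rewrite vq vr jq' jr'.
have eU : [set i | (i, j) \in unmatched] = [set i in suffix_max j.+1 | v j < i].
  by apply/setP => i; rewrite !inE /= [RHS]andbC andbA.
rewrite eS eU cardsU1 inE ltnNge vm // andbF add1n addSn; congr _.+1.
rewrite -[RHS](cardsID [set i : 'I_n | i < v j] (suffix_max j.+1)); congr (_ + _).
  by apply: eq_card => i; rewrite !inE.
apply: eq_card => i; rewrite !inE -leqNgt andbC; apply/andP/andP=> -[h1 h2]; split => //.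
  exact: ltnW.
rewrite ltn_neqAle h1 andbT; apply/negP => /eqP/ord_inj e.
by move: h2; rewrite -e permK ltnn.
Qed.

Lemma card_suffix_max0 : #|suffix_max 0| + #|unmatched| = n.
Proof.
have H t : t <= n -> #|suffix_max (n - t)| +
    \sum_(j : 'I_n | n - t <= j) #|[set i | (i, j) \in unmatched]| = t.
  elim: t => [|t IH] tn.
    rewrite subn0 big1 => [|j]; last by rewrite leqNgt ltn_ord.
    by rewrite addn0; apply: eq_card0 => i; rewrite inE leqNgt ltn_ord.
  have jn : n - t.+1 < n by lia.
  pose j := Ordinal jn.
  rewrite (bigD1 j) //= addnA (card_suffix_max_step j) /=.
  have -> : (n - t.+1).+1 = n - t by lia.
  rewrite -[RHS]/(t.+1) -[in RHS]IH ?addSn //; last by lia.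
  congr (_ + _).+1; apply: eq_bigl => i.
  by rewrite -(inj_eq (@ord_inj n)) /=; lia.
have := H n (leqnn n); rewrite subnn => e; rewrite -[RHS]e; congr (_ + _).
rewrite -sum1_card (eq_bigl (fun c => (c.1, c.2) \in unmatched)); last by case.
rewrite -(pair_big_dep xpredT (fun i j => (i, j) \in unmatched) (fun _ _ => 1)) /=.
rewrite (exchange_big_dep xpredT) //=.
by apply: eq_bigr => j _; rewrite -sum1_card; apply: eq_bigl => i; rewrite inE.
Qed.
End GreedyMatching.

(** * Cyclomatic number, forests and the dimension of the weight cone *)

Local Open Scope ring_scope.

Lemma undirected_sym (V : finType) (E : {set V * V}) : symmetric (undirected E).
Proof. by move=> a b; rewrite /undirected orbC. Qed.

Lemma undirected_connect_sym (V : finType) (E : {set V * V}) :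
  connect_sym (undirected E).
Proof. apply: sym_connect_sym; apply: undirected_sym. Qed.

Section EdgeSpace.
Variables (F : fieldType) (n : nat).
Implicit Types E : {set 'I_n * 'I_n}.

Definition edge_vector (e : 'I_n * 'I_n) : 'rV[F]_n := delta_mx 0 e.1 - delta_mx 0 e.2.

Definition edge_space E : {vspace 'rV[F]_n} := <<[seq edge_vector e | e in E]>>%VS.

(** Right multiplication adds up the coordinates of a row over each component and stores the sum at
    the root of the component. *)
Definition component_sum E : 'M[F]_n :=
  \matrix_(i, j) (fingraph.root (undirected E) i == j)%:R.

Lemma delta_component_sum E i :
  delta_mx 0 i *m component_sum E = delta_mx 0 (fingraph.root (undirected E) i) :> 'rV_n.
Proof. by rewrite -rowE; apply/rowP => j; rewrite !mxE eqxx eq_sym. Qed.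

Lemma edge_vector_connect E a b :
  connect (undirected E) a b -> edge_vector (a, b) \in edge_space E.
Proof.
have step x y : undirected E x y -> edge_vector (x, y) \in edge_space E.
  move=> /orP[xyE|yxE]; first by apply/memv_span/image_f.
  by rewrite /edge_vector -opprB rpredN; apply/memv_span/(image_f _ yxE).
move=> /connectP[p p_path ->]; elim: p a p_path => [|y p IH] a /=.
  by rewrite /edge_vector subrr mem0v.
move=> /andP[/step ay /IH]; rewrite /edge_vector /= in ay * => yp.
by rewrite -(subrKA (delta_mx 0 y)) rpredD.
Qed.

(** If the component sums vanish, [v] is the sum of the [v_i (e_i - e_(root i))], and each of these
    differences telescopes along a path of edges. *)
Lemma mem_edge_space E (v : 'rV_n) :
  (v \in edge_space E) = (v *m component_sum E == 0).
Proof.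
apply/idP/eqP => [/coord_span->|v0].
  rewrite mulmx_suml big1 // => t _; rewrite -scalemxAl.
  have /imageP[[a b] abE ->] : [seq edge_vector e | e in E]`_t \in [seq edge_vector e | e in E].
    by rewrite mem_nth // size_tuple.
  rewrite /edge_vector mulmxBl !delta_component_sum /=.
  have /(fingraph.rootP (undirected_connect_sym E))-> :
    connect (undirected E) a b by apply/connect1; rewrite /undirected abE.
  by rewrite subrr scaler0.
rewrite -[v]subr0 -v0 [v in v - _]row_sum_delta {1}[v in v *m _]row_sum_delta.
rewrite mulmx_suml -sumrB rpred_sum // => i _.
rewrite -scalemxAl delta_component_sum -scalerBr rpredZ //.
exact/edge_vector_connect/connect_root.
Qed.

Lemma edge_vector_mem E a b :
  (edge_vector (a, b) \in edge_space E) = connect (undirected E) a b.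
Proof.
apply/idP/idP; last exact: edge_vector_connect.
rewrite mem_edge_space mulmxBl !delta_component_sum subr_eq0 /= => /eqP/rowP.
move=> /(_ (fingraph.root (undirected E) a)); rewrite !mxE !eqxx /=.
case: eqP => [e _|_ /eqP]; last by rewrite oner_eq0.
by apply/(fingraph.rootP (undirected_connect_sym E)).
Qed.

(** Rank-nullity for the component sums, whose image has the unit vectors at the roots as a
    basis. *)
Lemma dim_edge_space E :
  (\dim (edge_space E) + n_comp (undirected E) predT)%N = n.
Proof.
pose f : 'Hom('rV[F]_n, 'rV[F]_n) := linfun (mulmxr (component_sum E)).
have -> : edge_space E = lker f.
  by apply/vspaceP => v; rewrite mem_edge_space memv_ker lfunE.
have := limg_ker_dim f fullv; rewrite capfv dimvf /dim /= mul1n => e.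
rewrite -[RHS]e; congr (_ + _)%N.
pose r := fingraph.roots (undirected E).
pose X := [tuple (delta_mx 0 (enum_val t) : 'rV[F]_n) | t < #|r|].
have -> : limg f = <<X>>%VS.
  apply/eqP; rewrite eqEsubv; apply/andP; split; apply/subvP => v.
    move=> /memv_imgP[u _ ->]; rewrite lfunE /= [u]row_sum_delta mulmx_suml rpred_sum // => i _.
    rewrite -scalemxAl delta_component_sum rpredZ // memv_span //.
    have ir : fingraph.root (undirected E) i \in r by apply/roots_root/undirected_connect_sym.
    apply/mapP; exists (enum_rank_in ir (fingraph.root (undirected E) i)); rewrite ?mem_enum //.
    by rewrite enum_rankK_in.
  apply: (subvP _ v); apply/span_subvP => _ /mapP[t _ ->].
  have /eqP <- : fingraph.root (undirected E) (enum_val t) == enum_val t by exact: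
    (enum_valP t).
  rewrite -delta_component_sum; have -> : forall u, u *m component_sum E = f u by move=> u;
    rewrite lfunE.
  exact/memv_img/memvf.
have /eqP-> : free X; last first.
  by rewrite size_tuple /n_comp_mem; apply: eq_card => i; rewrite !inE andbT.
apply/freeP => a a0 t; move/rowP: a0 => /(_ (enum_val t)).
rewrite summxE mxE (bigD1 t) //= big1 ?addr0 => [|s st].
  by rewrite (nth_map t) ?size_enum_ord // nth_ord_enum !mxE !eqxx mulr1.
rewrite (nth_map t) ?size_enum_ord // nth_ord_enum !mxE (inj_eq enum_val_inj).
by rewrite eq_sym (negPf st) andbF mulr0.
Qed.

(** The dimension of the edge space drops by one exactly when the deleted edge vector leaves the
    span; [dim_edge_space] turns this into a count of components. *)
Lemma n_comp_edge_setD1 E a b : (a, b) \in E ->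
  n_comp (undirected (E :\ (a, b))) predT =
  (n_comp (undirected E) predT + ~~ connect (undirected (E :\ (a, b))) a b)%N.
Proof.
move=> abE; set E' := E :\ (a, b).
have -> : connect (undirected E') a b = (edge_vector (a, b) \in edge_space E').
  by rewrite edge_vector_mem.
have d := dim_edge_space E; have d' := dim_edge_space E'.
have eqE : edge_space E = (edge_space E' + <[edge_vector (a, b)]>)%VS.
  apply/eqP; rewrite eqEsubv; apply/andP; split.
    apply/span_subvP => _ /imageP[e eE ->]; have [->|ne] := eqVneq e (a, b).
      by apply: (subvP (addvSr _ _)); apply: memv_line.
    by apply: (subvP (addvSl _ _)); apply/memv_span/image_f; rewrite !inE ne.
  apply/subvP => v /memv_addP[x xE' [y /vlineP[c ->] ->]].
  rewrite rpredD ?rpredZ //; last by apply/memv_span/image_f.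
  move: x xE' {v}; apply/subvP/span_subvP => _ /imageP[e /setD1P[_ eE] ->].
  by apply/memv_span/image_f.
have [vE|vE] := boolP (_ \in _).
  by move: d; rewrite eqE (addv_idPl _) ?addn0 -?memvE //; lia.
have : \dim (edge_space E) = (\dim (edge_space E')).+1.
  rewrite eqE dimv_disjoint_sum ?dim_vline; last first.
    apply/eqP; rewrite -subv0; apply/subvP => x /memv_capP[xE /vlineP[c xc]].
    move: xE; rewrite xc memv0; have [->|c0] := eqVneq c 0; first by rewrite scale0r.
    by move=> /(rpredZ c^-1); rewrite scalerK ?(negPf vE) // unitfE.
  suff -> : edge_vector (a, b) != 0 by rewrite addn1.
  by apply: contraNneq vE => ->; rewrite mem0v.
by lia.
Qed.
End EdgeSpace.

Local Close Scope ring_scope.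

(** * The cyclomatic number of the noninversion graph *)

Section NonInversionGraph.
Variables (n : nat) (v : 'S_n).

Definition rothe_edges : {set 'I_n * 'I_n} := [set (v c.2, c.1) | c in opp_rothe v].

Lemma mem_rothe_edges a b :
  ((a, b) \in rothe_edges) = (a < b) && ((v^-1)%g a < (v^-1)%g b).
Proof.
apply/imsetP/andP => [[[i j] /[!inE] /= /andP[? ?] [-> ->]]|[ab pab]].
  by rewrite permK.
by exists (b, (v^-1)%g a); rewrite ?inE /= permKV ?ab.
Qed.

(** The values up to an element of [suffix_max v 0] form a union of components, so distinct elements
    lie in distinct components; and the largest value of any component belongs to
    [suffix_max v 0]. *)
Lemma n_comp_rothe_edges : n_comp (undirected rothe_edges) predT = #|suffix_max v 0|.
Proof.
set e := undirected rothe_edges.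
have eS : connect_sym e by exact: undirected_connect_sym.
have maxP a : a \in suffix_max v 0 ->
    forall b c : 'I_n, b <= a -> a < c -> (v^-1)%g c < (v^-1)%g b.
  rewrite inE => /andP[_ /forallP h] b c ba ac.
  have /forallP/(_ ((v^-1)%g c))/implyP := h ((v^-1)%g b).
  by rewrite !permKV ba ac; apply.
have root_inj : {in suffix_max v 0 &, injective (fingraph.root e)}.
  move=> a b; wlog ab : a b / a <= b => [H aM bM r|].
    by case: (leqP a b) => ab; [apply: H|apply/esym/H => //; exact: ltnW].
  move=> aM bM /(fingraph.rootP eS) ab_conn.
  apply/ord_inj/anti_leq; rewrite ab /= leqNgt; apply/negP => ba.
  have a_closed : fingraph.closed e (fun c : 'I_n => c <= a).
    apply: intro_closed => // x y /orP[]; rewrite mem_rothe_edges unfold_in => /andP[xy pxy] xa.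
      rewrite unfold_in leqNgt; apply/negP => ay.
      by have := maxP a aM x y xa ay; lia.
    by rewrite unfold_in; lia.
  have := closed_connect a_closed ab_conn; rewrite !unfold_in leqnn; lia.
transitivity #|[set fingraph.root e a | a in suffix_max v 0]|; last exact: card_in_imset.
apply: eq_card => r; rewrite !inE andbT; apply/idP/imsetP => [/eqP rr|[a _ ->]];
  last exact/roots_root.
case: (arg_maxnP (fun p : 'I_n => val p) (connect0 e r)) => m rm mmax.
exists m; last by rewrite -rr; apply/(fingraph.rootP eS).
rewrite inE; apply/forallP => q; apply/forallP => s; apply/implyP => /and4P[_ _ vq vs].
have not_max (c : 'I_n) : m < c -> connect e m c -> False.
  by move=> mc conn; have := mmax c (connect_trans rm conn); rewrite /= ; lia.
have edge (x y : 'I_n) : x < y -> v x < v y -> connect e (v x) (v y).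
  move=> xy vxy; apply/connect1; rewrite /e /undirected mem_rothe_edges vxy !permK xy.
  by [].
rewrite ltnNge leq_eqVlt; apply/negP => /orP[/eqP/ord_inj eqs|qs].
  by move: vq vs; rewrite eqs; lia.
have qs_conn := edge q s qs (leq_ltn_trans vq vs).
have [eqm|ne] := eqVneq (v q) m; first by apply: (not_max (v s) vs); rewrite -eqm.
have lt_qm : v q < m by rewrite ltn_neqAle vq andbT; apply: contra_neq ne => /ord_inj.
(* The edge from [v q] to [v s] ties [m] to a larger value: through [v q] if [q] precedes the
   position [p] of [m], directly otherwise. *)
pose p := (v^-1)%g m; have vp : v p = m by rewrite permKV.
have [qp|pq] := ltnP q p.
  have := edge q p qp; rewrite vp => /(_ lt_qm) qm.
  by apply: (not_max (v s) vs); apply: connect_trans qs_conn; rewrite eS.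
have := edge p s (leq_ltn_trans pq qs); rewrite vp => /(_ vs).
exact: not_max.
Qed.

Lemma cyclomatic_rothe_edges : cyclomatic rothe_edges = #|P_set v|%:Z%R.
Proof.
rewrite /cyclomatic P_setE card_ord n_comp_rothe_edges.
have -> : #|rothe_edges| = #|opp_rothe v|.
  by apply: card_imset => -[i j] [i' j'] /= [/perm_inj-> ->].
by have := card_suffix_max0 v; have := card_matching v; lia.
Qed.
End NonInversionGraph.

Local Open Scope ring_scope.

From mathcomp Require Import boolp classical_sets.

Lemma edge_count_lower n (E : {set 'I_n * 'I_n}) :
  (n <= #|E| + n_comp (undirected E) predT)%N.
Proof.
rewrite -{1}(dim_edge_space rat E) leq_add2r.
by apply: leq_trans (dim_span _) _; rewrite size_map -cardE.
Qed.

Lemma undirected_setD1 (V : finType) (E : {set V * V}) e x y :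
  undirected (E :\ e) x y -> undirected E x y.
Proof. by rewrite /undirected !inE => /orP[]/andP[_ ->]; rewrite ?orbT. Qed.

(** An edge of a cycle can be deleted without changing the components, against [edge_count_lower].
    Conversely, an edge whose ends stay connected without it closes a simple path to a cycle, of
    length at least 3 because the reversed edge is absent. *)
Lemma is_forestE n (E : {set 'I_n * 'I_n}) :
    (forall a b, (a, b) \in E -> (a != b) && ((b, a) \notin E)) ->
  is_forest E <-> (#|E| + n_comp (undirected E) predT)%N = n.
Proof.
move=> Eor; split; last first.
  move=> En [[|x [|y [|z s]]] [/andP[c_cyc c_uniq] //= _]].
  have [a [b [abE ab]]] : exists a b, (a, b) \in E /\ ((a, b) = (x, y) \/ (a, b) = (y, x)).
    move: c_cyc => /= /andP[/orP[xyE|yxE] _]; first by exists x, y; split; [|left].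
    by exists y, x; split; [|right].
  have E'E u u' : undirected E u u' -> (u != x) || (u' != y) -> (u' != x) || (u != y) ->
      undirected (E :\ (a, b)) u u'.
    rewrite /undirected !inE !xpair_eqE => h.
    by case: ab => -[-> ->]; move: h => /orP[->|->]; do !case: (_ == _); rewrite ?orbT.
  have xy : connect (undirected (E :\ (a, b))) y x.
    apply/connectP; exists (rcons (z :: s) x); last by rewrite last_rcons.
    move: c_cyc c_uniq; rewrite /= rcons_path => /andP[_ /andP[yz /andP[zs lx]]].
    rewrite !inE !negb_or => /andP[/and3P[xy xz xs] /andP[/andP[yz' ys] /andP[zs' us]]].
    rewrite E'E //= ?rcons_path ?[y == x]eq_sym ?xy // ?[z == x]eq_sym ?xz //.
    apply/andP; split.
      apply: (@sub_in_path _ (predC1 x) (undirected E)) zs.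
        by move=> u u' /=; rewrite !inE => ux u'x uu'; rewrite E'E ?ux ?u'x.
      rewrite /= eq_sym xz; apply/allP => u us' /=; apply/eqP => e.
      by move: xs; rewrite -e us'.
    have lu : last z s \in z :: s by exact: mem_last.
    apply: E'E => //; apply/orP; [left|right]; apply/eqP => e; move: lu; rewrite e inE.
      by rewrite (negPf xz) (negPf xs).
    by rewrite (negPf yz') (negPf ys).
  have := n_comp_edge_setD1 rat abE.
  have -> /= : connect (undirected (E :\ (a, b))) a b.
    by case: ab xy => -[-> ->] //; rewrite undirected_connect_sym.
  have := edge_count_lower (E :\ (a, b)); have := cardsD1 (a, b) E; rewrite abE.
  rewrite add1n addn0 => cE + e; rewrite e => h.
  by move: h; rewrite leqNgt -[X in (_ < X)%N]En cE addSn ltnS leqnn.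
have [m] := ubnP #|E|; elim: m E Eor => // m IH E Eor Em Ef.
have [E0|[[a b] abE]] := set_0Vmem E.
  have := dim_edge_space rat E;
    rewrite /edge_space E0 cards0 /image_mem enum_set0 /= span_nil dimv0.
  by [].
have Ef' : is_forest (E :\ (a, b)).
  move=> [c [/andP[c_cyc c_uniq] c2]]; apply: Ef; exists c; split=> //; apply/andP; split=> //.
  by case: c c_cyc {c_uniq c2} => //= x c; apply: sub_path => u v; apply: undirected_setD1.
have cE := cardsD1 (a, b) E; rewrite abE in cE.
have {}IH : (#|E :\ (a, b)| + n_comp (undirected (E :\ (a, b))) predT)%N = n.
  apply: IH Ef'; last by rewrite cE add1n in Em.
  by move=> u v /setD1P[_ /Eor/andP[-> /= vuE]]; rewrite !inE (negPf vuE) andbF.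
have := n_comp_edge_setD1 rat abE.
have [/connectP[p p_path]|] := boolP (connect (undirected (E :\ (a, b))) a b); last first.
  by move=> _ e; rewrite cE -[RHS]IH e add1n addn1 addSnnS.
case: (shortenP p_path) => p' p'_path p'_uniq _ bE; exfalso; apply: Ef.
exists (a :: p'); have /andP[ab baE] := Eor a b abE.
split; first apply/andP; first split=> //=.
  rewrite rcons_path -bE {2}/undirected abE orbT andbT.
  by move: p'_path; apply: sub_path => u v; apply: undirected_setD1.
case: p' p'_path bE {p'_uniq} => [|x [|y p']] //=; first by move=> _ e; move: ab;
  rewrite e eqxx.
rewrite andbT => ax e; move: ax; rewrite -e /undirected !inE eqxx /= (negPf baE).
by rewrite andbF.
Qed.

Lemma graph_edges_oriented n (v w : 'S_n) a b :
  (a, b) \in graph_edges v w -> (a < b)%N.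
Proof. by move=> /imsetP[[i j]]; rewrite !inE /= => /andP[/andP[vji _] _] [-> ->]. Qed.

Lemma card_graph_edges n (v w : 'S_n) : #|graph_edges v w| = #|weight_cells v w|.
Proof. by apply: card_imset => -[i j] [i' j'] /= [/perm_inj-> ->]. Qed.

(** The generators lie in the cone, so every space containing the cone contains the edge space;
    minimality then determines the dimension chosen by [get]. *)
Lemma cone_dim_weight_cone (R : realType) n (v w : 'S_n) :
  (cone_dim (@weight_cone R n v w) + n_comp (undirected (graph_edges v w)) predT)%N = n.
Proof.
rewrite -[RHS](dim_edge_space R (graph_edges v w)); congr (_ + _)%N.
rewrite /cone_dim; set D := (X in get X); set U := edge_space R _.
have Ucone x : @weight_cone R n v w x -> x \in U.
  move=> [a [_ ->]]; apply: rpred_sum => c cW; apply: rpredZ.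
  have cE : (v c.2, c.1) \in graph_edges v w by apply/imsetP; exists c.
  have -> : delta_mx 0 (v c.2) - delta_mx 0 c.1 = edge_vector R (v c.2, c.1) by [].
  by apply/memv_span; apply: fintype.image_f.
have Umin (U' : {vspace 'rV[R]_n}) :
    (forall x, @weight_cone R n v w x -> x \in U') -> (U <= U')%VS.
  move=> coneU'; apply/span_subvP => _ /fintype.imageP[_ /imsetP[c cW ->] ->].
  apply: coneU'; exists (fun c' => (c' == c)%:R); split=> [c'|]; first exact: ler0n.
  rewrite (bigD1 c) //= eqxx scale1r big1 ?addr0 // => c' /andP[_ /negPf->].
  by rewrite scale0r.
have : D (get D) by apply: getI; exists U.
move=> [V [coneV Vmin <-]].
by congr (\dim _); apply/eqP; rewrite eqEsubv Umin // Vmin.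
Qed.

(** * Algebraic independence of polynomial functions *)

Lemma poly_nonroot (F : numFieldType) (p : {poly F}) : p != 0 -> exists x, p.[x] != 0.
Proof.
move=> p0; apply: contrapT => all0.
have : (size [seq (i%:R : F) | i <- iota 0 (size p)] < size p)%N.
  apply: max_poly_roots => //.
    apply/allP => x _; apply/negPn/negP => px; apply: all0.
    by exists x; rewrite -rootE.
  rewrite map_inj_in_uniq ?iota_uniq // => i j _ _ /eqP.
  by rewrite eqr_nat => /eqP.
by rewrite size_map size_iota ltnn.
Qed.

Lemma poly_eq0_grid (F : numFieldType) (p : {poly F}) d : (size p <= d.+1)%N ->
  (forall k, (k <= d)%N -> p.[k%:R] = 0) -> p = 0.
Proof.
move=> pd pk; apply/eqP/negPn/negP => p0.
have : (size [seq (i%:R : F) | i <- iota 0 d.+1] < size p)%N.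
  apply: max_poly_roots => //.
    by apply/allP => _ /mapP[k /[!mem_iota] /= kd ->]; rewrite rootE pk.
  rewrite map_inj_in_uniq ?iota_uniq // => i j _ _ /eqP.
  by rewrite eqr_nat => /eqP.
by rewrite size_map size_iota ltnNge pd.
Qed.

Section PolynomialFunctions.
Variable F : numFieldType.

(** Polynomials are kept as functions over an arbitrary index type of coordinates, so that
    substituting a parametrization is plain composition. *)
Inductive polyfun (I : Type) : ((I -> F) -> F) -> Prop :=
| polyfun_cst c : polyfun (fun=> c)
| polyfun_var i : polyfun (fun t => t i)
| polyfun_add f g : polyfun f -> polyfun g -> polyfun (fun t => f t + g t)
| polyfun_mul f g : polyfun f -> polyfun g -> polyfun (fun t => f t * g t).

Section Closure.
Variable I : Type.
Implicit Types f g : (I -> F) -> F.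

Lemma polyfun_ext f g : polyfun f -> (forall t, f t = g t) -> polyfun g.
Proof. by move=> pf /funext <-. Qed.

Lemma polyfun_opp f : polyfun f -> polyfun (fun t => - f t).
Proof.
move=> pf; by apply: polyfun_ext (polyfun_mul (@polyfun_cst I (-1)) pf) _ => t; rewrite mulN1r.
Qed.

Lemma polyfun_sub f g : polyfun f -> polyfun g -> polyfun (fun t => f t - g t).
Proof. by move=> pf pg; apply/polyfun_add/polyfun_opp. Qed.

Lemma polyfun_sum (K : Type) (r : seq K) (P : pred K) (f : K -> (I -> F) -> F) :
  (forall k, P k -> polyfun (f k)) -> polyfun (fun t => \sum_(k <- r | P k) f k t).
Proof.
move=> pf; elim: r => [|k r IH].
  by apply: polyfun_ext (@polyfun_cst I 0) _ => t; rewrite big_nil.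
have [Pk|nPk] := boolP (P k).
  by apply: polyfun_ext (polyfun_add (pf k Pk) IH) _ => t; rewrite big_cons Pk.
by apply: polyfun_ext IH _ => t; rewrite big_cons (negPf nPk).
Qed.

Lemma polyfun_prod (K : Type) (r : seq K) (P : pred K) (f : K -> (I -> F) -> F) :
  (forall k, P k -> polyfun (f k)) -> polyfun (fun t => \prod_(k <- r | P k) f k t).
Proof.
move=> pf; elim: r => [|k r IH].
  by apply: polyfun_ext (@polyfun_cst I 1) _ => t; rewrite big_nil.
have [Pk|nPk] := boolP (P k).
  by apply: polyfun_ext (polyfun_mul (pf k Pk) IH) _ => t; rewrite big_cons Pk.
by apply: polyfun_ext IH _ => t; rewrite big_cons (negPf nPk).
Qed.

Lemma polyfun_exp f k : polyfun f -> polyfun (fun t => f t ^+ k).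
Proof.
move=> pf; elim: k => [|k IH]; first exact: polyfun_cst.
by apply: polyfun_ext (polyfun_mul pf IH) _ => t; rewrite exprS.
Qed.

Lemma polyfun_if (b : bool) f g : polyfun f -> polyfun g ->
  polyfun (fun t => if b then f t else g t).
Proof. by case: b. Qed.

Lemma polyfun_det m (A : (I -> F) -> 'M[F]_m) :
  (forall i j, polyfun (fun t => A t i j)) -> polyfun (fun t => \det (A t)).
Proof.
move=> pA; apply: polyfun_sum => s _; apply: polyfun_mul; first exact: polyfun_cst.
by apply: polyfun_prod => i _; apply: pA.
Qed.

Lemma polyfun_line f t u : polyfun f ->
  exists p : {poly F}, forall s, f (fun i => t i + s * u i) = p.[s].
Proof.
elim=> [c|i|{}f g _ [p ep] _ [q eq]|{}f g _ [p ep] _ [q eq]].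
- by exists c%:P => s; rewrite hornerC.
- by exists ((t i)%:P + (u i) *: 'X) => s; rewrite !hornerE mulrC.
- by exists (p + q) => s; rewrite ep eq hornerD.
- by exists (p * q) => s; rewrite ep eq hornerM.
Qed.

(** On the line through [t1] and [t2] both functions restrict to nonzero polynomials in one
    variable, hence so does their product. This is the irreducibility of affine spaces. *)
Lemma polyfun_line_neq0 f g t1 t2 : polyfun f -> polyfun g -> f t1 != 0 -> g t2 != 0 ->
  exists s, f (fun i => t1 i + s * (t2 i - t1 i)) * g (fun i => t1 i + s * (t2 i - t1 i)) != 0.
Proof.
move=> pf pg f1 g2; pose u i := t2 i - t1 i.
have [p ep] := polyfun_line t1 u pf; have [q eq] := polyfun_line t1 u pg.
have p0 : p != 0.
  apply: contraNneq f1 => p0; apply/eqP; transitivity (p.[0]); last by rewrite p0 horner0.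
  by rewrite -ep; congr f; apply/funext => i; rewrite mul0r addr0.
have q0 : q != 0.
  apply: contraNneq g2 => q0; apply/eqP; transitivity (q.[1]); last by rewrite q0 horner0.
  by rewrite -eq; congr g; apply/funext => i; rewrite mul1r /u addrC subrK.
have [s pqs] := poly_nonroot (mulf_neq0 p0 q0).
by exists s; rewrite ep eq -hornerM.
Qed.
End Closure.

Lemma polyfun_comp I J (f : (I -> F) -> F) (phi : (J -> F) -> I -> F) :
  polyfun f -> (forall i, polyfun (fun t => phi t i)) -> polyfun (fun t => f (phi t)).
Proof.
move=> pf pphi; elim: pf => [c|i|{}f g _ pf _ pg|{}f g _ pf _ pg].
- exact: polyfun_cst.
- exact: pphi.
- exact: polyfun_add.
- exact: polyfun_mul.
Qed.

Section SeparateDegree.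
Variable I : eqType.
Implicit Types f g : (I -> F) -> F.

Definition update (t : I -> F) i s : I -> F := fun j => if j == i then s else t j.

Lemma update_id t i : update t i (t i) = t.
Proof. by apply/funext => j; rewrite /update; case: eqP => // ->. Qed.

Definition degree_le d f := forall i t, exists2 p : {poly F},
  (size p <= d.+1)%N & forall s, f (update t i s) = p.[s].

Lemma degree_leW d d' f : (d <= d')%N -> degree_le d f -> degree_le d' f.
Proof. by move=> dd' df i t; have [p pd pE] := df i t; exists p => //; lia. Qed.

Lemma degree_le_cst c : degree_le 0 (fun=> c).
Proof. by move=> i t; exists c%:P => [|s]; rewrite ?size_polyC ?hornerC //; case: eqP. Qed.

Lemma degree_le_add d f g : degree_le d f -> degree_le d g -> degree_le d (fun t => f t + g t).
Proof.
move=> df dg i t; have [p pd pE] := df i t; have [q qd qE] := dg i t.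
exists (p + q) => [|s]; last by rewrite pE qE hornerD.
by rewrite (leq_trans (size_polyD _ _)) // geq_max pd.
Qed.

Lemma degree_le_mul d d' f g : degree_le d f -> degree_le d' g ->
  degree_le (d + d') (fun t => f t * g t).
Proof.
move=> df dg i t; have [p pd pE] := df i t; have [q qd qE] := dg i t.
exists (p * q) => [|s]; last by rewrite pE qE hornerM.
by rewrite (leq_trans (size_polyMleq _ _)) //; lia.
Qed.

Lemma degree_le_exp d f k : degree_le d f -> degree_le (k * d) (fun t => f t ^+ k).
Proof.
move=> df; elim: k => [|k IH]; first exact: degree_le_cst.
have -> : (fun t => f t ^+ k.+1) = (fun t => f t * f t ^+ k).
  by apply/funext => t; rewrite exprS.
by rewrite mulSn; apply: degree_le_mul.
Qed.

Lemma degree_le_sum d (K : Type) (r : seq K) (f : K -> (I -> F) -> F) :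
  (forall k, degree_le d (f k)) -> degree_le d (fun t => \sum_(k <- r) f k t).
Proof.
move=> df; elim: r => [|k r IH].
  have -> : (fun t => \sum_(k <- [::]) f k t) = fun=> 0 by apply/funext => t; rewrite big_nil.
  exact/(degree_leW (leq0n d))/degree_le_cst.
have -> : (fun t => \sum_(j <- k :: r) f j t) = (fun t => f k t + \sum_(j <- r) f j t).
  by apply/funext => t; rewrite big_cons.
exact: degree_le_add.
Qed.

Lemma polyfun_degree f : polyfun f -> exists d, degree_le d f.
Proof.
elim=> [c|i|{}f g _ [d df] _ [d' dg]|{}f g _ [d df] _ [d' dg]].
- by exists 0%N; apply: degree_le_cst.
- exists 1%N => j t; have [e|ne] := eqVneq i j.
    by exists 'X => [|s]; rewrite ?size_polyX // hornerX /update e eqxx.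
  exists (t i)%:P => [|s]; first by rewrite size_polyC; case: eqP.
  by rewrite hornerC /update (negPf ne).
- exists (maxn d d'); apply: degree_le_add.
    exact: degree_leW (leq_maxl _ _) df.
  exact: degree_leW (leq_maxr _ _) dg.
- by exists (d + d')%N; apply: degree_le_mul.
Qed.

Lemma degree_le_grid_eq0 d f (T : seq I) : degree_le d f ->
    (forall t, (forall i, i \in T -> exists2 k, (k <= d)%N & t i = k%:R) -> f t = 0) ->
  forall t, f t = 0.
Proof.
move=> df; elim: T => [|i T IH] fT; first by move=> t; apply: fT.
apply: IH => t tT; rewrite -(update_id t i); have [p pd pE] := df i t.
rewrite pE (poly_eq0_grid pd) ?horner0 // => k kd; rewrite -pE.
apply: fT => j; rewrite /update inE; have [_ _|_ /tT//] := eqVneq j i.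
by exists k.
Qed.
End SeparateDegree.
End PolynomialFunctions.

Local Open Scope classical_set_scope.
Local Open Scope ring_scope.

(** Nested pairs, rather than a function type, let [monomial] recurse along the list of
    functions. *)
Fixpoint exponents (K m : nat) : finType :=
  if m is m'.+1 then ('I_K * exponents K m')%type : finType else unit.

Lemma card_exponents K m : #|exponents K m| = (K ^ m)%N.
Proof. by elim: m => [|m IH] /=; rewrite ?card_unit // card_prod card_ord IH expnS. Qed.

Section AlgebraicIndependence.
Variables (F : numFieldType) (X : Type).
Local Notation point := (X -> F).
Implicit Types (Z : set point) (f g h : point -> F) (fs : seq (point -> F)).

Fixpoint monomial K fs : exponents K (size fs) -> point -> F :=
  match fs with
  | [::] => fun _ _ => 1
  | f :: fs' => fun e z => f z ^+ (e.1 : 'I_K) * monomial e.2 z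
  end.

Definition independent Z fs := forall K (a : exponents K (size fs) -> F),
  (forall z, Z z -> \sum_e a e * monomial e z = 0) -> forall e, a e = 0.

(** Equivalently, the ideal of polynomials vanishing on [Z] is prime. *)
Definition function_irreducible Z := Z !=set0 /\
  forall f g, polyfun f -> polyfun g -> (forall z, Z z -> f z * g z = 0) ->
    (forall z, Z z -> f z = 0) \/ (forall z, Z z -> g z = 0).

Definition polyfuns fs := forall f, List.In f fs -> polyfun f.

Lemma polyfun_monomial K fs (e : exponents K (size fs)) :
  polyfuns fs -> polyfun (monomial e).
Proof.
elim: fs e => [|f fs IH] e pfs /=; first exact: polyfun_cst.
apply: polyfun_mul; first by apply: polyfun_exp; apply: pfs; left.
by apply: IH => g gfs; apply: pfs; right.
Qed.

(* Divide a relation among [h :: fs] on [Z'] by the largest possible power of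
   [h]; its restriction to [Z] is then a relation among [fs]. *)
Lemma independent_cons Z Z' h fs :
    polyfuns fs -> polyfun h -> independent Z fs -> (forall z, Z z -> Z' z) ->
    function_irreducible Z' -> (forall z, Z z -> h z = 0) -> (exists2 z, Z' z & h z != 0) ->
  independent Z' (h :: fs).
Proof.
move=> pfs ph Zfs ZZ' [_ Zirr] hZ [z0 Zz0 hz0] K a aZ [k e].
have [m] := ubnP (k : nat); elim: m k e => // m IH k e km.
pose A (k' : 'I_K) z := \sum_e a (k', e) * monomial e z.
have pA k' : polyfun (A k').
  by apply: polyfun_sum => e' _; apply: polyfun_mul; [apply: polyfun_cst|apply:
    polyfun_monomial].
pose Q z := \sum_(k' < K | (k <= k')%N) h z ^+ (k' - k) * A k' z.
have pQ : polyfun Q.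
  by apply: polyfun_sum => k' _; apply: polyfun_mul; [apply: polyfun_exp|apply: pA].
have hQ z : Z' z -> h z ^+ k * Q z = 0.
  move=> Zz; have : \sum_(k' < K) \sum_e' a (k', e') * (h z ^+ k' * monomial e' z) = 0.
    rewrite pair_big -[RHS](aZ z Zz); apply: eq_big => [|[k' e'] _] //.
  rewrite (bigID (fun k' : 'I_K => (k <= k')%N)) /= [X in _ + X]big1 ?addr0 => [<-|k' kk'].
    rewrite mulr_sumr; apply: eq_bigr => k' kk'; rewrite mulrA -exprD subnKC // mulr_sumr.
    by apply: eq_bigr => e' _; rewrite mulrCA.
  rewrite big1 // => e' _; rewrite IH ?mul0r //.
  by move: km kk'; rewrite -ltnNge; lia.
have QZ z : Z' z -> Q z = 0.
  have [h0|Q0] := Zirr _ _ (polyfun_exp k ph) pQ hQ; last exact: Q0.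
  by move: hz0 (h0 _ Zz0) => /negPf hz0 /eqP; rewrite expf_eq0 hz0 andbF.
apply: (Zfs K (fun e => a (k, e))) => z Zz; have := QZ z (ZZ' z Zz).
rewrite /Q (bigD1 k) //= subnn expr0 mul1r [X in _ + X]big1 ?addr0 // => k' /andP[kk' ne].
rewrite hZ // expr0n subn_eq0 leqNgt ltn_neqAle kk' andbT.
have -> : (k != k' :> nat) by apply: contra ne => /eqP/ord_inj ->.
by rewrite mul0r.
Qed.

(** Each strict inclusion contributes a function vanishing on the smaller set but not on the larger,
    and [independent_cons] adds it to the list. This stands in for transcendence degree. *)
Lemma independent_chain (Z : nat -> set point) m :
    (forall i, (i <= m)%N -> function_irreducible (Z i)) ->
    (forall i, (i < m)%N -> (forall z, Z i z -> Z i.+1 z) /\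
       exists2 h, polyfun h & (forall z, Z i z -> h z = 0) /\ exists2 z, Z i.+1 z & h z != 0) ->
  exists fs, [/\ size fs = m, polyfuns fs & independent (Z m) fs].
Proof.
move=> Zirr Zstep; elim: m Zirr Zstep => [|m IH] Zirr Zstep.
  exists [::]; split=> // K a aZ []; have [[z Zz] _] := Zirr 0%N (leqnn _).
  have := aZ z Zz; rewrite (bigD1 tt) //= big1 ?addr0 ?mulr1 // => -[].
have [fs [sfs pfs ifs]] : exists fs, [/\ size fs = m, polyfuns fs & independent (Z m) fs].
  by apply: IH => i im; [apply: Zirr|apply: Zstep]; apply: leqW.
have [Zsub [h ph [hZ hZ']]] := Zstep m (leqnn _).
exists (h :: fs); split; first by rewrite /= sfs.
  by move=> f [<-|/pfs].
by apply: (independent_cons pfs ph ifs Zsub _ hZ hZ'); exact: Zirr.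
Qed.

(** If some [h] vanishes on [Im c] but not on [Z], the part of [Z] where [h] is nonzero is still
    irreducible and is covered by the remaining images; a polynomial vanishing on that part vanishes
    on [Z]. *)
Lemma function_irreducible_cover (J : Type) (Im : J -> set point) (s : seq J) Z :
    function_irreducible Z -> (forall z, Z z -> exists2 c, List.In c s & Im c z) ->
  exists2 c, List.In c s &
    forall h, polyfun h -> (forall z, Im c z -> h z = 0) -> forall z, Z z -> h z = 0.
Proof.
elim: s Z => [|c s IH] Z [[z0 Zz0] Zirr] Zcov; first by have [] := Zcov z0 Zz0.
apply: contrapT => none.
have [h [ph hc [z1 Zz1 hz1]]] : exists h, [/\ polyfun h, forall z, Im c z -> h z = 0 &
    exists2 z, Z z & h z != 0].
  apply: contrapT => noh; apply: none; exists c; [by left|move=> h ph hc z Zz].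
  by apply: contrapT => /eqP hz; apply: noh; exists h; split=> //; exists z.
pose Z' : set point := [set z | Z z /\ h z != 0].
have Z'irr : function_irreducible Z'.
  split; first by exists z1.
  move=> f g pf pg fg.
  have [H|H] : (forall z, Z z -> h z * f z = 0) \/ (forall z, Z z -> g z = 0).
  - apply: Zirr => // [|z Zz]; first exact: polyfun_mul.
    have [hz|hz] := eqVneq (h z) 0; first by rewrite hz !mul0r.
    by rewrite -mulrA fg ?mulr0.
  - left=> z [Zz /negPf hz]; have := H z Zz => /eqP.
    by rewrite mulf_eq0 hz => /eqP.
  - by right=> z [Zz _]; apply: H.
have Z'cov z : Z' z -> exists2 c, List.In c s & Im c z.
  move=> [Zz hz]; have [c' [e|c's] Iz] := Zcov z Zz; last by exists c'.
  by move: hz; rewrite hc ?eqxx // e.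
have [c' c's Hc'] := IH Z' Z'irr Z'cov; apply: none.
exists c'; [by right|move=> f pf fc z Zz].
have [hf|H] : (forall z, Z z -> h z = 0) \/ (forall z, Z z -> f z = 0).
- apply: Zirr => // z' Zz'; have [->|hz'] := eqVneq (h z') 0; first by rewrite mul0r.
  by rewrite (Hc' f pf fc z') ?mulr0.
- by move: hz1; rewrite hf ?eqxx.
- exact: H.
Qed.

(* If there were more functions than parameters, the monomials with exponents
   less than a large [K] would outnumber the points of a grid on which a
   polynomial of their separate degrees vanishes only if it is zero. *)
Lemma independent_bound (J : finType) (T : {set J}) (phi : (J -> F) -> point) Z fs :
    (forall x, polyfun (fun t => phi t x)) ->
    (forall t t', (forall i, i \in T -> t i = t' i) -> phi t = phi t') ->
    (forall h, polyfun h -> (forall t, h (phi t) = 0) -> forall z, Z z -> h z = 0) ->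
    polyfuns fs -> independent Z fs -> (size fs <= #|T|)%N.
Proof.
move=> pphi phiT Zphi pfs indep; rewrite leqNgt; apply/negP => Tfs.
have [D degD] : exists D, forall f, List.In f fs -> degree_le D (fun t => f (phi t)).
  elim: (fs) pfs => [|f gs IH] pgs; first by exists 0%N.
  have [D1 d1] := polyfun_degree (polyfun_comp (pgs f (or_introl (erefl f))) pphi).
  have [|D2 d2] := IH; first by move=> g ggs; apply: pgs; right.
  exists (maxn D1 D2) => g [<-|/d2]; first exact: degree_leW (leq_maxl _ _) d1.
  exact/degree_leW/leq_maxr.
pose m := size fs; pose d := #|T|.
(* Since [D'.+1 <= K * (m * D).+1], this choice makes the grid of [D'.+1 ^ d] points smaller than
   [K ^ d.+1 <= K ^ m], the number of monomials. *)
pose K := ((m * D).+1 ^ d).+1.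
pose D' := (m * (K * D))%N.
have degM (e : exponents K (size fs)) : degree_le D' (fun t => monomial e (phi t)).
  rewrite /D' /m; elim: (fs) degD e => [|f gs IH] dgs e /=; first exact: degree_le_cst.
  rewrite mulSn; apply: degree_le_mul; last by apply: IH => g ggs; apply: dgs; right.
  apply: (@degree_leW _ _ (e.1 * D)); first by rewrite leq_mul2r ltnW ?orbT.
  by apply: degree_le_exp; apply: dgs; left.
pose Tt : finType := {x : J | x \in T}.
pose G : finType := {ffun Tt -> 'I_D'.+1}.
pose pt (g : G) (i : J) : F := if insub i is Some x then (g x : nat)%:R else 0.
pose A : 'M[F]_(#|exponents K (size fs)|, #|G|) :=
  \matrix_(e, g) monomial (enum_val e) (phi (pt (enum_val g))).
have ltGE : (#|G| < #|exponents K (size fs)|)%N.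
  rewrite card_exponents card_ffun card_ord card_sig -/m.
  have -> : #|[pred x | x \in T]| = d by [].
  have dm : (d.+1 <= m)%N by [].
  apply: (@leq_trans (K ^ d.+1)); last by rewrite leq_pexp2l.
  apply: (@leq_ltn_trans ((K * (m * D).+1) ^ d)%N).
    have leq_exp a b e : (a <= b -> a ^ e <= b ^ e)%N by case: e => // e; rewrite leq_exp2r.
    by apply: leq_exp; rewrite /D' mulnS mulnCA; lia.
  by rewrite expnMn expnS mulnC ltn_pmul2r ?expn_gt0.
have kerA : kermx A != 0.
  by rewrite -mxrank_eq0 mxrank_ker subn_eq0 -ltnNge (leq_ltn_trans (rank_leq_col A)).
have [u /sub_kermxP uA u0] := rowV0Pn kerA.
pose a e := u 0 (enum_rank e).
pose h z := \sum_e a e * monomial e z.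
have ph : polyfun h.
  by apply: polyfun_sum => e _; apply: polyfun_mul; [apply: polyfun_cst|apply:
    polyfun_monomial].
have degh : degree_le D' (fun t => h (phi t)).
  apply: degree_le_sum => e; rewrite -[D']add0n; apply: degree_le_mul => //.
  exact: degree_le_cst.
have hphi t : h (phi t) = 0.
  move: t; apply: (degree_le_grid_eq0 (T := enum T) degh) => t tT.
  have [g ->] : exists g : G, phi t = phi (pt g).
    have /fin_all_exists[g gE] : forall x : Tt, exists k : 'I_D'.+1, t (val x) = (k : nat)%:R.
      move=> [i iT]; have [|k kD tk] := tT i; first by rewrite mem_enum.
      by exists (Ordinal (kD : (k < D'.+1)%N)).
    exists [ffun x => g x]; apply: phiT => i iT; rewrite /pt insubT ffunE.
    by rewrite -gE.
  rewrite /h; have := congr1 (fun B : 'rV_ _ => B 0 (enum_rank g)) uA.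
  rewrite !mxE => uA0; rewrite -[RHS]uA0 (reindex_onto enum_val enum_rank) /=; last first.
    by move=> e _; rewrite enum_rankK.
  apply: eq_big => [e|e _]; first by rewrite enum_valK eqxx.
  by rewrite /a enum_valK !mxE enum_rankK.
have a0 : forall e, a e = 0 by apply: (indep K); apply: Zphi.
case/eqP: u0; apply/rowP => e; rewrite mxE -[RHS](a0 (enum_val e)) /a enum_valK.
by [].
Qed.
End AlgebraicIndependence.

(** * Triangular matrices *)

Lemma ord_gt_eqF n (i j : 'I_n) : (j < i)%N -> (i == j) = false.
Proof. by move=> ji; apply/eqP => e; rewrite e ltnn in ji. Qed.

Lemma ord_lt_eqF n (i j : 'I_n) : (i < j)%N -> (i == j) = false.
Proof. by move=> ij; rewrite eq_sym ord_gt_eqF. Qed.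

Section TriangularMatrices.
Variables (F : fieldType) (n : nat).
Implicit Types (g h b : 'M[F]_n) (u v : 'S_n).

Definition upper : pred 'M[F]_n := [pred b | (b \in unitmx) && is_trig_mx b^T].

Lemma upperP b : reflect ((forall i j : 'I_n, (j < i)%N -> b i j = 0) /\ (forall i, b i i != 0))
  (upper b).
Proof.
rewrite /upper /=; apply: (iffP andP) => [[bU /is_trig_mxP bT]|[bT b0]].
  split=> [i j ji|i]; first by have := bT j i ji; rewrite mxE.
  move: bU; rewrite unitmxE -det_tr det_trig; last exact/is_trig_mxP.
  rewrite unitfE => /prodf_neq0/(_ i isT); by rewrite mxE.
have bT' : is_trig_mx b^T by apply/is_trig_mxP => i j ij; rewrite mxE bT.
split=> //; rewrite unitmxE -det_tr det_trig // unitfE.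
by apply/prodf_neq0 => i _; rewrite mxE.
Qed.

Lemma upper1 : upper 1%:M.
Proof.
by apply/upperP; split=> [i j ji|i]; rewrite mxE ?eqxx ?oner_eq0 // ord_gt_eqF.
Qed.

Lemma upperM b b' : upper b -> upper b' -> upper (b *m b').
Proof.
move=> /upperP[bT b0] /upperP[bT' b0']; apply/upperP; split=> [i j ji|i]; rewrite mxE.
  apply: big1 => k _; have [ki|ik] := ltnP k i; first by rewrite bT ?mul0r.
  by rewrite bT' ?mulr0 //; lia.
rewrite (bigD1 i) //= big1 ?addr0 ?mulf_neq0 // => k ki.
have [ki'|ik] := ltnP k i; first by rewrite bT ?mul0r.
by rewrite bT' ?mulr0 // ltn_neqAle ik andbT; apply: contra_neq ki => /ord_inj.
Qed.

Lemma upperV b : upper b -> upper (invmx b).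
Proof.
move=> bU; have /upperP[bT b0] := bU; have b_unit : b \in unitmx by case/andP: bU.
have bV : b *m invmx b = 1%:M by apply: mulmxV.
have VT (i j : 'I_n) : (j < i)%N -> invmx b i j = 0.
  have [m] := ubnP (n - i); elim: m i => // m IH i im ji.
  have := congr1 (fun c : 'M_n => c i j) bV; rewrite !mxE (bigD1 i) //= big1 ?addr0.
    rewrite (_ : (i == j) = false) => [/eqP|]; last by rewrite ord_gt_eqF.
    by rewrite mulf_eq0 (negPf (b0 i)) => /eqP.
  move=> k ki; have [ki'|ik] := ltnP k i; first by rewrite bT ?mul0r.
  have lt_ik : (i < k)%N by rewrite ltn_neqAle ik andbT; apply: contra_neq ki => /ord_inj.
  by rewrite IH ?mulr0 //; have := ltn_ord k; lia.
apply/andP; split; first by rewrite unitmx_inv.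
by apply/is_trig_mxP => i j ij; rewrite mxE VT.
Qed.

Lemma upper_unitmx b : upper b -> b \in unitmx.
Proof. by case/andP. Qed.

Lemma perm_matrixE v : perm_matrix F v = perm_mx (v^-1)%g.
Proof.
by apply/matrixP => i j; rewrite !mxE -[_ == j](inj_eq (@perm_inj _ v)) permKV eq_sym.
Qed.

Lemma perm_matrix_unit v : perm_matrix F v \in unitmx.
Proof. by rewrite perm_matrixE unitmx_perm. Qed.

Definition col_step (m : 'I_n) (c : 'I_n -> F) : 'M[F]_n :=
  \matrix_(i, j) ((i == j)%:R + (i == m)%:R * c j).

Lemma mul_col_step h m c i j : (h *m col_step m c) i j = h i j + h i m * c j.
Proof.
rewrite mxE; under eq_bigr => k _ do rewrite mxE mulrDr.
rewrite big_split /= (bigD1 j) //= eqxx mulr1 big1 ?addr0 => [|k /negPf->];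
  last by rewrite mulr0.
rewrite (bigD1 m) //= eqxx mul1r big1 ?addr0 // => k /negPf->.
by rewrite mul0r mulr0.
Qed.

Lemma upper_col_step (m : 'I_n) c : (forall j : 'I_n, (j < m)%N -> c j = 0) -> 1 + c m != 0 ->
  upper (col_step m c).
Proof.
move=> c0 cm; apply/upperP; split=> [i j ji|i]; rewrite mxE.
  rewrite ord_gt_eqF // add0r; have [e|_] := eqVneq i m; last by rewrite mul0r.
  by rewrite c0 ?mulr0 // -e.
rewrite eqxx; have [->|_] := eqVneq i m; first by rewrite mul1r.
by rewrite mul0r addr0 oner_eq0.
Qed.

Definition row_step (m : 'I_n) (c : 'I_n -> F) : 'M[F]_n :=
  \matrix_(i, j) ((i == j)%:R + c i * (j == m)%:R).

Lemma mul_row_step h m c i j : (row_step m c *m h) i j = h i j + c i * h m j.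
Proof.
rewrite mxE; under eq_bigr => k _ do rewrite mxE mulrDl.
rewrite big_split /= (bigD1 i) //= eqxx mul1r big1 ?addr0 => [|k]; last first.
  by rewrite eq_sym => /negPf->; rewrite mul0r.
rewrite (bigD1 m) //= eqxx mulr1 big1 ?addr0 // => k /negPf->.
by rewrite mulr0 mul0r.
Qed.

Lemma upper_row_step (m : 'I_n) c : (forall i : 'I_n, (m < i)%N -> c i = 0) -> 1 + c m != 0 ->
  upper (row_step m c).
Proof.
move=> c0 cm; apply/upperP; split=> [i j ji|i]; rewrite mxE.
  rewrite ord_gt_eqF // add0r; have [e|_] := eqVneq j m; last by rewrite mulr0.
  by rewrite c0 ?mul0r // -e.
rewrite eqxx; have [->|_] := eqVneq i m; first by rewrite mulr1.
by rewrite mulr0 addr0 oner_eq0.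
Qed.

(* Eliminate the columns from left to right, with the lowest nonzero entry as pivot. *)
Lemma bruhat_decomposition g : g \in unitmx ->
  exists u b b', [/\ upper b, upper b' & g = b *m perm_matrix F u *m b'].
Proof.
move=> gU.
have elim_cols m : (m <= n)%N -> exists (b b' : 'M[F]_n) (f : 'I_n -> 'I_n),
    [/\ upper b, upper b' & forall j : 'I_n, (j < m)%N ->
      (forall i, (b *m g *m b') i j = (i == f j)%:R) /\
      (forall k, (b *m g *m b') (f j) k = (k == j)%:R)].
  elim: m => [|m IH] mn.
    by exists 1%:M, 1%:M, id; rewrite !upper1.
  have [b [b' [f [bU bU' H]]]] := IH (ltnW mn).
  set h := b *m g *m b' in H.
  have hU : h \in unitmx by rewrite !unitmx_mul gU !upper_unitmx.
  pose M := Ordinal mn.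
  have [i0 hi0] : exists i, h i M != 0.
    case: (pickP (fun i => h i M != 0)) => [i hi|h0]; first by exists i.
    have : delta_mx 0 M *m h^T = 0 :> 'rV_n.
      by rewrite -rowE; apply/rowP => i; rewrite [LHS]mxE [LHS]mxE [RHS]mxE; apply/eqP/negbFE;
        exact: h0.
    move=> /(congr1 (fun x => x *m invmx h^T)); rewrite mulmxK ?unitmx_tr // mul0mx.
    by move=> /rowP/(_ M)/eqP; rewrite !mxE !eqxx oner_eq0.
  pose P i := h i M != 0.
  have Pi0 : P i0 by [].
  case: (arg_maxnP (fun i : 'I_n => val i) Pi0) => i ai imax.
  rewrite /P in ai; set a := h i M in ai.
  have below0 (r : 'I_n) : (i < r)%N -> h r M = 0.
    by move=> ir; apply/eqP/negPn/negP => /imax /=; rewrite leqNgt ir.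
  have fi (j : 'I_n) : (j < m)%N -> f j != i.
    move=> jm; apply: contra_neq ai => fj; have [_ /(_ M)] := H j jm.
    by rewrite /a -fj => ->; rewrite (_ : (M == j) = false) // ord_gt_eqF.
  have left0 (j : 'I_n) : (j < m)%N -> h i j = 0.
    by move=> jm; have [-> _] := H j jm; rewrite eq_sym (negPf (fi j jm)).
  (* The column step scales the pivot to [1] and clears its row to the right; the row step with [d]
     then clears the column of the pivot above it. *)
  pose c j := ((j == M)%:R - h i j) / a.
  have cU : upper (col_step M c).
    apply: upper_col_step => [j jM|].
      by rewrite /c left0 // (_ : (j == M) = false) ?subrr ?mul0r // ord_lt_eqF.
    by rewrite /c eqxx mulrBl -/a divff // addrC subrK mul1r invr_eq0.
  pose h1 := h *m col_step M c.
  have h1E r j : h1 r j = h r j + h r M * c j by rewrite /h1 mul_col_step.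
  have h1i j : h1 i j = (j == M)%:R by rewrite h1E -/a /c mulrC divfK // addrC subrK.
  pose d r := (r == i)%:R - h1 r M.
  have dU : upper (row_step i d).
    apply: upper_row_step => [r ir|].
      by rewrite /d h1E below0 // mul0r addr0 (_ : (r == i) = false) ?subr0 // ord_gt_eqF.
    by rewrite /d eqxx h1i eqxx subrr addr0 oner_eq0.
  exists (row_step i d *m b), (b' *m col_step M c), (fun j => if j == M then i else f j).
  split; [exact: upperM|exact: upperM|move=> j jm].
  have -> : row_step i d *m b *m g *m (b' *m col_step M c) = row_step i d *m h1.
    by rewrite /h1 /h !mulmxA.
  have [->|jM] := eqVneq j M.
    rewrite ?eqxx; split=> r; rewrite mul_row_step h1i;
      first by rewrite eqxx mulr1 /d addrC subrK.
    by rewrite /d eqxx h1i eqxx subrr mul0r addr0.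
  have {}jm : (j < m)%N.
    by rewrite ltn_neqAle -ltnS jm andbT; apply: contra jM => /eqP jm'; apply/eqP/ord_inj.
  have [Hc Hr] := H j jm.
  have cj : c j = 0 by rewrite /c left0 // (negPf jM) subrr mul0r.
  have h1j r : h1 r j = (r == f j)%:R by rewrite h1E cj mulr0 addr0 Hc.
  split=> r; rewrite mul_row_step h1i.
    by rewrite (negPf jM) mulr0 addr0 h1j.
  have h1f k : h1 (f j) k = (k == j)%:R.
    by rewrite h1E !Hr (_ : (M == j) = false) ?mul0r ?addr0 // eq_sym (negPf jM).
  rewrite h1f /d h1f (negPf (fi j jm)) (_ : (M == j) = false) ?subrr ?mul0r ?addr0 //.
  by rewrite eq_sym (negPf jM).
have [b [b' [f [bU bU' H]]]] := elim_cols n (leqnn n).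
have f_inj : injective f.
  move=> j j' e; have [Hc _] := H j' (ltn_ord j'); have [_ Hr] := H j (ltn_ord j).
  have := Hr j'; rewrite Hc e eqxx; case: eqP => [->//|_ /eqP].
  by rewrite oner_eq0.
exists (perm f_inj), (invmx b), (invmx b'); split; [exact: upperV|exact: upperV|].
have -> : perm_matrix F (perm f_inj) = b *m g *m b'.
  by apply/matrixP => i j; have [-> _] := H j (ltn_ord j); rewrite mxE permE eq_sym.
by rewrite !mulmxA mulVmx ?upper_unitmx // mul1mx mulmxK // upper_unitmx.
Qed.

Definition in_slice v h := (forall j, h (v j) j = 1) /\
  (forall i j, h i j != 0 -> i = v j \/ (i, j) \in opp_rothe v).

(** Column operations from left to right make each pivot [1] and clear its row beyond it. The zeros
    above the pivots survive: if [v M < v j], the entry to clear in column [j] is already zero, so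
    column [M] is not added there. *)
Lemma slice_reduction v b : b \in unitmx -> is_trig_mx b ->
  exists2 b', upper b' & in_slice v (b *m perm_matrix F v *m b').
Proof.
move=> bU /is_trig_mxP bT.
have b0 i : b i i != 0.
  move: bU; rewrite unitmxE det_trig; last exact/is_trig_mxP.
  by rewrite unitfE => /prodf_neq0/(_ i isT).
have bv i j : (b *m perm_matrix F v) i j = b i (v j).
  rewrite mxE (bigD1 (v j)) //= mxE eqxx mulr1 big1 ?addr0 // => k.
  by rewrite mxE eq_sym => /negPf->; rewrite mulr0.
have elim_cols m : (m <= n)%N -> exists b', [/\ upper b',
    forall i j : 'I_n, (i < v j)%N -> (b *m perm_matrix F v *m b') i j = 0,
    forall j, (b *m perm_matrix F v *m b') (v j) j != 0 &
    forall j k : 'I_n, (j < m)%N -> (j <= k)%N ->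
      (b *m perm_matrix F v *m b') (v j) k = (k == j)%:R].
  elim: m => [|m IH] mn.
    exists 1%:M; rewrite upper1 mulmx1; split=> // [i j ij|j]; first by rewrite bv bT.
    by rewrite bv.
  have [b' [bU' hT h0 H]] := IH (ltnW mn); set h := _ *m b' in hT h0 H.
  pose M := Ordinal mn; pose a := h (v M) M.
  have a0 : a != 0 by exact: h0.
  pose c (j : 'I_n) := if (j < m)%N then 0 else ((j == M)%:R - h (v M) j) / a.
  have cM : c M = a^-1 - 1 by rewrite /c /= ltnn eqxx mulrBl -/a divff // mul1r.
  have cU : upper (col_step M c).
    apply: upper_col_step => [j jM|]; first by rewrite /c ifT.
    by rewrite cM addrC subrK invr_eq0.
  exists (b' *m col_step M c); rewrite mulmxA -/h; split; first exact: upperM.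
  - move=> i j ij; rewrite mul_col_step hT // add0r.
    have [e|jM] := eqVneq j M; first by rewrite hT ?mul0r // -e.
    have [le_vv|lt_vv] := leqP (v j) (v M); first by rewrite (hT i M) ?mul0r //; lia.
    by rewrite /c hT // (negPf jM) subrr mul0r if_same mulr0.
  - move=> j; rewrite mul_col_step; have [->|jM] := eqVneq j M.
      by rewrite cM -/a mulrBr mulr1 divff // addrC subrK oner_eq0.
    have [lt_vv|le_vv] := ltnP (v j) (v M); first by rewrite (hT (v j) M) // mul0r addr0.
    rewrite /c hT ?(negPf jM) ?subrr ?mul0r ?if_same ?mulr0 ?addr0 //.
    by rewrite ltn_neqAle le_vv andbT; apply: contra jM => /eqP/ord_inj/perm_inj ->.
  - move=> j k jm jk; rewrite mul_col_step; have [e|jM] := eqVneq j M.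
      have km : (k < m)%N = false by move: jk; rewrite e /=; lia.
      by rewrite e -/a /c km mulrC divfK // addrC subrK.
    have {}jm : (j < m)%N.
      by rewrite ltn_neqAle -ltnS jm andbT; apply: contra jM => /eqP jm'; apply/eqP/ord_inj.
    rewrite H // (H j M) //; last exact: ltnW.
    by rewrite (_ : (M == j) = false) ?mul0r ?addr0 // eq_sym (negPf jM).
have [b' [bU' hT h0 H]] := elim_cols n (leqnn n); exists b' => //.
split=> [j|i j hij]; first by rewrite H // eqxx.
have [->|ne] := eqVneq i (v j); [by left|right].
rewrite inE /=; apply/andP; split.
  rewrite ltn_neqAle; apply/andP; split; first by apply: contra ne => /eqP/ord_inj->.
  by rewrite leqNgt; apply: contra hij => /hT->.
rewrite ltnNge; apply: contra hij => pij; have := H ((v^-1)%g i) j (ltn_ord _) pij.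
rewrite permKV => ->; have [e|//] := eqVneq j ((v^-1)%g i).
by case/eqP: ne; rewrite e permKV.
Qed.

Lemma in_slice_lower v h : in_slice v h ->
  exists b, [/\ b \in unitmx, is_trig_mx b & h = b *m perm_matrix F v].
Proof.
move=> [h1 h0]; pose b := \matrix_(i, k) h i ((v^-1)%g k).
have bT : is_trig_mx b.
  apply/is_trig_mxP => i k ik; rewrite mxE; apply/eqP/negPn/negP => /h0.
  by rewrite permKV inE /= permKV => -[e|/andP[ki _]]; move: ik; rewrite ?e; lia.
exists b; split=> //.
  rewrite unitmxE det_trig // unitfE; apply/prodf_neq0 => i _.
  by rewrite mxE -{1}[i](permKV v) h1 oner_eq0.
apply/matrixP => i j; rewrite mxE (bigD1 (v j)) //= !mxE permK eqxx mulr1.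
rewrite big1 ?addr0 // => k; rewrite !mxE eq_sym => /negPf->.
by rewrite mulr0.
Qed.

(** A line through [u] whose other points lie in [B u' B]; it puts [u] in the closure of the larger
    cell. *)
Lemma bruhat_step_curve u u' : bruhat_step u u' -> exists p q : 'I_n,
  forall c : F, c != 0 -> exists b b', [/\ upper b, upper b' &
    perm_matrix F u + c *: delta_mx p q = b *m perm_matrix F u' *m b'].
Proof.
move=> /bruhat_stepP[x [y [xy uxy ->]]]; exists (u y), x => c c0.
have xy' : (x == y) = false by rewrite ord_lt_eqF.
have uxy' : (u x == u y) = false by rewrite ord_lt_eqF.
(* The computation is that of the 2 by 2 matrix with rows [(1, 0)] and [(c, 1)], placed at rows
   [u x < u y] and columns [x < y]. *)
pose R := row_step (u y) (fun i => - c^-1 * (i == u x)%:R).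
pose S := col_step x (fun j => - c^-1 * (j == y)%:R).
pose d : 'rV[F]_n := \row_j (if j == x then c else if j == y then - c^-1 else 1).
have RU : upper R.
  apply: upper_row_step => [i yi|]; last by rewrite [u y == _]eq_sym uxy' mulr0 addr0 oner_eq0.
  by rewrite ord_gt_eqF ?mulr0 //; lia.
have SU : upper S.
  apply: upper_col_step => [j jx|]; last by rewrite xy' mulr0 addr0 oner_eq0.
  by rewrite ord_lt_eqF ?mulr0 //; lia.
have dU : upper (diag_mx d).
  apply/upperP; split=> [i j ji|i]; rewrite !mxE; first by rewrite (ord_gt_eqF ji).
  rewrite eqxx mulr1n; have [_|_] := eqVneq i x; first by [].
  by have [_|_] := eqVneq i y; rewrite ?oppr_eq0 ?invr_eq0 ?oner_eq0.
set G := perm_matrix F u + _.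
have GE i j : G i j = (u j == i)%:R + c * ((i == u y) && (j == x))%:R by rewrite !mxE.
have RGE i j : (R *m G) i j = G i j - c^-1 * (i == u x)%:R * G (u y) j.
  by rewrite mul_row_step !mulNr.
have RGx i : (R *m G) i x = c * (i == u y)%:R.
  rewrite RGE !GE !eqxx uxy' /= add0r mulr1 andbT mulrAC mulVf // mul1r.
  by rewrite addrAC [u x == i]eq_sym subrr add0r.
have key : R *m G *m S = perm_matrix F (perm_comp u (tperm x y)) *m diag_mx d.
  apply/matrixP => i j; rewrite mul_mx_diag mul_col_step RGx [RHS]mxE.
  rewrite [perm_matrix F _ i j]mxE [d 0 j]mxE perm_comp_tpermE.
  have [->|jx] := eqVneq j x.
    by rewrite RGx xy' !mulr0 addr0 tpermL [u y == i]eq_sym mulrC.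
  have [->|jy] := eqVneq j y.
    rewrite RGE !GE ![y == x]eq_sym xy' !andbF !mulr0 !addr0 eqxx tpermR !mulr1.
    rewrite mulrN mulrAC divff // mul1r [u y == i]eq_sym addrAC subrr add0r.
    by rewrite mulrC mulrN [u x == i]eq_sym mulrC.
  rewrite RGE !GE (negPf jx) !andbF !mulr0 !addr0 tpermD 1?eq_sym //.
  by rewrite (inj_eq perm_inj) (negPf jy) mulr0 subr0 mulr1.
exists (invmx R), (diag_mx d *m invmx S).
split; [exact: upperV|by apply: upperM; last exact: upperV|].
rewrite mulmxA -[_ *m _ *m diag_mx d]mulmxA -key !mulmxA mulVmx ?upper_unitmx // mul1mx.
by rewrite mulmxK ?upper_unitmx.
Qed.
End TriangularMatrices.

(** * Closed subsets of the flag variety *)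

From mathcomp Require Import complex mpoly.

Section FlagVariety.
Variables (R : realType) (n : nat).
Local Notation C := (R[i]).
Local Notation point := ('I_n * 'I_n -> C).
Implicit Types (g b M : 'M[C]_n) (u v w : 'S_n) (f p h : point -> C).

Definition entries g : point := fun ij => g ij.1 ij.2.

Lemma borelE b : borel b <-> upper b.
Proof. by split => [[? ?]|/andP//]; apply/andP. Qed.

Lemma coset_borelM g b : upper b -> coset_borel (g *m b) = coset_borel g.
Proof.
move=> bU; apply/seteqP; split=> _ [c /borelE cU <-].
  by exists (b *m c); rewrite ?mulmxA //; apply/borelE/upperM.
exists (invmx b *m c); first by apply/borelE/upperM => //; apply: upperV.
by rewrite mulmxA mulmxK // upper_unitmx.
Qed.

Lemma coset_borel_refl g : coset_borel g g.
Proof. by exists 1%:M; [apply/borelE/upper1|rewrite mulmx1]. Qed.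

Lemma coset_borel_eq g g' : coset_borel g = coset_borel g' ->
  exists2 b, upper b & g = g' *m b.
Proof.
by move=> e; have := coset_borel_refl g; rewrite e => -[b /borelE bU <-]; exists b.
Qed.

Lemma polyfun_meval (p : {mpoly C[n * n]}) :
  exists2 f, polyfun f & forall g, p.@[fun k => mxvec g 0 k] = f (entries g).
Proof.
have ij (k : 'I_(n * n)) : exists ij : 'I_n * 'I_n, forall g, mxvec g 0 k = entries g ij.
  by case/mxvec_indexP: k => i j; exists (i, j) => g; rewrite mxvecE.
have [s sE] := fin_all_exists ij.
exists (fun t => \sum_(m <- msupp p) p@_m * \prod_k t (s k) ^+ m k).
  apply: polyfun_sum => m _; apply: polyfun_mul; first exact: polyfun_cst.
  by apply: polyfun_prod => k _; apply/polyfun_exp/polyfun_var.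
move=> g; rewrite mevalE; apply: eq_bigr => m _; congr (_ * _).
by apply: eq_bigr => k _; rewrite sE.
Qed.

Lemma meval_polyfun f : polyfun f ->
  exists p : {mpoly C[n * n]}, forall g, p.@[fun k => mxvec g 0 k] = f (entries g).
Proof.
elim=> [c|[i j]|{}f h _ [p pE] _ [q qE]|{}f h _ [p pE] _ [q qE]].
- by exists c%:MP => g; rewrite mevalC.
- by exists 'X_(mxvec_index i j) => g; rewrite mevalXU mxvecE.
- by exists (p + q) => g; rewrite mevalD pE qE.
- by exists (p * q) => g; rewrite mevalM pE qE.
Qed.

Definition flag_zeros (P : set (point -> C)) : set (set 'M[C]_n) :=
  [set coset_borel g | g in [set g | GL g /\ forall p, P p -> p (entries g) = 0]].

(** Families of polynomials whose common zero set in [GL] is a union of cosets, so that it descends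
    to a closed set of the quotient. *)
Definition invariant_family (P : set (point -> C)) :=
  (forall p, P p -> polyfun p) /\
  forall g b, GL g -> upper b -> (forall p, P p -> p (entries g) = 0) ->
    forall p, P p -> p (entries (g *m b)) = 0.

Lemma mem_flag_zeros P g : invariant_family P -> GL g ->
  flag_zeros P (coset_borel g) <-> forall p, P p -> p (entries g) = 0.
Proof.
move=> [_ Pinv] gU; split=> [[g' [g'U Pg'] /esym/coset_borel_eq[b bU ->]]|Pg]; first exact:
  Pinv.
by exists g.
Qed.

Lemma flag_zeros_closed P : invariant_family P -> zariski_closed_flag (flag_zeros P).
Proof.
move=> Pinv; split=> [_ [g [gU _] <-]|]; first by exists g.
exists [set q | exists2 p, P p & forall g, q.@[fun k => mxvec g 0 k] = p (entries g)].
apply/seteqP; split=> g [gU].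
  move=> /(mem_flag_zeros Pinv gU) Pg; split=> // q [p Pp qE].
  by rewrite qE Pg.
move=> Pg; split=> //; apply/(mem_flag_zeros Pinv gU) => p Pp.
have [q qE] := meval_polyfun (Pinv.1 p Pp).
by rewrite -qE; apply: Pg; exists p.
Qed.

Lemma closed_flag_zeros Y : zariski_closed_flag Y -> exists2 P : set (point -> C),
  (forall p, P p -> polyfun p) &
  forall g, GL g -> Y (coset_borel g) <-> forall p, P p -> p (entries g) = 0.
Proof.
move=> [_ [I YI]].
exists [set p | polyfun p /\ exists2 q, I q & forall g, q.@[fun k => mxvec g 0 k] = p (entries g)].
  by move=> p [].
move=> g gU; split=> [Yg p [_ [q Iq qE]]|H].
  have : [set g | GL g /\ Y (coset_borel g)] g by [].
  by rewrite YI => -[_ /(_ q Iq)]; rewrite qE.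
suff : [set g | GL g /\ Y (coset_borel g)] g by case.
rewrite YI; split=> // q Iq; have [p pp pE] := polyfun_meval q.
by rewrite pE; apply: H; split=> //; exists q.
Qed.

Section Slice.
Variable v : 'S_n.

(** Columns up to [j] and rows [v 0, ..., v (j - 1), i]. Right multiplication by an upper triangular
    matrix mixes these columns only among themselves, so it scales the determinant. *)
Definition minor_mx (i j : 'I_n) g : 'M[C]_j.+1 :=
  \matrix_(r, c) g (if r == ord_max then i else v (widen_ord (ltn_ord j) r))
                   (widen_ord (ltn_ord j) c).

Definition minor i j (t : point) := \det (minor_mx i j (\matrix_(a, b) t (a, b))).

Definition leading (j : 'I_n) b : 'M[C]_j.+1 :=
  \matrix_(r, c) b (widen_ord (ltn_ord j) r) (widen_ord (ltn_ord j) c).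

Lemma entriesK g : \matrix_(a, b) entries g (a, b) = g.
Proof. by apply/matrixP => a b; rewrite mxE. Qed.

Lemma polyfun_minor i j : polyfun (minor i j).
Proof.
apply: polyfun_det => r c.
apply: (polyfun_ext (@polyfun_var _ _ (if r == ord_max then i else v (widen_ord (ltn_ord j) r),
  widen_ord (ltn_ord j) c))) => t.
by rewrite !mxE.
Qed.

Lemma minorM i j g b : upper b ->
  minor i j (entries (g *m b)) = minor i j (entries g) * \det (leading j b).
Proof.
move=> /upperP[bT _]; rewrite /minor !entriesK -det_mulmx; congr (\det _).
apply/matrixP => r c; rewrite !mxE.
rewrite (bigID (fun k : 'I_n => (k < j.+1)%N)) /= [X in _ + X]big1 ?addr0; last first.
  by move=> k kj; rewrite bT ?mulr0 //=; have := ltn_ord c; lia.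
rewrite (big_ord_narrow (ltn_ord j)); apply: eq_bigr => k _; by rewrite !mxE.
Qed.

(** On the slice, row [v r] vanishes beyond column [r], so the matrix of the minor is triangular,
    with pivots [1] and last diagonal entry [M i j]. *)
Lemma minor_slice i j M : in_slice v M -> minor i j (entries M) = M i j.
Proof.
move=> [M1 M0]; rewrite /minor entriesK det_trig.
  rewrite (bigD1 ord_max) //= big1 ?mulr1 => [|r rm].
    by rewrite mxE eqxx; congr (M _ _); apply: ord_inj.
  by rewrite mxE (negPf rm) M1.
apply/is_trig_mxP => r c rc; rewrite mxE.
have rm : (r == ord_max) = false by apply/eqP => e; move: rc (ltn_ord c); rewrite e /=; lia.
rewrite rm; apply/eqP/negPn/negP => /M0[/perm_inj/(congr1 (@nat_of_ord n)) /= e|].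
  by move: rc; rewrite e ltnn.
by rewrite inE /= permK /=; lia.
Qed.

Definition weight b := \prod_j \det (leading j b).

Definition pivots (t : point) := \prod_j minor (v j) j t.

(* [minor i j] is a relative invariant of the Borel subgroup restricting to the
   coordinate [(i, j)] of the slice, and [pivots] restricts to [1]. *)
Lemma homogenize f : polyfun f -> exists N h, [/\ polyfun h,
  forall g b, upper b -> h (entries (g *m b)) = weight b ^+ N * h (entries g) &
  forall M, in_slice v M -> h (entries M) = f (entries M)].
Proof.
have ppiv : polyfun pivots by apply: polyfun_prod => j _; apply: polyfun_minor.
have pivM g b : upper b -> pivots (entries (g *m b)) = weight b * pivots (entries g).
  move=> bU; rewrite /pivots /weight -big_split /=; apply: eq_bigr => j _.
  by rewrite minorM // mulrC.
have piv1 M : in_slice v M -> pivots (entries M) = 1.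
  by move=> MS; apply: big1 => j _; rewrite minor_slice //; case: MS.
elim=> [c|[i j]|{}f f' _ [N [h [ph hM hS]]] _ [N' [h' [ph' hM' hS']]]|
                {}f f' _ [N [h [ph hM hS]]] _ [N' [h' [ph' hM' hS']]]].
- exists 0%N, (fun=> c); split=> // [|g b _]; first exact: polyfun_cst.
  by rewrite expr0 mul1r.
- exists 1%N, (fun t => minor i j t * \prod_(k | k != j) minor (v k) k t); split.
  + by apply: polyfun_mul; [|apply: polyfun_prod => k _]; apply: polyfun_minor.
  + move=> g b bU; rewrite minorM // /weight expr1 [X in _ = X * _](bigD1 j) //=.
    under eq_bigr => k _ do rewrite minorM //.
    by rewrite big_split /= mulrACA mulrC.
  + move=> M MS; rewrite minor_slice // big1 ?mulr1 // => k _.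
    by rewrite minor_slice //; case: MS.
(* Powers of [pivots], equal to [1] on the slice, bring the two summands to a common weight. *)
- exists (N + N')%N, (fun t => h t * pivots t ^+ N' + h' t * pivots t ^+ N); split.
  + by apply: polyfun_add; apply: polyfun_mul => //; apply: polyfun_exp.
  + move=> g b bU; rewrite hM // hM' // pivM // !exprMn exprD; ring.
  + by move=> M MS; rewrite hS // hS' // piv1 // !expr1n !mulr1.
- exists (N + N')%N, (fun t => h t * h' t); split.
  + exact: polyfun_mul.
  + by move=> g b bU; rewrite hM // hM' // exprD mulrACA.
  + by move=> M MS; rewrite hS // hS'.
Qed.
End Slice.
End FlagVariety.

(** * Irreducible chains in the opposite cell, studied on the slice *)

Section KrullDimensionOfSlice.
Variables (R : realType) (n : nat) (v : 'S_n).
Local Notation C := (R[i]).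
Local Notation point := ('I_n * 'I_n -> C).
Implicit Types (g b M : 'M[C]_n) (f p h : point -> C) (S Z F : set (set 'M[C]_n)).

Lemma in_slice_GL M : in_slice v M -> GL M.
Proof.
move=> /in_slice_lower[b [bU _ ->]].
by rewrite /GL /= unitmx_mul bU perm_matrix_unit.
Qed.

Lemma in_slice_opp_cell M : in_slice v M -> opp_schubert_cell v (coset_borel M).
Proof. by move=> /in_slice_lower[b [bU bT ->]]; exists b. Qed.

Lemma opp_cell_slice (x : set 'M[C]_n) : opp_schubert_cell v x ->
  exists2 M, in_slice v M & x = coset_borel M.
Proof.
move=> [b [bU bT] <-]; have [b' bU' MS] := slice_reduction v bU bT.
by exists (b *m perm_matrix C v *m b') => //; rewrite (coset_borelM _ bU').
Qed.

Definition slice_points Z : set point :=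
  [set t | exists M, [/\ in_slice v M, Z (coset_borel M) & t = entries M]].

(** Homogenizing [f] spreads its zero set from the slice to a closed union of cosets; polynomials on
    the slice thereby test irreducibility in the flag variety. *)
Lemma slice_zeros_closed f : polyfun f -> exists2 F, zariski_closed_flag F &
  forall M, in_slice v M -> F (coset_borel M) <-> f (entries M) = 0.
Proof.
move=> /(homogenize v)[N [h [ph hM hS]]].
have inv : invariant_family [set h].
  split=> [_ ->//|g b gU bU h0 _ ->]; by rewrite hM // h0 // mulr0.
exists (flag_zeros [set h]); first exact: flag_zeros_closed.
move=> M MS; rewrite mem_flag_zeros //; last exact: in_slice_GL.
by split=> [H|f0 _ ->]; rewrite -?hS ?H // hS.
Qed.

Lemma function_irreducible_slice Z : Z `<=` opp_schubert_cell v ->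
  irreducible_set (@zariski_closed_flag R n) Z -> function_irreducible (slice_points Z).
Proof.
move=> Zv [[x Zx] Zirr]; split.
  by have [M MS xM] := opp_cell_slice (Zv x Zx); exists (entries M), M; split; rewrite -?xM.
move=> f h pf ph fh.
have [F1 F1cl F1E] := slice_zeros_closed pf; have [F2 F2cl F2E] := slice_zeros_closed ph.
have ZF : Z `<=` F1 `|` F2.
  move=> y Zy; have [M MS yM] := opp_cell_slice (Zv y Zy); rewrite yM in Zy *.
  have /eqP := fh (entries M) (ex_intro _ M (And3 MS Zy (erefl _))).
  by rewrite mulf_eq0 => /orP[/eqP f0|/eqP h0]; [left; apply/F1E|right; apply/F2E].
have [ZF1|ZF2] := Zirr _ _ F1cl F2cl ZF; [left|right] => _ [M [MS ZM ->]].
  by apply/F1E => //; apply: ZF1.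
by apply/F2E => //; apply: ZF2.
Qed.

(** The chain yields [m] independent functions on its top set. That set is irreducible, so it lies
    in the closure of the image of a single chart, where [independent_bound] applies. *)
Lemma irreducible_chain_bound S (J : finType) (K : Type) (s : seq K) (T : K -> {set J})
    (phi : K -> (J -> C) -> point) d m :
    S `<=` opp_schubert_cell v ->
    (forall c x, polyfun (fun t => phi c t x)) ->
    (forall c t t', (forall i, i \in T c -> t i = t' i) -> phi c t = phi c t') ->
    (forall c, List.In c s -> (#|T c| <= d)%N) ->
    (forall M, in_slice v M -> S (coset_borel M) ->
       exists2 c, List.In c s & exists t, entries M = phi c t) ->
  irreducible_chain (@zariski_closed_flag R n) S m -> (m <= d)%N.
Proof.
move=> Sv pphi phiT Td Scov [Z [Zirr Zstep]].
have ZS i : (i <= m)%N -> Z i `<=` S.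
  by move=> im x; have [[F _ ->] _] := Zirr i im; case.
have Zv i : (i <= m)%N -> Z i `<=` opp_schubert_cell v.
  by move=> im x Zx; apply: Sv; apply: ZS Zx.
have [||fs [sfs pfs indep]] := @independent_chain _ _ (fun i => slice_points (Z i)) m.
- by move=> i im; apply: function_irreducible_slice; [apply: Zv|case: (Zirr i im)].
- move=> i im; have [Zsub ZNsub] := Zstep i im; split=> [_ [M [MS ZM ->]]|].
    by exists M; split=> //; apply: Zsub.
  have [x Zx nZx] : exists2 x, Z i.+1 x & ~ Z i x.
    by apply: contrapT => H; apply: ZNsub => x Zx; apply: contrapT => nZx; apply: H; exists x.
  have [[F Fcl ZF] _] := Zirr i (ltnW im).
  have [P Ppol PF] := closed_flag_zeros Fcl.
  have [M MS xM] := opp_cell_slice (Zv _ im x Zx); rewrite xM in Zx nZx.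
  have [p Pp pM] : exists2 p, P p & p (entries M) != 0.
    apply: contrapT => H; apply: nZx; rewrite ZF; split; first exact: ZS Zx.
    apply/PF => [|p Pp]; first exact: in_slice_GL.
    by apply: contrapT => /eqP pM; apply: H; exists p.
  exists p; [exact: Ppol|split; last by exists (entries M) => //; exists M].
  move=> _ [M' [MS' ZM' ->]]; move: ZM'; rewrite ZF => -[_ /PF]; apply=> //.
  exact: in_slice_GL.
have Zirr' : function_irreducible (slice_points (Z m)).
  by apply: function_irreducible_slice; [apply: Zv|case: (Zirr m (leqnn m))].
pose Im c : set point := [set t | exists u, t = phi c u].
have Zcov t : slice_points (Z m) t -> exists2 c, List.In c s & Im c t.
  by move=> [M [MS ZM ->]]; apply: Scov => //; apply: ZS ZM.
have [c cs Hc] := function_irreducible_cover Zirr' Zcov.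
rewrite -sfs; apply: leq_trans (Td c cs); apply:
  independent_bound (pphi c) (phiT c) _ pfs indep => h ph hphi.
by apply: Hc => // _ [t ->].
Qed.

(* The closures of the images of a flag of coordinate subspaces through [t0] form
   a chain, each step of which is witnessed by an entry of the matrix. *)
Lemma irreducible_chain_exists S (J : eqType) (ts : seq J) (phi : (J -> C) -> point) t0 :
    S `<=` opp_schubert_cell v ->
    (forall x, polyfun (fun t => phi t x)) ->
    (forall t, exists2 M, in_slice v M & S (coset_borel M) /\ phi t = entries M) ->
    (forall i, (i < size ts)%N -> exists x a,
       (forall t, (forall j, j \notin take i ts -> t j = t0 j) -> phi t x = a) /\
       exists2 t, (forall j, j \notin take i.+1 ts -> t j = t0 j) & phi t x != a) ->
  irreducible_chain (@zariski_closed_flag R n) S (size ts).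
Proof.
move=> Sv pphi phiS step.
pose A i : set (J -> C) := [set t | forall j, j \notin take i ts -> t j = t0 j].
pose P i : set (point -> C) := [set h | [/\ polyfun h,
  exists N, forall g b, upper b -> h (entries (g *m b)) = weight b ^+ N * h (entries g) &
  forall t, A i t -> h (phi t) = 0]].
have Pinv i : invariant_family (P i).
  split=> [h []//|g b gU bU Pg h Ph]; have [_ [N hN] _] := Ph.
  by rewrite hN // Pg // mulr0.
have At0 i : A i t0 by [].
have PE i M : in_slice v M -> flag_zeros (P i) (coset_borel M) <->
    forall f, polyfun f -> (forall t, A i t -> f (phi t) = 0) -> f (entries M) = 0.
  move=> MS; rewrite mem_flag_zeros //; last exact: in_slice_GL.
  split=> [H f pf fA|H h [ph _ hA]]; last exact: H.
  have [N [h [ph hM hS]]] := homogenize v pf; rewrite -hS //; apply: H; split=> //;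
    first by exists N.
  by move=> t At; have [M' MS' [_ e]] := phiS t; rewrite e hS // -e fA.
pose Z i := S `&` flag_zeros (P i).
have ZA i t M : A i t -> in_slice v M -> S (coset_borel M) -> phi t = entries M ->
    Z i (coset_borel M).
  by move=> At MS SM e; split=> //; apply/PE => // f _ fA; rewrite -e fA.
have Acomb i t1 t2 s : A i t1 -> A i t2 -> A i (fun j => t1 j + s * (t2 j - t1 j)).
  by move=> A1 A2 j /[dup] /A1 e1 /A2 e2; rewrite e1 e2 subrr mulr0 addr0.
have ZF i F : zariski_closed_flag F -> (forall t, A i t -> forall M, phi t = entries M ->
    in_slice v M -> F (coset_borel M)) -> Z i `<=` F.
  move=> Fcl FA x [Sx Zx]; have [M MS xM] := opp_cell_slice (Sv x Sx); rewrite xM in Zx *.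
  have [Q Qpol QF] := closed_flag_zeros Fcl.
  apply/QF => [|q Qq]; first exact: in_slice_GL.
  have /PE := Zx; apply=> //; first exact: Qpol.
  move=> t At; have [M' MS' [SM' e]] := phiS t; rewrite e.
  by have /QF := FA t At M' e MS'; apply=> //; exact: in_slice_GL.
exists Z; split=> [i _|i im].
  split; first by exists (flag_zeros (P i)) => //; apply: flag_zeros_closed.
  split.
    by have [M MS [SM e]] := phiS t0; exists (coset_borel M); apply: ZA e.
  move=> F1 F2 F1cl F2cl ZF12; apply: contrapT => /not_orP[nF1 nF2].
  have witness F : zariski_closed_flag F -> ~ Z i `<=` F ->
      exists2 q, polyfun q & (exists2 t, A i t & q (phi t) != 0) /\
        forall M, in_slice v M -> F (coset_borel M) -> q (entries M) = 0.
    move=> Fcl nF; have [Q Qpol QF] := closed_flag_zeros Fcl.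
    apply: contrapT => H; apply: nF; apply: ZF => // t At M e MS.
    apply/QF => [|q Qq]; first exact: in_slice_GL.
    apply: contrapT => /eqP qM; apply: H; exists q; first exact: Qpol.
    split; first by exists t; rewrite // e.
    by move=> M' MS' /QF H; apply: H => //; apply: in_slice_GL.
  have [q1 pq1 [[t1 At1 qt1] q1F]] := witness F1 F1cl nF1.
  have [q2 pq2 [[t2 At2 qt2] q2F]] := witness F2 F2cl nF2.
  (* [A i] is an affine subspace, so it contains the line through [t1] and [t2]; a point of this
     line where neither [q1] nor [q2] vanishes escapes both [F1] and [F2]. *)
  have [s] := polyfun_line_neq0 (polyfun_comp pq1 pphi) (polyfun_comp pq2 pphi) qt1 qt2.
  set t := fun j => _; have At : A i t by apply: Acomb.
  have [M MS [SM e]] := phiS t; rewrite e.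
  have [F1M|F2M] := ZF12 _ (ZA i t M At MS SM e).
    by rewrite q1F // mul0r eqxx.
  by rewrite q2F // mulr0 eqxx.
have AS t : A i t -> A i.+1 t.
  move=> At j jN; apply: At; apply: contra jN.
  by rewrite -(take_takel ts (leqnSn i)); apply: mem_take.
split=> [x [Sx Zx]|].
  have [M MS xM] := opp_cell_slice (Sv x Sx); rewrite xM in Sx Zx *; split=> //.
  apply/PE => // f pf fA; have /PE := Zx; apply=> // t At.
  by apply: fA; apply: AS.
move=> ZZ; have [x [a [xa [t At txa]]]] := step i im.
have [M MS [SM e]] := phiS t.
have [_ /PE] := ZZ _ (ZA i.+1 t M At MS SM e).
move=> /(_ MS (fun s => s x - a)) H; move: txa; rewrite e -subr_eq0 H ?eqxx //.
  by apply: polyfun_sub; [apply: polyfun_var|apply: polyfun_cst].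
by move=> s As; rewrite xa // subrr.
Qed.
End KrullDimensionOfSlice.

(** * Charts of the Kazhdan-Lusztig variety *)

(** Turns the existence of a relation into polynomial equations. Repeated rows in [f] are harmless,
    as they give zero determinants. *)
Lemma kernel_rowsub_det (F : fieldType) p q (B : 'M[F]_(p, q)) :
  (exists2 x : 'cV_q, x != 0 & B *m x = 0) <->
  (forall f : {ffun 'I_q -> 'I_p}, \det (rowsub f B) = 0).
Proof.
split=> [[x x0 Bx] f|H].
  apply/eqP/negPn/negP => fB; case/eqP: x0.
  have fU : rowsub f B \in unitmx by rewrite unitmxE unitfE.
  rewrite -[x](mulKmx fU) (_ : rowsub f B *m x = 0) ?mulmx0 //.
  apply/matrixP => i j; rewrite [RHS]mxE -[RHS](_ : (B *m x) (f i) j = 0);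
    last by rewrite Bx mxE.
  by rewrite !mxE; apply: eq_bigr => k _; rewrite mxE.
have [Bfull|Bnfull] := boolP (row_full B).
  have := H (finfun (fullrankfun Bfull)).
  have -> : rowsub (finfun (fullrankfun Bfull)) B = rowsub (fullrankfun Bfull) B.
    by apply/matrixP => i j; rewrite !mxE ffunE.
  by have := fullrowsub_unit Bfull; rewrite unitmxE unitfE => /negPf; move=> + e;
    rewrite e eqxx.
have : kermx B^T != 0.
  rewrite -mxrank_eq0 mxrank_ker mxrank_tr subn_eq0 -ltnNge.
  by rewrite ltn_neqAle rank_leq_col andbT.
move=> /rowV0Pn[y /sub_kermxP yB y0]; exists y^T.
  by apply: contra_neq y0 => e; rewrite -[y]trmxK e trmx0.
by apply: trmx_inj; rewrite trmx_mul trmxK yB trmx0.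
Qed.

Section KazhdanLusztigVariety.
Variables (R : realType) (n : nat).
Local Notation C := (R[i]).
Local Notation point := ('I_n * 'I_n -> C).
Implicit Types (g b M : 'M[C]_n) (u v w : 'S_n) (F : set (set 'M[C]_n)).

(** An equation of [F] restricted to the curve is a polynomial in one variable vanishing at every
    [s != 0], hence also at [0]. *)
Lemma closed_flag_step F u u' : zariski_closed_flag F -> bruhat_step u u' ->
    (forall b, upper b -> F (coset_borel (b *m perm_matrix C u'))) ->
  forall b, upper b -> F (coset_borel (b *m perm_matrix C u)).
Proof.
move=> Fcl uu' Fu' b bU; have [P Ppol PF] := closed_flag_zeros Fcl.
have [p [q curve]] := bruhat_step_curve C uu'.
have GLP c : upper c -> forall s, GL (c *m perm_matrix C s).
  by move=> cU s; rewrite /GL /= unitmx_mul perm_matrix_unit upper_unitmx.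
apply/PF => [|f Pf]; first exact: GLP.
have [r rE] := polyfun_line (entries (b *m perm_matrix C u)) (entries (b *m delta_mx p q)) (Ppol f Pf).
have rs s : s != 0 -> r.[s] = 0.
  move=> s0; rewrite -rE; have [b1 [b2 [b1U b2U e]]] := curve s s0.
  have := Fu' (b *m b1) (upperM bU b1U); rewrite -(coset_borelM _ b2U) -mulmxA -mulmxA.
  rewrite [b1 *m _]mulmxA -e => FM.
  have -> : (fun ij => entries (b *m perm_matrix C u) ij + s * entries (b *m delta_mx p q) ij) =
      entries (b *m (perm_matrix C u + s *: delta_mx p q)).
    by apply/funext => -[i j]; rewrite /entries mulmxDr -scalemxAr !mxE.
  have /PF := FM; apply=> //.
  by rewrite /GL /= unitmx_mul e !unitmx_mul perm_matrix_unit !upper_unitmx.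
have r0 : r = 0.
  (* The factor ['X] forces the nonroot to be nonzero. *)
  apply/eqP/negPn/negP => r0; have rX0 : r * 'X != 0 by rewrite mulf_neq0 ?polyX_eq0.
  have [s] := poly_nonroot rX0; rewrite hornerMX mulf_eq0 negb_or => /andP[rs0 s0].
  by rewrite rs ?eqxx in rs0.
have := rE 0; rewrite r0 horner0 => <-; congr f.
by apply/funext => ij; rewrite mul0r addr0.
Qed.

Lemma closed_flag_bruhat F u w : zariski_closed_flag F -> schubert_cell w `<=` F ->
  bruhat_le u w -> forall b, upper b -> F (coset_borel (b *m perm_matrix C u)).
Proof.
move=> Fcl wF /connectP[s]; elim: s u => [|u' s IH] u /=.
  by move=> _ <- b bU; apply: wF; exists b => //; apply/borelE.
by move=> /andP[uu' s_path] ws; apply: closed_flag_step uu' (IH u' s_path ws).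
Qed.

Section Dependence.
Variables l k : 'I_n.

(** The kernel consists of the relations used in [col_dependent]: the lower block kills the
    coordinates beyond [l]. Zero rows keep the size independent of [l] and [k]. *)
Definition col_system g : 'M[C]_(n + n, n) :=
  col_mx (\matrix_(i, j) if (n - k <= i)%N then g i j else 0)
         (\matrix_(i, j) ((i == j) && (l < j)%N)%:R).

Definition row_system g : 'M[C]_(n + n, n) :=
  col_mx (\matrix_(j, i) if (j < k)%N then g i j else 0)
         (\matrix_(j, i) ((j == i) && (i < n - l.+1)%N)%:R).

(* The rank conditions defining the Schubert variety of [w], stated as the
   existence of a relation among the columns (resp. rows) of each block. *)
Definition col_dependent g := exists2 x : 'cV[C]_n, x != 0 &
  (forall j : 'I_n, (l < j)%N -> x j 0 = 0) /\
  (forall i : 'I_n, (n - k <= i)%N -> (g *m x) i 0 = 0).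

Definition row_dependent g := exists2 y : 'rV[C]_n, y != 0 &
  (forall i : 'I_n, (i < n - l.+1)%N -> y 0 i = 0) /\
  (forall j : 'I_n, (j < k)%N -> (y *m g) 0 j = 0).

Lemma sum_delta_if (x : 'I_n -> C) (P : pred 'I_n) i :
  \sum_j ((i == j) && P j)%:R * x j = if P i then x i else 0.
Proof.
rewrite (bigD1 i) //= eqxx big1 ?addr0 /= => [|j]; first by case: (P i); rewrite ?mul1r ?mul0r.
by rewrite eq_sym => /negPf->; rewrite mul0r.
Qed.

Lemma col_dependentE g :
  col_dependent g <-> forall f : {ffun 'I_n -> 'I_(n + n)}, \det (rowsub f (col_system g)) = 0.
Proof.
have sysE (x : 'cV_n) : col_system g *m x = 0 <->
    (forall j : 'I_n, (l < j)%N -> x j 0 = 0) /\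
    (forall i : 'I_n, (n - k <= i)%N -> (g *m x) i 0 = 0).
  rewrite mul_col_mx -col_mx0; split=> [/eq_col_mx[/colP h1 /colP h2]|[h1 h2]].
    split=> [j lj|i ki]; [have := h2 j|have := h1 i]; rewrite !mxE.
      by under eq_bigr => i _ do rewrite mxE; rewrite sum_delta_if lj.
    by under eq_bigr => j _ do rewrite mxE ki.
  congr col_mx; apply/colP => i; rewrite !mxE; under eq_bigr => j _ do rewrite mxE.
    have [ki|ki] := leqP (n - k) i; last by apply: big1 => j _; rewrite mul0r.
    by have := h2 i ki; rewrite mxE.
  by rewrite sum_delta_if; case: ifP => // /h1.
rewrite -kernel_rowsub_det; split=> -[x x0 /sysE xg]; by exists x.
Qed.

Lemma row_dependentE g :
  row_dependent g <-> forall f : {ffun 'I_n -> 'I_(n + n)}, \det (rowsub f (row_system g)) = 0.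
Proof.
have sysE (y : 'rV_n) : row_system g *m y^T = 0 <->
    (forall i : 'I_n, (i < n - l.+1)%N -> y 0 i = 0) /\
    (forall j : 'I_n, (j < k)%N -> (y *m g) 0 j = 0).
  rewrite mul_col_mx -col_mx0; split=> [/eq_col_mx[/colP h1 /colP h2]|[h1 h2]].
    split=> [i li|j jk]; [have := h2 i|have := h1 j]; rewrite !mxE.
      by under eq_bigr => j _ do rewrite mxE; rewrite sum_delta_if li mxE.
    by under eq_bigr => i _ do rewrite !mxE jk mulrC.
  congr col_mx; apply/colP => j; rewrite !mxE; under eq_bigr => i _ do rewrite mxE.
    have [jk|jk] := ltnP j k; last by apply: big1 => i _; rewrite mul0r.
    have := h2 j jk; rewrite mxE; under eq_bigr => i _ do rewrite mulrC.
    by move=> e; rewrite -[RHS]e; apply: eq_bigr => i _; rewrite mxE.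
  by rewrite sum_delta_if; case: ifP => // /h1; rewrite mxE.
rewrite -kernel_rowsub_det; split=> [[y y0 /sysE yg]|[x x0 xg]].
  by exists y^T => //; apply: contra_neq y0 => e; rewrite -[y]trmxK e trmx0.
exists x^T; first by apply: contra_neq x0 => e; rewrite -[x]trmxK e trmx0.
by apply/sysE; rewrite trmxK.
Qed.

Lemma col_dependentMl b g : upper b -> col_dependent g -> col_dependent (b *m g).
Proof.
move=> /upperP[bT _] [x x0 [xl xg]]; exists x => //; split=> // i ki.
rewrite -mulmxA mxE big1 // => j _; have [ji|ij] := ltnP j i; first by rewrite bT ?mul0r.
by rewrite xg ?mulr0 // (leq_trans ki).
Qed.

Lemma col_dependentMr g b : upper b -> col_dependent g -> col_dependent (g *m b).
Proof.
move=> bU [x x0 [xl xg]]; have bV := upper_unitmx bU.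
exists (invmx b *m x).
  by apply: contra_neq x0 => e; rewrite -[x](mulKVmx bV) e mulmx0.
split=> [j lj|i ki]; last by rewrite mulmxA mulmxK // xg.
have /upperP[bT _] := upperV bU; rewrite mxE big1 // => c _.
have [cj|jc] := ltnP c j; first by rewrite bT ?mul0r.
by rewrite xl ?mulr0 // (leq_trans lj).
Qed.

Lemma row_dependentMl b g : upper b -> row_dependent g -> row_dependent (b *m g).
Proof.
move=> bU [y y0 [yl yg]]; have bV := upper_unitmx bU.
exists (y *m invmx b).
  by apply: contra_neq y0 => e; rewrite -[y](mulmxKV bV) e mul0mx.
split=> [i li|j jk]; last by rewrite mulmxA mulmxKV // yg.
have /upperP[bT _] := upperV bU; rewrite mxE big1 // => c _.
have [ic|ci] := ltnP i c; first by rewrite bT ?mulr0.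
by rewrite yl ?mul0r // (leq_ltn_trans ci).
Qed.

Lemma row_dependentMr g b : upper b -> row_dependent g -> row_dependent (g *m b).
Proof.
move=> /upperP[bT _] [y y0 [yl yg]]; exists y => //; split=> // j jk.
rewrite mulmxA mxE big1 // => i _; have [ji|ij] := ltnP j i; first by rewrite bT ?mulr0.
by rewrite yg ?mul0r // (leq_ltn_trans ij).
Qed.

Lemma invariant_system (B : 'M[C]_n -> 'M[C]_(n + n, n)) :
    (forall i j, polyfun (fun t : point => B (\matrix_(a, b) t (a, b)) i j)) ->
    (forall g b, upper b ->
       (forall f : {ffun 'I_n -> 'I_(n + n)}, \det (rowsub f (B g)) = 0) ->
       forall f : {ffun 'I_n -> 'I_(n + n)}, \det (rowsub f (B (g *m b))) = 0) ->
  exists2 F, zariski_closed_flag F & forall g, GL g -> F (coset_borel g) <->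
    forall f : {ffun 'I_n -> 'I_(n + n)}, \det (rowsub f (B g)) = 0.
Proof.
move=> Bpol Binv.
pose P : set (point -> C) := [set p | exists f : {ffun 'I_n -> 'I_(n + n)},
  p = fun t => \det (rowsub f (B (\matrix_(a, b) t (a, b))))].
have PE g : (forall p, P p -> p (entries g) = 0) <->
    forall f : {ffun 'I_n -> 'I_(n + n)}, \det (rowsub f (B g)) = 0.
  split=> [H f|H _ [f ->]]; last by rewrite entriesK.
  by have := H _ (ex_intro _ f (erefl _)); rewrite entriesK.
have Pinv : invariant_family P.
  split=> [_ [f ->]|g b gU bU /PE Pg]; last by apply/PE; apply: Binv.
  by apply: polyfun_det => i j; apply: (polyfun_ext (Bpol (f i) j)) => t; rewrite mxE.
exists (flag_zeros P); first exact: flag_zeros_closed.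
by move=> g gU; rewrite mem_flag_zeros.
Qed.

Lemma polyfun_col_mx (A B : 'M[C]_n -> 'M[C]_n) i j :
    (forall i j, polyfun (fun t : point => A (\matrix_(a, b) t (a, b)) i j)) ->
    (forall i j, polyfun (fun t : point => B (\matrix_(a, b) t (a, b)) i j)) ->
  polyfun (fun t : point => col_mx (A (\matrix_(a, b) t (a, b)))
                                   (B (\matrix_(a, b) t (a, b))) i j).
Proof.
move=> pA pB; case: (split_ordP i) => r ->.
  by apply: (polyfun_ext (pA r j)) => t; rewrite col_mxEu.
by apply: (polyfun_ext (pB r j)) => t; rewrite col_mxEd.
Qed.

Lemma col_dependent_closed : exists2 F, zariski_closed_flag F &
  forall g, GL g -> F (coset_borel g) <-> col_dependent g.
Proof.
have [|g b bU /col_dependentE gD|F Fcl FE] := @invariant_system col_system.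
- move=> i j; apply: (@polyfun_col_mx
    (fun g => \matrix_(i, j) if (n - k <= i)%N then g i j else 0)
    (fun=> \matrix_(i, j) ((i == j) && (l < j)%N)%:R)) => {}i {}j.
    apply: (polyfun_ext (polyfun_if (n - k <= i)%N (@polyfun_var _ _ (i, j)) (@polyfun_cst _ _ 0))) => t.
    by rewrite !mxE.
  by apply: (polyfun_ext (@polyfun_cst _ _ ((i == j) && (l < j)%N)%:R)) => t; rewrite mxE.
- by apply/col_dependentE; apply: col_dependentMr.
by exists F => // g gU; rewrite FE // col_dependentE.
Qed.

Lemma row_dependent_closed : exists2 F, zariski_closed_flag F &
  forall g, GL g -> F (coset_borel g) <-> row_dependent g.
Proof.
have [|g b bU /row_dependentE gD|F Fcl FE] := @invariant_system row_system.
- move=> j i; apply: (@polyfun_col_mx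
    (fun g => \matrix_(j, i) if (j < k)%N then g i j else 0)
    (fun=> \matrix_(j, i) ((j == i) && (i < n - l.+1)%N)%:R)) => {}j {}i.
    apply: (polyfun_ext (polyfun_if (j < k)%N (@polyfun_var _ _ (i, j)) (@polyfun_cst _ _ 0))) => t.
    by rewrite !mxE.
  by apply: (polyfun_ext (@polyfun_cst _ _ ((j == i) && (i < n - l.+1)%N)%:R)) => t;
    rewrite mxE.
- by apply/row_dependentE; apply: row_dependentMr.
by exists F => // g gU; rewrite FE // row_dependentE.
Qed.

Lemma perm_mulcv u (x : 'cV[C]_n) j : (perm_matrix C u *m x) (u j) 0 = x j 0.
Proof.
rewrite mxE (bigD1 j) //= mxE eqxx mul1r big1 ?addr0 // => i ij.
by rewrite mxE (inj_eq perm_inj) (negPf ij) mul0r.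
Qed.

Lemma perm_mulrv u (y : 'rV[C]_n) j : (y *m perm_matrix C u) 0 j = y 0 (u j).
Proof.
rewrite mxE (bigD1 (u j)) //= mxE eqxx mulr1 big1 ?addr0 // => i ij.
by rewrite mxE eq_sym (negPf ij) mulr0.
Qed.

Lemma below_dependent u : below l k u <->
  col_dependent (perm_matrix C u) /\ row_dependent (perm_matrix C u).
Proof.
split=> [/belowP[j0 [j1 [h0 h1 h2 h3]]]|[[x x0 [xl xg]] [y y0 [yl yg]]]].
  split.
    exists (delta_mx j0 0).
      by apply/eqP => /colP/(_ j0)/eqP; rewrite !mxE !eqxx oner_eq0.
    split=> [j lj|i ki]; first by rewrite mxE ord_gt_eqF //; lia.
    rewrite -(permKV u i) perm_mulcv mxE; case: eqP => // e.
    by move: h1; rewrite -e permKV; lia.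
  exists (delta_mx 0 (u j1)).
    by apply/eqP => /rowP/(_ (u j1))/eqP; rewrite !mxE !eqxx oner_eq0.
  split=> [i li|j jk]; first by rewrite mxE (@ord_lt_eqF _ i) ?andbF //; lia.
  by rewrite perm_mulrv mxE (inj_eq perm_inj) (@ord_lt_eqF _ j) ?andbF //; lia.
have [j0 xj0] : exists j, x j 0 != 0.
  apply: contrapT => H; case/eqP: x0; apply/colP => j; rewrite mxE.
  by apply: contrapT => /eqP xj; apply: H; exists j.
have [i1 yi1] : exists i, y 0 i != 0.
  apply: contrapT => H; case/eqP: y0; apply/rowP => i; rewrite mxE.
  by apply: contrapT => /eqP yi; apply: H; exists i.
apply/belowP; exists j0, ((u^-1)%g i1); rewrite permKV; split.
- by rewrite leqNgt; apply: contra xj0 => /xl ->.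
- by rewrite ltnNge; apply: contra xj0 => /xg; rewrite perm_mulcv => ->.
- rewrite leqNgt; apply: contra yi1 => /yg; by rewrite perm_mulrv permKV => ->.
- by rewrite leqNgt; apply: contra yi1 => /yl ->.
Qed.

(** Both conditions are closed, invariant under the Borel subgroup on either side, and true at [w],
    so they hold on the closure. Conversely, they pass from [M] to the permutation [u] of its Bruhat
    cell, giving [u <= w], and every cell below [w] lies in the closure. *)
Lemma kl_variety_dependent v w M : (l < k)%N -> w = perm_comp w0 (tperm l k) ->
  in_slice v M -> kl_variety v w (coset_borel M) <-> col_dependent M /\ row_dependent M.
Proof.
move=> lk wE MS; have MU := in_slice_GL MS.
have wGL b : upper b -> GL (b *m perm_matrix C w).
  by move=> bU; rewrite /GL /= unitmx_mul perm_matrix_unit upper_unitmx.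
have [wc wr] := (below_dependent w).1 (below_w lk wE).
split=> [[wM _]|[Mc Mr]].
  have [Fc Fc_cl FcE] := col_dependent_closed; have [Fr Fr_cl FrE] := row_dependent_closed.
  split.
    apply/FcE => //; apply: wM; split=> // _ [b /borelE bU <-].
    by apply/FcE; [apply: wGL|apply: col_dependentMl].
  apply/FrE => //; apply: wM; split=> // _ [b /borelE bU <-].
  by apply/FrE; [apply: wGL|apply: row_dependentMl].
split; last exact: in_slice_opp_cell.
move=> F [Fcl wF]; have [u [b [b' [bU b'U Me]]]] := bruhat_decomposition MU.
rewrite Me coset_borelM //; apply: (closed_flag_bruhat Fcl wF) => //.
rewrite (bruhat_le_below lk wE); apply/below_dependent.
have -> : perm_matrix C u = invmx b *m M *m invmx b'.
  by rewrite Me !mulmxA mulVmx ?upper_unitmx // mul1mx mulmxK ?upper_unitmx.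
have bV := upperV bU; have b'V := upperV b'U.
by split; [apply/col_dependentMr/col_dependentMl|apply/row_dependentMr/row_dependentMl].
Qed.
End Dependence.
End KazhdanLusztigVariety.

Lemma mem_filter_enum (T : finType) (A : {set T}) (P : pred T) x :
  (x \in [seq y <- enum A | P y]) = P x && (x \in A).
Proof. by rewrite mem_filter fintype.mem_enum. Qed.

Lemma In_mem (T : eqType) (s : seq T) x : List.In x s <-> x \in s.
Proof.
elim: s => //= y s IH; rewrite inE IH; split=> [[->|->]|/orP[/eqP->|]]; rewrite ?eqxx ?orbT //.
  by left.
by right.
Qed.

(** Component [j] is settled after [mu j + 1] iterations, so [n] iterations forget the start.
    Triangular systems are thus solved by plain iteration, with existence and uniqueness of the
    fixed point. *)
Lemma iter_triangular (T : Type) n (G : ('I_n -> T) -> 'I_n -> T) (mu : 'I_n -> nat) :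
    (forall i, (mu i < n)%N) ->
    (forall x x' m, (forall j, (mu j < m)%N -> x j = x' j) ->
       forall j, (mu j <= m)%N -> G x j = G x' j) ->
  forall x x', iter n G x = iter n G x'.
Proof.
move=> mun Gtri x x'.
have H m j : (mu j < m)%N -> iter m G x j = iter m G x' j.
  by elim: m j => // m IH j jm; apply: Gtri IH j jm.
by apply/funext => j; apply: H.
Qed.

(** * Parameters for the slice matrices with both relations *)

Section Chart.
Variables (R : realType) (n : nat) (l k : 'I_n) (v : 'S_n).
Hypothesis lk : (l < k)%N.
Local Notation C := (R[i]).
Local Notation J := (('I_n * 'I_n) + ('I_n + 'I_n))%type.
Implicit Types (t : J -> C) (x y : 'I_n -> C).

Section Parametrization.
Variables i1 j1 : 'I_n.

(* The chart [(i1, j1)] describes the slice matrices with a column relation of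
   coefficient [1] at [j1] and a row relation of coefficient [1] at [i1]. The
   relations are determined by their coefficients off the pivots, and they solve
   for the entries in the [solved] cells; the remaining entries are free. *)
Definition solved : {set 'I_n * 'I_n} :=
  (finset.setX (free_rows l k v) [set j1] :|: finset.setX [set i1] (free_cols l k v))%SET.

Definition base t i j : C :=
  (v j == i)%:R + (if (i, j) \in opp_rothe v :\: solved then t (inl (i, j)) else 0).

(** In a low column the coefficient is free. In another column [j <= l], the relation along the
    pivot row [v j >= n - k] determines it from the coefficients to its left. *)
Definition col_step_rel t x (j : 'I_n) : C :=
  if j == j1 then 1 else if (l < j)%N then 0 else
  if (v j < n - k)%N then t (inr (inl j)) else - \sum_(j' < n | (j' < j)%N) base t (v j) j' * x j'.

Definition row_step_rel t y (i : 'I_n) : C :=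
  if i == i1 then 1 else if (i < n - l.+1)%N then 0 else
  if (k <= (v^-1)%g i)%N then t (inr (inr i))
  else - \sum_(i' < n | (i < i')%N) y i' * base t i' ((v^-1)%g i).

Definition col_rel t := iter n (col_step_rel t) (fun=> 0).
Definition row_rel t := iter n (row_step_rel t) (fun=> 0).

Definition fill t i j : C := base t i j -
  (if (j == j1) && (i \in free_rows l k v) && (i != i1) then \sum_j' base t i j' * col_rel t j'
   else if (i == i1) && (j \in free_cols l k v) && (j != j1) then \sum_i' row_rel t i' * base t i' j
   else 0).

(** The corner is filled last, from the column relation alone, as its equation involves the solved
    entries of row [i1]. The row relation in column [j1] is then automatic; see [chart_row_rel]. *)
Definition chart t (ij : 'I_n * 'I_n) : C :=
  if ij == (i1, j1) then - \sum_j' fill t i1 j' * col_rel t j' else fill t ij.1 ij.2.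

Definition chart_params : {set J} := [set s | match s with
  | inl c => c \in opp_rothe v :\: solved
  | inr (inl j) => j \in low_cols l k v :\ j1
  | inr (inr i) => i \in high_rows l k v :\ i1
  end]%SET.

Lemma col_step_rel_iter t x x' : iter n (col_step_rel t) x = iter n (col_step_rel t) x'.
Proof.
apply: (@iter_triangular _ _ _ (@nat_of_ord n)) => // {}x {}x' m xx' j jm.
rewrite /col_step_rel; do 3!case: ifP => // _; congr (- _).
by apply: eq_bigr => j' j'j; rewrite xx' //; lia.
Qed.

Lemma row_step_rel_iter t y y' : iter n (row_step_rel t) y = iter n (row_step_rel t) y'.
Proof.
apply: (@iter_triangular _ _ _ (fun i : 'I_n => n - i.+1)%N) => [i|{}y {}y' m yy' i im].
  by have := ltn_ord i; lia.
rewrite /row_step_rel; do 3!case: ifP => // _; congr (- _).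
by apply: eq_bigr => i' ii'; rewrite yy' //; have := ltn_ord i'; lia.
Qed.

Lemma col_relE t : col_step_rel t (col_rel t) = col_rel t.
Proof. by rewrite /col_rel -iterS iterSr; apply: col_step_rel_iter. Qed.

Lemma row_relE t : row_step_rel t (row_rel t) = row_rel t.
Proof. by rewrite /row_rel -iterS iterSr; apply: row_step_rel_iter. Qed.

Lemma col_rel_unique t x : col_step_rel t x = x -> col_rel t = x.
Proof.
by move=> xE; rewrite /col_rel (col_step_rel_iter t _ x) iter_fix.
Qed.

Lemma row_rel_unique t y : row_step_rel t y = y -> row_rel t = y.
Proof.
by move=> yE; rewrite /row_rel (row_step_rel_iter t _ y) iter_fix.
Qed.

Lemma chart_ext t t' : (forall s, s \in chart_params -> t s = t' s) -> chart t = chart t'.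
Proof.
move=> tt'.
have eb : base t = base t'.
  apply/funext => i; apply/funext => j; congr (_ + _).
  by case: ifP => // ijD; apply: tt'; rewrite inE.
have ex : col_rel t = col_rel t'.
  rewrite /col_rel; congr (iter n _ _); apply/funext => x; apply/funext => j.
  rewrite /col_step_rel eb; case: eqP => // /eqP jj; case: ltnP => // jl; case: ifP => // vj.
  by apply: tt'; rewrite inE finset.in_setD1 jj inE jl vj.
have ey : row_rel t = row_rel t'.
  rewrite /row_rel; congr (iter n _ _); apply/funext => y; apply/funext => i.
  rewrite /row_step_rel eb; case: eqP => // /eqP ii; case: ltnP => // il; case: ifP => // vi.
  by apply: tt'; rewrite inE finset.in_setD1 ii inE il vi.
by rewrite /chart /fill eb ex ey.
Qed.

Lemma polyfun_base i j : polyfun (fun t => base t i j).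
Proof.
apply: polyfun_add; first exact: polyfun_cst.
by apply: polyfun_if; [apply: polyfun_var|apply: polyfun_cst].
Qed.

Lemma polyfun_col_rel j : polyfun (fun t => col_rel t j).
Proof.
suff: forall m j, polyfun (fun t => iter m (col_step_rel t) (fun=> 0) j) by apply.
elim=> [|m IH] {}j /=; first exact: polyfun_cst.
do 2!(apply: polyfun_if; first exact: polyfun_cst).
apply: polyfun_if; first exact: polyfun_var.
apply/polyfun_opp/polyfun_sum => j' _; apply: polyfun_mul; last exact: IH.
exact: polyfun_base.
Qed.

Lemma polyfun_row_rel i : polyfun (fun t => row_rel t i).
Proof.
suff: forall m i, polyfun (fun t => iter m (row_step_rel t) (fun=> 0) i) by apply.
elim=> [|m IH] {}i /=; first exact: polyfun_cst.
do 2!(apply: polyfun_if; first exact: polyfun_cst).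
apply: polyfun_if; first exact: polyfun_var.
apply/polyfun_opp/polyfun_sum => i' _; apply: polyfun_mul; first exact: IH.
exact: polyfun_base.
Qed.

Lemma polyfun_fill i j : polyfun (fun t => fill t i j).
Proof.
apply: polyfun_sub; first exact: polyfun_base.
apply: polyfun_if; last apply: polyfun_if; last exact: polyfun_cst.
  by apply: polyfun_sum => j' _; apply: polyfun_mul; [apply: polyfun_base|apply:
    polyfun_col_rel].
by apply: polyfun_sum => i' _; apply: polyfun_mul; [apply: polyfun_row_rel|apply: polyfun_base].
Qed.

Lemma polyfun_chart ij : polyfun (fun t => chart t ij).
Proof.
apply: polyfun_if; last exact: polyfun_fill.
apply/polyfun_opp/polyfun_sum => j' _; apply: polyfun_mul; last exact: polyfun_col_rel.
exact: polyfun_fill.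
Qed.

Hypotheses (j1L : j1 \in low_cols l k v) (i1H : i1 \in high_rows l k v).

Lemma j1P : (j1 <= l)%N /\ (v j1 < n - k)%N.
Proof. by move: j1L; rewrite inE => /andP. Qed.

Lemma i1P : (n - l.+1 <= i1)%N /\ (k <= (v^-1)%g i1)%N.
Proof. by move: i1H; rewrite inE => /andP. Qed.

Lemma i1_free : i1 \in free_rows l k v.
Proof. exact: (fintype.subsetP (high_rows_free lk v)). Qed.

Lemma j1_free : j1 \in free_cols l k v.
Proof. exact: (fintype.subsetP (low_cols_free lk v)). Qed.

Lemma solved_opp_rothe : (solved \subset opp_rothe v)%SET.
Proof.
apply/fintype.subsetP => -[i j];
  rewrite finset.in_setU !finset.in_setX !finset.in_set1 => /orP[/andP[iF /eqP->]|/andP[/eqP-> jF]].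
  by apply: (low_cell lk).
by apply: high_cell i1H jF.
Qed.

(** The column relation trades [#|free_rows|] solved cells for [#|low_cols| - 1] coefficients, a
    loss of [k - l]. The row relation loses as much, and the corner [(i1, j1)] is counted twice. *)
Lemma card_chart_params : (#|chart_params| + (2 * (k - l)).-1)%N = #|opp_rothe v|.
Proof.
have cL : #|low_cols l k v| = #|low_cols l k v :\ j1|.+1 by rewrite (cardsD1 j1) j1L.
have cH : #|high_rows l k v| = #|high_rows l k v :\ i1|.+1 by rewrite (cardsD1 i1) i1H.
have cS : (#|solved| + 1 =
    (#|low_cols l k v| + (k - l.+1)) + (#|high_rows l k v| + (k - l.+1)))%N.
  have := cardsUI (finset.setX (free_rows l k v) [set j1]%SET)
                  (finset.setX [set i1]%SET (free_cols l k v)).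
  have -> : (finset.setX (free_rows l k v) [set j1] :&: finset.setX [set i1] (free_cols l k v)
      = [set (i1, j1)])%SET.
    apply/setP => -[i j]; rewrite finset.in_setI !finset.in_setX !finset.in_set1 xpair_eqE.
    by have [->|_] := eqVneq i i1; have [->|_] := eqVneq j j1; rewrite ?andbF ?i1_free ?j1_free.
  by rewrite -/solved !cardsX !cards1 muln1 mul1n card_free_rows // card_free_cols.
have cD : #|opp_rothe v| = (#|solved| + #|opp_rothe v :\: solved|)%N.
  by rewrite -(cardsID solved (opp_rothe v)) (finset.setIidPr solved_opp_rothe).
have -> : #|chart_params| =
    (#|opp_rothe v :\: solved| + (#|low_cols l k v :\ j1| + #|high_rows l k v :\ i1|))%N.
  rewrite -sum1_card big_sumType /=; congr (_ + _)%N.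
    by rewrite -sum1_card; apply: eq_bigl => s; rewrite inE.
  by rewrite big_sumType /= -!sum1_card; congr (_ + _)%N; apply: eq_bigl => s; rewrite inE.
move: cS; rewrite cD cL cH.
move: #|solved| #|opp_rothe v :\: solved| #|low_cols l k v :\ j1| #|high_rows l k v :\ i1| lk.
by clear; lia.
Qed.

Lemma chart_slice t : in_slice v (\matrix_(i, j) chart t (i, j)).
Proof.
have [j1l vj1] := j1P; have [i1l vi1] := i1P.
have baseN i j : i != v j -> (i, j) \notin opp_rothe v :\: solved -> base t i j = 0.
  by move=> /negPf vji /negPf ijD; rewrite /base eq_sym vji ijD addr0.
have pivotN j : (v j, j) \notin opp_rothe v by rewrite inE /= ltnn.
have solvedD ij : ij \in solved -> ij \in opp_rothe v by apply:
  (fintype.subsetP solved_opp_rothe).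
have jjF j : (j == j1) && (v j \in free_rows l k v) && (v j != i1) = false.
  apply/negP => /andP[/andP[/eqP-> vF] _]; have := solvedD (v j1, j1).
  by rewrite (negPf (pivotN j1)) finset.in_setU finset.in_setX vF finset.set11 => /(_ isT).
have jjF' j : (v j == i1) && (j \in free_cols l k v) && (j != j1) = false.
  apply/negP => /andP[/andP[/eqP vji jF] _]; have := solvedD (v j, j).
  by rewrite (negPf (pivotN j)) finset.in_setU !finset.in_setX jF vji finset.set11 orbT => /(_ isT).
split=> [j|i j].
  rewrite mxE /chart xpair_eqE; case: ifP => [/andP[/eqP vji /eqP jj]|_].
    by have := jjF j; move: vi1; rewrite -vji permK jj; lia.
  rewrite /fill /= jjF jjF' subr0 /base eqxx (_ : (v j, j) \in _ = false) ?addr0 //.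
  by rewrite finset.in_setD (negPf (pivotN j)) andbF.
rewrite mxE /chart /fill xpair_eqE /= => h.
have [->|vji] := eqVneq i (v j); [by left|right].
apply/negPn/negP => ijD; case/negP: h; apply/eqP.
have ijS : (i, j) \notin solved by apply: contra ijD; apply: solvedD.
move: ijS; rewrite finset.in_setU !finset.in_setX !finset.in_set1 negb_or !negb_and => /andP[h1 h2].
rewrite baseN //; last by rewrite finset.in_setD (negPf ijD) andbF.
have [ii|ii] := eqVneq i i1.
  by move: h1; rewrite ii i1_free /= => /negPf ->; move: h2; rewrite ii eqxx /= => /negPf ->;
    rewrite subr0.
by move: h1; rewrite andbT /= ; case: (j == j1); case: (i \in _) => //= _; rewrite subr0.
Qed.

Lemma mem_solved i j : ((i, j) \in solved) =
  (i \in free_rows l k v) && (j == j1) || (i == i1) && (j \in free_cols l k v).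
Proof. by rewrite finset.in_setU !finset.in_setX !finset.in_set1. Qed.

Lemma base_pivot t j : base t (v j) j = 1.
Proof. by rewrite /base eqxx finset.in_setD [_ \in opp_rothe v]inE /= ltnn andbF addr0. Qed.

Lemma base_eq0 t i j : i != v j -> (i, j) \notin opp_rothe v :\: solved -> base t i j = 0.
Proof. by move=> /negPf vji /negPf ijD; rewrite /base eq_sym vji ijD addr0. Qed.

Lemma base_solved t i j : (i, j) \in solved -> base t i j = 0.
Proof.
move=> ijS; apply: base_eq0; last by rewrite finset.in_setD ijS.
apply: contraTneq (fintype.subsetP solved_opp_rothe _ ijS) => ->.
by rewrite inE /= ltnn.
Qed.

Lemma base_free t i j : (i, j) \in opp_rothe v :\: solved -> base t i j = t (inl (i, j)).
Proof.
move=> ijD; rewrite /base ijD; case: eqP => [e|_]; last by rewrite add0r.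
by move: ijD; rewrite -e finset.in_setD => /andP[_]; rewrite inE /= ltnn.
Qed.

Lemma col_rel1 t : col_rel t j1 = 1.
Proof. by rewrite -col_relE /col_step_rel eqxx. Qed.

Lemma row_rel1 t : row_rel t i1 = 1.
Proof. by rewrite -row_relE /row_step_rel eqxx. Qed.

Lemma col_rel0 t (j : 'I_n) : (l < j)%N -> col_rel t j = 0.
Proof.
move=> lj; have [j1l _] := j1P; rewrite -col_relE /col_step_rel lj.
by rewrite (@ord_gt_eqF _ j j1) //; lia.
Qed.

Lemma row_rel0 t (i : 'I_n) : (i < n - l.+1)%N -> row_rel t i = 0.
Proof.
move=> il; have [i1l _] := i1P; rewrite -row_relE /row_step_rel il.
by rewrite (@ord_lt_eqF _ i i1) //; lia.
Qed.

Lemma col_rel_param t j : j \in low_cols l k v :\ j1 -> col_rel t j = t (inr (inl j)).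
Proof.
rewrite finset.in_setD1 inE => /andP[/negPf jj /andP[jl vj]].
by rewrite -col_relE /col_step_rel jj vj ltnNge jl.
Qed.

Lemma row_rel_param t i : i \in high_rows l k v :\ i1 -> row_rel t i = t (inr (inr i)).
Proof.
rewrite finset.in_setD1 inE => /andP[/negPf ii /andP[il vi]].
by rewrite -row_relE /row_step_rel ii vi ltnNge il.
Qed.

Lemma chart_corner t : chart t (i1, j1) = - \sum_j fill t i1 j * col_rel t j.
Proof. by rewrite /chart eqxx. Qed.

Lemma chart_fill t i j : (i, j) != (i1, j1) -> chart t (i, j) = fill t i j.
Proof. by move=> /negPf ij; rewrite /chart ij. Qed.

Lemma fill_base t i j : (i, j) \notin solved -> fill t i j = base t i j.
Proof.
rewrite mem_solved negb_or !negb_and /fill => /andP[h1 h2]; rewrite ifN ?ifN ?subr0 //.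
  by rewrite !negb_and; case/orP: h2 => ->; rewrite ?orbT.
by rewrite !negb_and; case/orP: h1 => ->; rewrite ?orbT.
Qed.

Lemma fill_corner t : fill t i1 j1 = 0.
Proof.
rewrite /fill !eqxx !andbF subr0 base_solved // mem_solved i1_free eqxx.
by [].
Qed.

Lemma chart_base t i j : (i, j) \notin solved -> chart t (i, j) = base t i j.
Proof.
move=> ijS; rewrite chart_fill ?fill_base //; apply: contraNneq ijS => -[-> ->].
by rewrite mem_solved i1_free eqxx.
Qed.

Lemma chart_solved_col t i : i \in free_rows l k v -> i != i1 ->
  chart t (i, j1) = - \sum_j base t i j * col_rel t j.
Proof.
move=> iF ii; rewrite chart_fill; last by rewrite xpair_eqE (negPf ii).
by rewrite /fill eqxx iF ii base_solved ?sub0r // mem_solved iF eqxx.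
Qed.

Lemma chart_solved_row t j : j \in free_cols l k v -> j != j1 ->
  chart t (i1, j) = - \sum_i row_rel t i * base t i j.
Proof.
move=> jF jj; rewrite chart_fill; last by rewrite xpair_eqE (negPf jj) andbF.
rewrite /fill (negPf jj) /= eqxx jF base_solved ?sub0r // mem_solved jF eqxx.
by rewrite orbT.
Qed.

Lemma chart_col_rel t (i : 'I_n) : (n - k <= i)%N -> \sum_j chart t (i, j) * col_rel t j = 0.
Proof.
move=> ki; have [j1l vj1] := j1P; have [i1l vi1] := i1P.
have [->|ii] := eqVneq i i1.
  rewrite (bigD1 j1) //= chart_corner col_rel1 mulr1 [X in - X](bigD1 j1) //=.
  rewrite fill_corner mul0r add0r addrC; apply/eqP; rewrite subr_eq0; apply/eqP.
  apply: eq_bigr => j jj; rewrite chart_fill //.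
  by rewrite xpair_eqE (negPf jj) andbF.
have [iF|iF] := boolP (i \in free_rows l k v).
  rewrite (bigD1 j1) //= chart_solved_col // col_rel1 mulr1 [X in - X](bigD1 j1) //=.
  rewrite base_solved ?mem_solved ?iF ?eqxx // mul0r add0r addrC; apply/eqP; rewrite subr_eq0;
    apply/eqP.
  apply: eq_bigr => j jj; rewrite chart_base //.
  by rewrite mem_solved (negPf jj) andbF (negPf ii).
have iS j : (i, j) \notin solved by rewrite mem_solved (negPf iF) (negPf ii).
under eq_bigr => j _ do rewrite chart_base //.
have pl : ((v^-1)%g i <= l)%N by move: iF; rewrite inE ki /= -leqNgt.
set p := (v^-1)%g i in pl; have vp : v p = i by rewrite permKV.
have pj : p != j1 by apply: contraTneq ki => pj; rewrite -vp pj -ltnNge.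
rewrite (bigD1 p) //= -{1}vp base_pivot mul1r.
have -> : col_rel t p = - \sum_(j < n | (j < p)%N) base t (v p) j * col_rel t j.
  by rewrite -{1}col_relE /col_step_rel (negPf pj) !ifN -?leqNgt ?vp.
rewrite vp addrC; apply/eqP; rewrite subr_eq0; apply/eqP.
rewrite [LHS](bigID (fun j : 'I_n => (j < p)%N)) /= [X in _ + X]big1 ?addr0.
  by apply: eq_bigl => j; rewrite andb_idl // => jp; rewrite ord_lt_eqF.
move=> j /andP[jp pj']; rewrite base_eq0 ?mul0r //.
  by rewrite -vp (inj_eq perm_inj) eq_sym.
by apply: contra pj'; rewrite finset.in_setD => /andP[_]; rewrite inE => /andP[].
Qed.

Lemma chart_row_rel t (j : 'I_n) : (j < k)%N -> \sum_i row_rel t i * chart t (i, j) = 0.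
Proof.
move=> jk; have [j1l vj1] := j1P; have [i1l vi1] := i1P.
have H (j' : 'I_n) : (j' < k)%N -> j' != j1 -> \sum_i row_rel t i * chart t (i, j') = 0.
  move=> {j jk}jk jj; set j := j' in jk jj *.
  have [jF|jF] := boolP (j \in free_cols l k v).
    rewrite (bigD1 i1) //= chart_solved_row // row_rel1 mul1r [X in - X](bigD1 i1) //=.
    rewrite [base t i1 j]base_solved ?mem_solved ?jF ?eqxx ?orbT // mulr0 add0r addrC.
    apply/eqP; rewrite subr_eq0; apply/eqP; apply: eq_bigr => i ii; rewrite chart_base //.
    by rewrite mem_solved (negPf jj) andbF (negPf ii).
  have jS i : (i, j) \notin solved by rewrite mem_solved (negPf jj) (negPf jF) !andbF.
  under eq_bigr => i _ do rewrite chart_base //.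
  have vjl : (n - l.+1 <= v j)%N by move: jF; rewrite inE jk /= -leqNgt.
  have vji : v j != i1.
    by apply: contraTneq jk => vji; move: vi1; rewrite -vji permK -leqNgt.
  rewrite (bigD1 (v j)) //= base_pivot mulr1.
  have -> : row_rel t (v j) = - \sum_(i < n | (v j < i)%N) row_rel t i * base t i j.
    rewrite -{1}row_relE /row_step_rel (negPf vji) permK !ifN -?leqNgt //.
    by rewrite -ltnNge.
  rewrite addrC; apply/eqP; rewrite subr_eq0; apply/eqP.
  rewrite [LHS](bigID (fun i : 'I_n => (v j < i)%N)) /= [X in _ + X]big1 ?addr0.
    by apply: eq_bigl => i; rewrite andb_idl // => jp; rewrite ord_gt_eqF.
  move=> i /andP[ij ij']; rewrite base_eq0 ?mulr0 //.
  by apply: contra ij'; rewrite finset.in_setD => /andP[_]; rewrite inE => /andP[].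
have [->|] := eqVneq j j1; last exact: H.
(* The product [y M x] vanishes by the column relation, since [y] is supported in rows where [M x]
   is zero. Summed by columns instead, only the term of [j1] is left. *)
have : \sum_j' (\sum_i row_rel t i * chart t (i, j')) * col_rel t j' = 0.
  under eq_bigr => j' _ do rewrite mulr_suml.
  rewrite exchange_big /= big1 // => i _.
  under eq_bigr => j' _ do rewrite -mulrA.
  rewrite -mulr_sumr; have [il|il] := ltnP i (n - l.+1); first by rewrite row_rel0 ?mul0r.
  by rewrite chart_col_rel ?mulr0 //; lia.
rewrite (bigD1 j1) //= col_rel1 mulr1 [X in _ + X]big1 ?addr0 // => j' jj.
have [lj|jl] := ltnP l j'; first by rewrite col_rel0 ?mulr0.
by rewrite H ?mul0r //; lia.
Qed.

Lemma chart_dependent t :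
  col_dependent l k (\matrix_(i, j) chart t (i, j)) /\
  row_dependent l k (\matrix_(i, j) chart t (i, j)).
Proof.
split.
  exists (\col_j col_rel t j).
    by apply/eqP => /colP/(_ j1)/eqP; rewrite !mxE col_rel1 oner_eq0.
  split=> [j lj|i ki]; first by rewrite mxE col_rel0.
  rewrite mxE -[RHS](chart_col_rel t ki); apply: eq_bigr => j _.
  by rewrite !mxE.
exists (\row_i row_rel t i).
  by apply/eqP => /rowP/(_ i1)/eqP; rewrite !mxE row_rel1 oner_eq0.
split=> [i il|j jk]; first by rewrite mxE row_rel0.
rewrite mxE -[RHS](chart_row_rel t jk); apply: eq_bigr => i _.
by rewrite !mxE.
Qed.

(** The parameters are read off [M], [x] and [y]. The recursions have unique solutions, so they
    return [x] and [y], and the relations then return the solved entries. *)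
Lemma entries_chart (M : 'M[C]_n) x y : in_slice v M ->
    x j1 = 1 -> (forall j : 'I_n, (l < j)%N -> x j = 0) ->
    (forall i : 'I_n, (n - k <= i)%N -> \sum_j M i j * x j = 0) ->
    y i1 = 1 -> (forall i : 'I_n, (i < n - l.+1)%N -> y i = 0) ->
    (forall j : 'I_n, (j < k)%N -> \sum_i y i * M i j = 0) ->
  entries M = chart (fun s => match s with
    | inl c => M c.1 c.2 | inr (inl j) => x j | inr (inr i) => y i end).
Proof.
move=> [M1 M0] x1 xl Mx y1 yl My; set t := fun s => _.
have [j1l vj1] := j1P; have [i1l vi1] := i1P.
have Mz i j : i != v j -> (i, j) \notin opp_rothe v -> M i j = 0.
  move=> iv ijD; apply/eqP; apply: contraNT ijD => /M0[e|//].
  by rewrite e eqxx in iv.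
have baseM i j : (i, j) \notin solved -> base t i j = M i j.
  move=> ijS; have [->|iv] := eqVneq i (v j); first by rewrite base_pivot M1.
  have [ijD|ijD] := boolP ((i, j) \in opp_rothe v).
    by rewrite base_free // finset.in_setD ijS.
  by rewrite Mz // base_eq0 // finset.in_setD (negPf ijD) andbF.
have pivot_row (j' j : 'I_n) : (j <= l)%N -> (j' <= l)%N -> (n - k <= v j)%N ->
  (v j, j') \notin solved.
  move=> jl j'l kv; rewrite mem_solved !inE permK ltnNge jl andbF /=.
  rewrite negb_and; apply/orP; left; apply: contraTneq vi1 => <-.
  by rewrite permK -ltnNge; lia.
have pivot_col (i' i : 'I_n) : (n - l.+1 <= i)%N -> ((v^-1)%g i < k)%N ->
  (i', (v^-1)%g i) \notin solved.
  move=> il ik; rewrite mem_solved [_ \in free_cols _ _ _]inE permKV (ltnNge i) il andbF andbF orbF.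
  rewrite negb_and; apply/orP; right; apply: contraTneq vj1 => <-.
  by rewrite permKV -leqNgt; have := ltn_ord k; lia.
have xE : col_rel t = x.
  apply: col_rel_unique; apply/funext => j; rewrite /col_step_rel.
  case: eqP => [->//|_]; case: ltnP => [/xl->//|jl]; case: ltnP => // kv.
  have := Mx (v j) kv; rewrite (bigD1 j) //= M1 mul1r => /eqP; rewrite addr_eq0 => /eqP->.
  congr (- _); rewrite [RHS](bigID (fun j' :
    'I_n => (j' < j)%N)) /= [X in _ = _ + X]big1 ?addr0.
    apply: eq_big => [j'|j' jj]; first by rewrite andb_idl // => jj; rewrite ord_lt_eqF.
    by rewrite baseM // pivot_row //; lia.
  move=> j' /andP[jj jj']; rewrite Mz ?mul0r //; first by rewrite (inj_eq perm_inj) eq_sym.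
  by rewrite inE /= permK (negPf jj') andbF.
have yE : row_rel t = y.
  apply: row_rel_unique; apply/funext => i; rewrite /row_step_rel.
  case: eqP => [->//|_]; case: ltnP => [/yl->//|il]; case: leqP => // ik.
  have := My _ ik; rewrite (bigD1 i) //= -{2}(permKV v i) M1 mulr1 => /eqP.
  rewrite addr_eq0 => /eqP->.
  congr (- _); rewrite [RHS](bigID (fun i' :
    'I_n => (i < i')%N)) /= [X in _ = _ + X]big1 ?addr0.
    apply: eq_big => [i'|i' ii]; first by rewrite andb_idl // => ii; rewrite ord_gt_eqF.
    by rewrite baseM // pivot_col.
  move=> i' /andP[ii ii']; rewrite Mz ?mulr0 ?permKV //.
  by rewrite inE /= permKV (negPf ii').
have colM i : i \in free_rows l k v -> i != i1 -> M i j1 = - \sum_j base t i j * x j.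
  move=> iF ii; have ki : (n - k <= i)%N by move: iF; rewrite inE => /andP[].
  have := Mx i ki; rewrite (bigD1 j1) //= x1 mulr1 => /eqP; rewrite addr_eq0 => /eqP->.
  rewrite [in RHS](bigD1 j1) //= base_solved ?mem_solved ?iF ?eqxx // mul0r add0r.
  congr (- _); apply: eq_bigr => j jj; rewrite baseM //.
  by rewrite mem_solved (negPf jj) andbF (negPf ii).
have rowM j : j \in free_cols l k v -> j != j1 -> M i1 j = - \sum_i y i * base t i j.
  move=> jF jj; have jk : (j < k)%N by move: jF; rewrite inE => /andP[].
  have := My j jk; rewrite (bigD1 i1) //= y1 mul1r => /eqP; rewrite addr_eq0 => /eqP->.
  rewrite [in RHS](bigD1 i1) //= [base t i1 j]base_solved ?mem_solved ?jF ?eqxx ?orbT //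
    mulr0 add0r.
  congr (- _); apply: eq_bigr => i ii; rewrite baseM //.
  by rewrite mem_solved (negPf jj) andbF (negPf ii).
have chartM i j : (i, j) != (i1, j1) -> chart t (i, j) = M i j.
  move=> ij; have [ijS|ijS] := boolP ((i, j) \in solved); last by rewrite chart_base ?baseM.
  move: ijS ij; rewrite mem_solved xpair_eqE => /orP[/andP[iF /eqP->]|/andP[/eqP-> jF]].
    by rewrite eqxx andbT => ii; rewrite chart_solved_col // xE colM.
  by rewrite eqxx /= => jj; rewrite chart_solved_row // yE rowM.
apply/funext => -[i j]; rewrite /entries /=.
have [[-> ->]|ij] := eqVneq (i, j) (i1, j1); last by rewrite chartM.
have ki : (n - k <= i1)%N by have := ltn_ord k; lia.
have := Mx i1 ki; rewrite (bigD1 j1) //= x1 mulr1 => /eqP; rewrite addr_eq0 => /eqP->.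
rewrite chart_corner xE [in RHS](bigD1 j1) //= fill_corner mul0r add0r; congr (- _).
have neq j' : j' != j1 -> (i1, j') != (i1, j1) by move=> jj; rewrite xpair_eqE (negPf jj) andbF.
by apply: eq_bigr => j' jj; rewrite -chart_fill ?chartM // neq.
Qed.

(** Rows and columns will be paired by position. Listing the high rows first guarantees each of them
    a partner even when the list of columns is the shorter one; likewise for the low columns. *)
Definition row_order := ([seq i <- enum (high_rows l k v) | i != i1] ++
  [seq i <- enum (free_rows l k v) | i \notin high_rows l k v])%SEQ.

Definition col_order := ([seq j <- enum (low_cols l k v) | j != j1] ++
  [seq j <- enum (free_cols l k v) | j \notin low_cols l k v])%SEQ.

(* At the base point the free entries form a partial permutation matrix, so that
   the equations for the solved entries read off [- x_j] and [- y_i]. *)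
Definition base_point (s : J) : C := match s with
  | inl (i, j) => [&& i \in row_order, j \in col_order & index i row_order == index j col_order]%:R
  | _ => 0
  end.

Lemma mem_row_order i : (i \in row_order) = (i \in free_rows l k v) && (i != i1).
Proof.
rewrite mem_cat !mem_filter_enum; have := high_rows_free lk v.
move=> /fintype.subsetP/(_ i); have [->|ii] := eqVneq i i1; first by rewrite i1H andbF.
by case: (i \in high_rows _ _ _) => /= [->|_]; rewrite ?andbT.
Qed.

Lemma mem_col_order j : (j \in col_order) = (j \in free_cols l k v) && (j != j1).
Proof.
rewrite mem_cat !mem_filter_enum; have := low_cols_free lk v.
move=> /fintype.subsetP/(_ j); have [->|jj] := eqVneq j j1; first by rewrite j1L andbF.
by case: (j \in low_cols _ _ _) => /= [->|_]; rewrite ?andbT.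
Qed.

Lemma uniq_row_order : uniq row_order.
Proof.
rewrite cat_uniq; apply/and3P; split;
  [exact/filter_uniq/enum_uniq| |exact/filter_uniq/enum_uniq].
apply/hasPn => i.
by rewrite !mem_filter_enum => /andP[/negPf-> _]; rewrite andbF.
Qed.

Lemma uniq_col_order : uniq col_order.
Proof.
rewrite cat_uniq; apply/and3P; split;
  [exact/filter_uniq/enum_uniq| |exact/filter_uniq/enum_uniq].
apply/hasPn => j.
by rewrite !mem_filter_enum => /andP[/negPf-> _]; rewrite andbF.
Qed.

Lemma size_row_order : (size row_order).+1 = #|free_rows l k v|.
Proof.
rewrite (cardsD1 i1) i1_free add1n -(card_uniqP uniq_row_order); congr _.+1.
by apply: eq_card => i; rewrite mem_row_order finset.in_setD1 andbC.
Qed.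

Lemma size_col_order : (size col_order).+1 = #|free_cols l k v|.
Proof.
rewrite (cardsD1 j1) j1_free add1n -(card_uniqP uniq_col_order); congr _.+1.
by apply: eq_card => j; rewrite mem_col_order finset.in_setD1 andbC.
Qed.

Lemma size_filter_neq (T : finType) (A : {set T}) a : a \in A ->
  (size [seq x <- enum A | x != a]).+1 = #|A|.
Proof.
move=> aA; rewrite (cardsD1 a) aA add1n; congr _.+1.
rewrite -(card_uniqP (filter_uniq _ (enum_uniq A))); apply: eq_card => x.
by rewrite mem_filter_enum finset.in_setD1.
Qed.

Lemma matching_row j : j \in low_cols l k v :\ j1 -> exists i,
  [/\ i \in free_rows l k v, i != i1 &
      forall j', (j' \in col_order) && (index i row_order == index j' col_order) = (j' == j)].
Proof.
rewrite finset.in_setD1 => /andP[jj jL].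
have jO : j \in [seq j <- enum (low_cols l k v) | j != j1] by rewrite mem_filter_enum jj.
have ltj : (index j col_order < size row_order)%N.
  rewrite /col_order index_cat jO; move: jO; rewrite -index_mem => h.
  have := size_filter_neq j1L; have := size_row_order; rewrite card_free_rows //.
  by move: h; move: (size _) (size _) (index _ _) #|_| => a b c d; lia.
exists (nth i1 row_order (index j col_order)).
have := mem_nth i1 ltj; rewrite mem_row_order => /andP[-> ->]; split=> // j'.
rewrite index_uniq ?uniq_row_order //; apply/andP/eqP => [[j'O /eqP e]|->].
  by rewrite -(nth_index j1 j'O) -e nth_index // /col_order mem_cat jO.
by rewrite eqxx /col_order mem_cat jO.
Qed.

Lemma matching_col i : i \in high_rows l k v :\ i1 -> exists j,
  [/\ j \in free_cols l k v, j != j1 &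
      forall i', (i' \in row_order) && (index i' row_order == index j col_order) = (i' == i)].
Proof.
rewrite finset.in_setD1 => /andP[ii iH].
have iO : i \in [seq i <- enum (high_rows l k v) | i != i1] by rewrite mem_filter_enum ii.
have lti : (index i row_order < size col_order)%N.
  rewrite /row_order index_cat iO; move: iO; rewrite -index_mem => h.
  have := size_filter_neq i1H; have := size_col_order; rewrite card_free_cols //.
  by move: h; move: (size _) (size _) (index _ _) #|_| => a b c d; lia.
exists (nth j1 col_order (index i row_order)).
have := mem_nth j1 lti; rewrite mem_col_order => /andP[-> ->]; split=> // i'.
rewrite index_uniq ?uniq_col_order //; apply/andP/eqP => [[i'O /eqP e]|->].
  by rewrite -(nth_index i1 i'O) e nth_index // /row_order mem_cat iO.
by rewrite eqxx /row_order mem_cat iO.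
Qed.

Lemma chart_read_col j : j \in low_cols l k v :\ j1 -> exists i, forall t,
  (forall c, t (inl c) = base_point (inl c)) -> chart t (i, j1) = - t (inr (inl j)).
Proof.
move=> jL; have [i [iF ii iE]] := matching_row jL; exists i => t tb.
have /andP[jj jL'] : (j != j1) && (j \in low_cols l k v) by rewrite -finset.in_setD1.
have iO : i \in row_order by rewrite mem_row_order iF.
have jl : (j <= l)%N by move: jL'; rewrite inE => /andP[].
have li : (l < (v^-1)%g i)%N by move: iF; rewrite inE => /andP[].
have bE j' : (i, j') \in opp_rothe v :\: solved -> base t i j' = (j' == j)%:R.
  by move=> h; rewrite base_free // tb /= iO iE.
rewrite chart_solved_col // (bigD1 j) //= bE ?eqxx; last first.
  by rewrite finset.in_setD mem_solved (negPf jj) (negPf ii) andbF (low_cell lk).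
rewrite mul1r (col_rel_param _ jL) big1 ?addr0 // => j' jj'.
have [lj|j'l] := ltnP l j'; first by rewrite col_rel0 ?mulr0.
have [h|h] := boolP ((i, j') \in opp_rothe v :\: solved).
  by rewrite bE // (negPf jj') mul0r.
rewrite base_eq0 ?mul0r //; apply: contraTneq li => ->.
by rewrite permK -leqNgt.
Qed.

Lemma chart_read_row i : i \in high_rows l k v :\ i1 -> exists j, forall t,
  (forall c, t (inl c) = base_point (inl c)) -> chart t (i1, j) = - t (inr (inr i)).
Proof.
move=> iH; have [j [jF jj jE]] := matching_col iH; exists j => t tb.
have /andP[ii iH'] : (i != i1) && (i \in high_rows l k v) by rewrite -finset.in_setD1.
have jO : j \in col_order by rewrite mem_col_order jF.
have jvl : (v j < n - l.+1)%N by move: jF; rewrite inE => /andP[].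
have bE i' : (i', j) \in opp_rothe v :\: solved -> base t i' j = (i' == i)%:R.
  by move=> h; rewrite base_free // tb /= jO jE.
rewrite chart_solved_row // (bigD1 i) //= bE ?eqxx; last first.
  by rewrite finset.in_setD mem_solved (negPf jj) (negPf ii) andbF (high_cell lk).
rewrite mulr1 (row_rel_param _ iH) big1 ?addr0 // => i' ii'.
have [il|li] := ltnP i' (n - l.+1); first by rewrite row_rel0 ?mul0r.
have [h|h] := boolP ((i', j) \in opp_rothe v :\: solved).
  by rewrite bE // (negPf ii') mulr0.
rewrite base_eq0 ?mulr0 //; apply: contraTneq jvl => <-.
by rewrite -leqNgt.
Qed.

Definition is_cell (s : J) := if s is inl _ then true else false.

(** Coefficients precede cells: they are read off solved entries while all cells keep their base
    values, whereas a cell parameter is an entry of the matrix whatever the other parameters are. *)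
Definition param_order : seq J :=
  ([seq s <- enum chart_params | ~~ is_cell s] ++ [seq s <- enum chart_params | is_cell s])%SEQ.

Lemma size_param_order : size param_order = #|chart_params|.
Proof. by rewrite size_cat !size_filter addnC count_predC cardE. Qed.

Lemma uniq_param_order : uniq param_order.
Proof.
rewrite cat_uniq; apply/and3P; split;
  [exact/filter_uniq/enum_uniq| |exact/filter_uniq/enum_uniq].
by apply/hasPn => s; rewrite !mem_filter_enum => /andP[-> _].
Qed.

Lemma mem_param_order s : s \in param_order -> s \in chart_params.
Proof. by rewrite mem_cat !mem_filter_enum => /orP[]/andP[]. Qed.

Lemma take_param_order m s0 : ~~ is_cell (nth s0 param_order m) -> (m < size param_order)%N ->
  forall c, inl c \notin take m.+1 param_order.
Proof.
rewrite /param_order; set S1 := filter _ _; set S2 := filter _ _ => sN m_lt c.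
have mS1 : (m < size S1)%N.
  rewrite ltnNge; apply: contra sN => S1m; rewrite nth_cat ltnNge S1m /=.
  suff : nth s0 S2 (m - size S1) \in S2 by rewrite mem_filter_enum => /andP[].
  by apply: mem_nth; rewrite ltn_subLR // -size_cat.
rewrite takel_cat //; apply/negP => /mem_take.
by rewrite mem_filter_enum.
Qed.

Lemma param_order_step m : (m < size param_order)%N -> exists ij a,
  (forall t, (forall s, s \notin take m param_order -> t s = base_point s) -> chart t ij = a) /\
  exists2 t, (forall s, s \notin take m.+1 param_order -> t s = base_point s) & chart t ij != a.
Proof.
move=> m_lt; set s0 : J := inr (inl j1); pose s := nth s0 param_order m.
have sO : s \in param_order by apply: mem_nth.
have takeS : take m.+1 param_order = rcons (take m param_order) s by apply: take_nth.
have sN : s \notin take m param_order.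
  by have := take_uniq m.+1 uniq_param_order; rewrite takeS rcons_uniq => /andP[].
pose t1 := update base_point s (base_point s + 1).
have t1N s' : s' \notin take m.+1 param_order -> t1 s' = base_point s'.
  rewrite takeS mem_rcons inE negb_or => /andP[/negPf ss _].
  by rewrite /t1 /update ss.
suff [ij [e [e0 H]]] : exists ij (e : C), e != 0 /\
    forall t, (forall s, s \notin take m.+1 param_order -> t s = base_point s) ->
      chart t ij = e * t s.
  exists ij, (e * base_point s); split=> [t tb|].
    rewrite H => [|s' s'N]; first by rewrite tb.
    by apply: tb; apply: contra s'N; rewrite takeS mem_rcons inE orbC => ->.
  exists t1 => //; rewrite H // /t1 /update eqxx mulrDr mulr1 -subr_eq0 addrAC subrr add0r.
  exact: e0.
have := mem_param_order sO; have : ~~ is_cell s -> forall c, inl c \notin take m.+1 param_order.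
  by move=> sC; apply: take_param_order sC m_lt.
case: (s) => [[i j]|[j|i]].
- rewrite inE => _ ijD; exists (i, j), 1; rewrite oner_eq0; split=> // t _;
    rewrite mul1r chart_base ?base_free //.
  by move: ijD; rewrite finset.in_setD => /andP[].
- rewrite inE => /(_ isT) tN jL; have [i ri] := chart_read_col jL; exists (i, j1), (-1);
    rewrite oppr_eq0 oner_eq0; split=> // t tb.
  by rewrite mulN1r ri // => c; apply: tb.
rewrite inE => /(_ isT) tN iH; have [j rj] := chart_read_row iH; exists (i1, j), (-1);
  rewrite oppr_eq0 oner_eq0; split=> // t tb.
by rewrite mulN1r rj // => c; apply: tb.
Qed.
End Parametrization.

(** Outside the low columns, a pivot row expresses [x j] by the coefficients to its left; a relation
    vanishing on all low columns would therefore vanish. This is why normalizing at low columns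
    suffices. *)
Lemma low_cols_nonzero (M : 'M[C]_n) (x : 'cV_n) : in_slice v M -> x != 0 ->
    (forall j : 'I_n, (l < j)%N -> x j 0 = 0) ->
    (forall i : 'I_n, (n - k <= i)%N -> (M *m x) i 0 = 0) ->
  exists2 j, j \in low_cols l k v & x j 0 != 0.
Proof.
move=> [M1 M0] x0 xl Mx; apply: contrapT => H; case/eqP: x0; apply/colP => j; rewrite [RHS]mxE.
have [m] := ubnP (j : nat); elim: m j => // m IH j jm.
have [lj|jl] := ltnP l j; first exact: xl.
have [vj|kv] := ltnP (v j) (n - k).
  by apply: contrapT => /eqP xj; apply: H; exists j; rewrite // inE jl.
have := Mx (v j) kv; rewrite mxE (bigD1 j) //= M1 mul1r big1 ?addr0 // => j' jj.
have [j'j|jj'] := ltnP j' j; first by rewrite IH ?mulr0 //; lia.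
suff -> : M (v j) j' = 0 by rewrite mul0r.
apply/eqP/negPn/negP => /M0[/perm_inj e|]; first by rewrite e eqxx in jj.
by rewrite inE /= permK (ltnNge j') jj' andbF.
Qed.

Lemma high_rows_nonzero (M : 'M[C]_n) (y : 'rV_n) : in_slice v M -> y != 0 ->
    (forall i : 'I_n, (i < n - l.+1)%N -> y 0 i = 0) ->
    (forall j : 'I_n, (j < k)%N -> (y *m M) 0 j = 0) ->
  exists2 i, i \in high_rows l k v & y 0 i != 0.
Proof.
move=> [M1 M0] y0 yl My; apply: contrapT => H; case/eqP: y0; apply/rowP => i; rewrite [RHS]mxE.
have [m] := ubnP (n - i); elim: m i => // m IH i im.
have [il|li] := ltnP i (n - l.+1); first exact: yl.
have [kv|vk] := leqP k ((v^-1)%g i).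
  by apply: contrapT => /eqP yi; apply: H; exists i; rewrite // inE li.
have := My _ vk; rewrite mxE (bigD1 i) //= -{2}(permKV v i) M1 mulr1 big1 ?addr0 // => i' ii.
have [i'i|ii'] := ltnP i i'; first by rewrite IH ?mul0r //; have := ltn_ord i'; lia.
suff -> : M i' ((v^-1)%g i) = 0 by rewrite mulr0.
apply/eqP/negPn/negP => /M0[e|]; first by rewrite e permKV eqxx in ii.
by rewrite inE /= permKV (ltnNge i) ii'.
Qed.

Lemma slice_chart (M : 'M[C]_n) : in_slice v M -> col_dependent l k M -> row_dependent l k M ->
  exists i1 j1, [/\ i1 \in high_rows l k v, j1 \in low_cols l k v & exists t, entries M = chart i1 j1 t].
Proof.
move=> MS [x x0 [xl Mx]] [y y0 [yl My]].
have [j1 j1L xj1] := low_cols_nonzero MS x0 xl Mx.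
have [i1 i1H yi1] := high_rows_nonzero MS y0 yl My.
exists i1, j1; split=> //; eexists.
apply: (@entries_chart i1 j1 j1L i1H M (fun j => x j 0 / x j1 0) (fun i => y 0 i / y 0 i1)) => //.
- by rewrite divff.
- by move=> j lj; rewrite xl // mul0r.
- move=> i ki; under eq_bigr => j _ do rewrite mulrA.
  by rewrite -mulr_suml; have := Mx i ki; rewrite mxE => ->; rewrite mul0r.
- by rewrite divff.
- by move=> i il; rewrite yl // mul0r.
- move=> j jk; under eq_bigr => i _ do rewrite mulrAC.
  by rewrite -mulr_suml; have := My j jk; rewrite mxE => ->; rewrite mul0r.
Qed.
End Chart.

(** * Dimension and complexity *)

Theorem krull_dim_kl_variety (R : realType) n (l k : 'I_n) (v w : 'S_n) :
    (l < k)%N -> w = perm_comp w0 (tperm l k) -> below l k v ->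
  (krull_dim (@zariski_closed_flag R n) (kl_variety v w) + (2 * (k - l)).-1 = #|opp_rothe v|)%N.
Proof.
move=> lk wE vb.
have klS : kl_variety v w `<=` @opp_schubert_cell R n v by move=> x [].
have /card_gt0P[j1 j1L] := low_cols_gt0 vb.
have /card_gt0P[i1 i1H] := high_rows_gt0 vb.
set d := krull_dim _ _; rewrite -(card_chart_params lk j1L i1H); congr (_ + _)%N.
have upper_bound m : irreducible_chain (@zariski_closed_flag R n) (kl_variety v w) m ->
    (m <= #|chart_params l k v i1 j1|)%N.
  apply: (@irreducible_chain_bound _ _ v (kl_variety v w) _ _
    (enum (finset.setX (high_rows l k v) (low_cols l k v)))
    (fun c => chart_params l k v c.1 c.2) (fun c => @chart R n l k v c.1 c.2) _ m klS).
  - by move=> c x; apply: polyfun_chart.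
  - by move=> c t t' tt'; apply: chart_ext.
  - move=> [i j] /In_mem; rewrite fintype.mem_enum finset.in_setX /= => /andP[iH jL].
    (* The number of parameters is the same in all charts, because the count depends only on [v],
       [k] and [l]. *)
    by have := card_chart_params lk jL iH; rewrite -(card_chart_params lk j1L i1H) => /addIn ->.
  - move=> M MS /(kl_variety_dependent lk wE MS)[Mc Mr].
    have [i [j [iH jL [t e]]]] := slice_chart lk MS Mc Mr.
    by exists (i, j); [apply/In_mem; rewrite fintype.mem_enum finset.in_setX iH|exists t].
have lower_bound : irreducible_chain (@zariski_closed_flag R n) (kl_variety v w)
    #|chart_params l k v i1 j1|.
  rewrite -(size_param_order l k v i1 j1).
  apply: (irreducible_chain_exists (phi := @chart R n l k v i1 j1)
    (t0 := @base_point R n l k v i1 j1) klS).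
  - exact: polyfun_chart.
  - move=> t; exists (\matrix_(i, j) @chart R n l k v i1 j1 t (i, j)); first exact: chart_slice.
    split; last by apply/funext => -[i j]; rewrite /entries mxE.
    apply/(kl_variety_dependent lk wE); first exact: chart_slice.
    exact: chart_dependent.
  - by move=> m m_lt; apply: param_order_step.
(* The two bounds exhibit a greatest length, so [get] returns a value with the defining property. *)
have [d_chain d_max] : irreducible_chain (@zariski_closed_flag R n) (kl_variety v w) d /\
    forall m, irreducible_chain (@zariski_closed_flag R n) (kl_variety v w) m -> (m <= d)%N.
  exact: (@getI nat (fun d => irreducible_chain (@zariski_closed_flag R n) (kl_variety v w) d /\
    forall m, irreducible_chain (@zariski_closed_flag R n) (kl_variety v w) m -> (m <= d)%N)
    _ (conj lower_bound upper_bound)).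
by apply/eqP; rewrite eqn_leq upper_bound ?d_max.
Qed.

Local Close Scope classical_set_scope.
Unset Implicit Arguments.

(* l, k and the cells (a1, b1), (a2, b2) are 0-based: with L = l + 1 and
   K = k + 1 these cells are (n-K+2, L) and (n-L+1, K-1) shifted by one, and
   L - 1 is l. *)
Theorem proposition4p14 (R : realType) (n : nat) (l k : 'I_n) (hlk : (l < k)%N)
    (w : 'S_n) (hw : w = perm_comp w0 (tperm l k))
    (v : 'S_n) (hv : bruhat_lt v w) :
  let a1 : nat := (n - k)%N in
  let b1 : nat := l in
  let a2 : nat := (n - l.+1)%N in
  let b2 : nat := k.-1 in
  let p : int := complexity R v w in
  let nu : int := cyclomatic (graph_edges v w) in
  let Dw : int := #|opp_rothe w|%:Z in
  [/\ forall i j : 'I_n, ((i, j) \in ess w) =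
        ((nat_of_ord i, nat_of_ord j) \in [:: (a1, b1); (a2, b2)]),
      (sw_rank v a1 b1 < l)%N -> (sw_rank v a2 b2 < l)%N ->
        p = nu - Dw /\
        nu - Dw = #|P_set v|%:Z - 2 * (k%:Z - l%:Z) + 1,
      (sw_rank v a1 b1 = l /\ (sw_rank v a2 b2 < l)%N) \/
      ((sw_rank v a1 b1 < l)%N /\ sw_rank v a2 b2 = l) ->
        p = nu - Dw + (k%:Z - l%:Z) /\
        nu - Dw + (k%:Z - l%:Z) = nu + l%:Z - k%:Z + 1
    & sw_rank v a1 b1 = l -> sw_rank v a2 b2 = l ->
        p = nu /\
        (is_toric R v w <-> is_forest (graph_edges v w))].
Proof.
move=> a1 b1 a2 b2 p nu Dw.
have vb : below l k v by rewrite -(bruhat_le_below hlk hw); case/andP: hv.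
have DwE : Dw = 2 * (k%:Z - l%:Z) - 1.
  by rewrite /Dw (card_opp_rothe_w hlk hw); lia.
have cW : (#|weight_cells v w| + #|violating l k v| = #|opp_rothe v|)%N.
  rewrite (weight_cellsE hlk hw vb) -(cardsID (violating l k v) (opp_rothe v)) addnC.
  congr (_ + _)%N; apply: eq_card => c; rewrite finset.in_setI andb_idl //.
  by rewrite inE => /andP[].
(* The variety has dimension [|D(v)| - |D(w)|], the cone has dimension [n - c], and
   [nu = |E| - n + c] with [|E| = |D(v)| - #|violating l k v|]. *)
have pE : p = nu - Dw + #|violating l k v|%:Z.
  have := krull_dim_kl_variety R hlk hw vb.
  have := cone_dim_weight_cone R v w; have := card_graph_edges v w.
  rewrite DwE /p /nu /complexity /cyclomatic card_ord.
  move: (n_comp _ _) (krull_dim _ _) (cone_dim _) #|graph_edges v w| cW hlk.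
  move: #|weight_cells v w| #|violating l k v| #|opp_rothe v|.
  by clear; lia.
have nuE : is_forest (graph_edges v w) <-> nu = 0.
  rewrite is_forestE => [|a b abE].
    rewrite /nu /cyclomatic card_ord.
    move: (n_comp _ _) #|graph_edges v w| => c e; clear; lia.
  have ab := graph_edges_oriented abE; rewrite neq_ltn ab /=;
    apply/negP => /graph_edges_oriented.
  by lia.
have cV := card_violating hlk vb.
(* Rank and number of witnesses add up to [l + 1], so rank [l] means a single witness. *)
have low1 : (#|low_cols l k v| == 1%N) = (sw_rank v a1 b1 == l).
  by have := card_low_cols l k v; rewrite -/a1 -/b1; lia.
have high1 : (#|high_rows l k v| == 1%N) = (sw_rank v a2 b2 == l).
  by have := card_high_rows hlk v; rewrite -/a2 -/b2; lia.
rewrite low1 high1 in cV.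
split.
- by move=> i j; rewrite (mem_ess_w hlk hw).
- move=> r1 r2; rewrite !ltn_eqF // in cV.
  rewrite pE cV addr0; split=> //.
  (* No bound is tight, so no cell is missing and the graph is the whole noninversion graph. *)
  have -> : nu = #|P_set v|%:Z.
    rewrite -cyclomatic_rothe_edges /nu; congr cyclomatic.
    rewrite /graph_edges /rothe_edges (weight_cellsE hlk hw vb).
    by rewrite (cards0_eq cV) finset.setD0.
  by rewrite DwE; lia.
- move=> H; have cV' : #|violating l k v| = (k - l)%N.
    rewrite cV; case: H => -[r1 r2].
      by rewrite r1 eqxx (ltn_eqF r2).
    by rewrite r2 eqxx (ltn_eqF r1).
  by rewrite pE DwE cV'; lia.
- move=> r1 r2; rewrite r1 r2 !eqxx in cV.
  have p_nu : p = nu by rewrite pE cV DwE; lia.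
  by split=> //; rewrite nuE /is_toric -/p p_nu.
Qed.
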